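(* Let $0<r\le1$ and let assumption (P) of the context hold. Suppose that $\hat\sigma_n/\alpha_n\to0$, $\hat\beta^{(2+r)}_n/\hat\sigma_n^{2+r}\to0$ and $\hat\sigma_n=O(\hat\gamma_n)$ as $n\to\infty$, and that $\xi_n$ is uniformly bounded. Put $$\varepsilon_n=\Bigl(\frac{\hat\sigma_n}{\alpha_n}\Bigr)^2+\frac1{\alpha_n}+\frac{\hat\beta^{(2+r)}_n}{\hat\sigma_n^{2+r}}\Bigl(\frac{\hat\sigma_n}{\alpha_n}\Bigr)^{2+r}+\frac{\hat\beta^{(2+r)}_n}{\hat\sigma_n^{2+r}}\Bigl(\frac{\hat\sigma_n}{\alpha_n}\Bigr)^{\xi_n-1}.$$ Then: (i) for any integers $q_1,\dots,q_n\ge0$ with $q_1+\cdots+q_n=m_n$, $$\mathbb P(Q_{1,n}=q_1,\dots,Q_{n,n}=q_n)=\frac{\alpha_n\Gamma(\xi_n)}{e^{-\xi_n}\xi_n^{\xi_n-1}}\prod_{k=1}^n\mathbb P(X_{k,n}=q_k)\,[1+O(\varepsilon_n)];$$ (ii) for any finite $\ell$ such that $\mathcal F^0_n\cap[1,\ell]=\emptyset$, $$\mathbb P(Q_{1,n}=q_1,\dots,Q_{\ell,n}=q_\ell)=\prod_{k=1}^\ell\mathbb P(X_{k,n}=q_k)\Bigl[1+O(\varepsilon_n)+O\Bigl(\frac{\sum_{k=1}^\ell(m_{k,n}-q_k)}{\alpha_n}\Bigr)\Bigr];$$ (iii) for any $j\notin\mathcal F^0_n$, $$\mathbb E Q_{j,n}=\mathbb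 E X_{j,n}\Bigl[1+O(\varepsilon_n)+O\Bigl(\frac{\sigma_{j,n}^2+m_{j,n}^2}{m_{j,n}\alpha_n}\Bigr)\Bigr];$$ (iv) for any $j\in\mathcal F^0_n$, $$\mathbb E Q_{j,n}=\mathbb E X_{j,n}\,[1+O(\varepsilon_n)].$$
   Context: Networks. For each $n\ge1$, $\mathcal C_n$ is a closed network with $n$ queues and $m_n$ customers. Queue $k$ ($1\le k\le n$) has service rate $\mu_{k,n}(q)>0$ when it contains $q\ge1$ customers. The routing matrix $P_n$ is ergodic with invariant probability $\pi_n=(\pi_{1,n},\dots,\pi_{n,n})$. The stationary queue lengths $Q_{1,n},\dots,Q_{n,n}$ have the product-form law: for integers $q_k\ge0$ with $q_1+\cdots+q_n=m_n$, $$\mathbb P(Q_{1,n}=q_1,\dots,Q_{n,n}=q_n)=\frac1{Z_{m_n,n}}\prod_{k=1}^n\frac{\pi_{k,n}^{q_k}}{\mu_{k,n}(1)\cdots\mu_{k,n}(q_k)},$$ with $Z_{m_n,n}$ the normalizing constant. Put $f_{k,n}(z)=\sum_{q\ge0}\frac{z^q}{\mu_{k,n}(1)\cdots\mu_{k,n}(q)}$. For each $n$, at least one $f_{k,n}$ has a singularity at finite distance. Associated independent variables. For admissible $\lambda>0$, let $X_{1,n}(\lambda),\dots,X_{n,n}(\lambda)$ be independent with $\mathbb P(X_{k,n}(\lambda)=x)=\frac{1}{f_{k,n}(\lambda\pi_{k,n})}\frac{(\lambda\pi_{k,n})^x}{\mu_{k,n}(1)\cdots\mu_{k,n}(x)}$,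 $x\ge0$. Let $\lambda_n$ be the unique value with $\sum_{k=1}^n\mathbb E X_{k,n}(\lambda_n)=m_n$, and write $X_{k,n}=X_{k,n}(\lambda_n)$, $m_{k,n}=\mathbb E X_{k,n}$, $\beta^{(s)}_{k,n}=\mathbb E|X_{k,n}-m_{k,n}|^s$ (assumed finite where used), $\sigma^2_{k,n}=\beta^{(2)}_{k,n}$, $\phi_{k,n}(\theta)=\mathbb E e^{\mathrm i(X_{k,n}-m_{k,n})\theta}$, and, with $p_i=\mathbb P(X_{k,n}=i)$, $\gamma^2_{k,n}=\sum_{i\ge0}\frac{p_{2i}p_{2i+1}}{p_{2i}+p_{2i+1}}$ (zero summands when $p_{2i}=p_{2i+1}=0$). Assumption (P). There are numbers $\rho^0_n\in[0,1)$ and nonempty sets $\mathcal F^0_n\subset\{1,\dots,n\}$ of ''saturable'' queues such that, with $\omega_n(\theta)=\frac{1-\rho^0_n}{1-\rho^0_ne^{\mathrm i\theta}}$, for all $k\in\mathcal F^0_n$ there exist a real number $\xi_{k,n}$ and a function $\psi_{k,n}$ with $\phi_{k,n}(\theta)=e^{-\mathrm i m_{k,n}\theta}\,\omega_n(\theta)^{\xi_{k,n}}\,\psi_{k,n}(\theta)$; moreover $\psi_{k,n}'(\theta)=O(1)$ uniformly in $k$ and $n$, and there is a constant $\xi_{\max}$ with $1\le\xi_{k,n}<\xi_{\max}<\infty$. Further notation. $\alpha_n=\frac{\rho^0_n}{1-\rho^0_n}$, $\xi_n=\sum_{k\in\mathcal F^0_n}\xi_{k,n}$, and, with sums over $k\in\{1,\dots,n\}\setminus\mathcal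 F^0_n$: $\hat\sigma_n^2=\sum_k\sigma_{k,n}^2$, $\hat\beta^{(2+r)}_n=\sum_k\beta^{(2+r)}_{k,n}$, $\hat\gamma_n^2=\sum_k\gamma_{k,n}^2$. Asymptotic notation. $a(\eta)=O(b(\eta))$ iff there is $K>0$ with $|a(\eta)|\le K|b(\eta)|$ for all $\eta$; all bounds are uniform in $n$ and in queue indices. *)

(* Defs.v *)
(* Stdlib/Coquelicot analysis on R; finite index types, finite sets and big
   operators from MathComp. Queues are indexed from 0 by 'I_n. *)
From Stdlib Require Export Reals Relations.
From Coquelicot Require Export Coquelicot.
From mathcomp Require Export all_boot.

Set Implicit Arguments.
Unset Strict Implicit.
Unset Printing Implicit Defensive.

Global Open Scope R_scope.

(** * Closed product-form networks *)

Record network (n : nat) : Type := Network {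
  customers : nat;
  rate : 'I_n -> nat -> R;        (* rate k q is only meaningful for q >= 1 *)
  routing : 'I_n -> 'I_n -> R;
  inv_law : 'I_n -> R
}.

Definition stochastic (n : nat) (P : 'I_n -> 'I_n -> R) : Prop :=
  (forall i j, 0 <= P i j) /\
  (forall i, \big[Rplus/0]_(j < n) P i j = 1).

(* On a finite state space this is irreducibility; aperiodicity is not
   required, so periodic (e.g. cyclic) routings are allowed. *)
Definition ergodic (n : nat) (P : 'I_n -> 'I_n -> R) : Prop :=
  stochastic P /\
  forall i j, clos_refl_trans 'I_n (fun a b => 0 < P a b) i j.

Definition invariant_probability (n : nat) (P : 'I_n -> 'I_n -> R)
    (p : 'I_n -> R) : Prop :=
  (forall k, 0 <= p k) /\
  \big[Rplus/0]_(k < n) p k = 1 /\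
  (forall j, \big[Rplus/0]_(i < n) (p i * P i j) = p j).

(* coef N k q = 1 / (mu_k(1) ... mu_k(q)) *)
Definition coef (n : nat) (N : network n) (k : 'I_n) (q : nat) : R :=
  / \big[Rmult/1]_(1 <= i < q.+1) rate N k i.

Definition gen_fun (n : nat) (N : network n) (k : 'I_n) (z : R) : R :=
  PSeries (coef N k) z.

(* Last clause: a sum of a power series has a singularity at finite distance
   exactly when its radius of convergence is finite. *)
Definition closed_network (n : nat) (N : network n) : Prop :=
  (forall k q, (1 <= q)%N -> 0 < rate N k q) /\
  ergodic (routing N) /\
  invariant_probability (routing N) (inv_law N) /\
  (exists k, CV_radius (coef N k) <> p_infty).

(** ** Stationary queue lengths *)

Definition weight (n : nat) (N : network n) (q : 'I_n -> nat) : R :=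
  \big[Rmult/1]_(k < n) (inv_law N k ^ q k * coef N k (q k)).

(* A queue never holds more than all the customers, so the configurations of
   the network are among the finite functions 'I_n -> {0, ..., customers}. *)
Definition config (n : nat) (N : network n) : finType :=
  {ffun 'I_n -> 'I_(customers N).+1}.

Definition Zpart (n : nat) (N : network n) : R :=
  \big[Rplus/0]_(c : config N | (\sum_(k < n) c k)%N == customers N)
    weight N (fun k => c k).

(* P(Q_1 = q_1, ..., Q_n = q_n) *)
Definition Q_law (n : nat) (N : network n) (q : 'I_n -> nat) : R :=
  if (\sum_(k < n) q k)%N == customers N then weight N q / Zpart N else 0.

(* P(Q_1 = q_1, ..., Q_l = q_l); only the values q k with k < l matter *)
Definition Q_marginal (n : nat) (N : network n) (l : nat) (q : 'I_n -> nat)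
    : R :=
  \big[Rplus/0]_(c : config N | [forall k : 'I_n, (k < l)%N ==> (c k == q k :> nat)])
    Q_law N (fun k => c k).

Definition Q_mean (n : nat) (N : network n) (j : 'I_n) : R :=
  \big[Rplus/0]_(c : config N) (INR (c j) * Q_law N (fun k => c k)).

(** ** Associated independent variables *)

Definition X_pmf (n : nat) (N : network n) (lam : R) (k : 'I_n) (x : nat) : R :=
  / gen_fun N k (lam * inv_law N k) * ((lam * inv_law N k) ^ x * coef N k x).

Definition X_E (n : nat) (N : network n) (lam : R) (k : 'I_n) (g : nat -> R)
    : R :=
  Series (fun x => X_pmf N lam k x * g x).

Definition X_mean (n : nat) (N : network n) (lam : R) (k : 'I_n) : R :=
  X_E N lam k INR.

Definition admissible (n : nat) (N : network n) (lam : R) : Prop :=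
  0 < lam /\ forall k, ex_pseries (coef N k) (lam * inv_law N k).

(* There is at most one such lam, the means being strictly increasing in it. *)
Definition mean_parameter (n : nat) (N : network n) (lam : R) : Prop :=
  admissible N lam /\
  (forall k, ex_series (fun x => X_pmf N lam k x * INR x)) /\
  \big[Rplus/0]_(k < n) X_mean N lam k = INR (customers N).

(* y^s for y >= 0 and s > 0; the library's Rpower 0 s is 1, not 0 *)
Definition power0 (y s : R) : R :=
  if Req_EM_T y 0 then 0 else Rpower y s.

(* beta_k^(s) = E |X_k - m_k|^s *)
Definition abs_moment (n : nat) (N : network n) (lam s : R) (k : 'I_n) : R :=
  X_E N lam k (fun x => power0 (Rabs (INR x - X_mean N lam k)) s).

Definition abs_moment_finite (n : nat) (N : network n) (lam s : R) (k : 'I_n)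
    : Prop :=
  ex_series (fun x =>
    X_pmf N lam k x * power0 (Rabs (INR x - X_mean N lam k)) s).

Definition variance (n : nat) (N : network n) (lam : R) (k : 'I_n) : R :=
  abs_moment N lam 2 k.

(* All p_i are positive here, so no summand has a zero denominator. *)
Definition gamma2 (n : nat) (N : network n) (lam : R) (k : 'I_n) : R :=
  let p := X_pmf N lam k in
  Series (fun i => p (2 * i)%N * p (2 * i).+1 / (p (2 * i)%N + p (2 * i).+1)).

(* e^{it} *)
Definition cis (t : R) : C := (cos t, sin t).

(* phi_k(theta) = E e^{i (X_k - m_k) theta}, componentwise *)
Definition char_fun (n : nat) (N : network n) (lam : R) (k : 'I_n) (theta : R)
    : C :=
  let e x := cis ((INR x - X_mean N lam k) * theta) in
  (X_E N lam k (fun x => fst (e x)), X_E N lam k (fun x => snd (e x))).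

(** * Saturable queues *)

(* Principal power z^s on the half-plane Re z > 0, where the principal argument
   is atan (Im z / Re z); omega rho maps R into this half-plane if
   0 <= rho < 1. *)
Definition Cpower (z : C) (s : R) : C :=
  (RtoC (Rpower (Cmod z) s) * cis (s * atan (snd z / fst z)))%C.

Definition omega (rho theta : R) : C :=
  (RtoC (1 - rho) / (RtoC 1 - RtoC rho * cis theta))%C.

Definition assumption_P (N : forall n, network n) (lam rho0 : nat -> R)
    (F0 : forall n, {set 'I_n}) (xi : forall n, 'I_n -> R)
    (psi : forall n, 'I_n -> R -> C) : Prop :=
  (forall n, (1 <= n)%N -> 0 <= rho0 n < 1) /\
  (forall n, (1 <= n)%N -> F0 n != set0) /\
  (forall n (k : 'I_n) theta, k \in F0 n ->
     char_fun (N n) (lam n) k theta =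
     (cis (- (X_mean (N n) (lam n) k * theta))
      * Cpower (omega (rho0 n) theta) (xi n k) * psi n k theta)%C) /\
  (exists K, 0 < K /\
     forall n (k : 'I_n) theta, k \in F0 n ->
       exists d : C, is_derive (V := C_R_NormedModule) (psi n k) theta d /\
                     Cmod d <= K) /\
  (exists xi_max, forall n (k : 'I_n), k \in F0 n -> 1 <= xi n k < xi_max).

Definition alpha (rho : R) : R := rho / (1 - rho).

Definition xi_sum (n : nat) (F : {set 'I_n}) (xi : 'I_n -> R) : R :=
  \big[Rplus/0]_(k in F) xi k.

(** Sums over the queues outside the saturable set F *)

Definition sigma_hat (n : nat) (N : network n) (lam : R) (F : {set 'I_n}) : R :=
  sqrt (\big[Rplus/0]_(k < n | k \notin F) variance N lam k).

Definition beta_hat (n : nat) (N : network n) (lam : R) (F : {set 'I_n})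
    (s : R) : R :=
  \big[Rplus/0]_(k < n | k \notin F) abs_moment N lam s k.

Definition gamma_hat (n : nat) (N : network n) (lam : R) (F : {set 'I_n}) : R :=
  sqrt (\big[Rplus/0]_(k < n | k \notin F) gamma2 N lam k).

(* beta_hat^(2+r) / sigma_hat^(2+r) *)
Definition lyapunov (n : nat) (N : network n) (lam : R) (F : {set 'I_n})
    (r : R) : R :=
  beta_hat N lam F (2 + r) / Rpower (sigma_hat N lam F) (2 + r).

Definition eps (n : nat) (N : network n) (lam rho : R) (F : {set 'I_n})
    (xi : 'I_n -> R) (r : R) : R :=
  let t := sigma_hat N lam F / alpha rho in
  t ^ 2 + 1 / alpha rho
  + lyapunov N lam F r * Rpower t (2 + r)
  + lyapunov N lam F r * Rpower t (xi_sum F xi - 1).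

(* The n for which the quotients in the hypotheses and in eps make sense. *)
Definition nondegenerate (n : nat) (N : network n) (lam rho : R)
    (F : {set 'I_n}) : Prop :=
  0 < alpha rho /\ 0 < sigma_hat N lam F.

(* Euler's Gamma function at x > 0 *)
Definition Gamma (x : R) : R :=
  RInt_gen (fun t => Rpower t (x - 1) * exp (- t))
           (at_right 0) (Rbar_locally p_infty).

(* Main.v *)
Require Import Defs.
From Stdlib Require Import Lra Lia FunctionalExtensionality.
From HB Require Import structures.

(** The stationary law is that of the independent variables [X_k] conditioned on
their sum: [P(Q = q) = prod_k P(X_k = q_k) / P(S = M)], where [S] is the sum and
[M], the number of customers, is its mean. A marginal law or a mean involves in
addition the law of the sum of the queues that remain when some are removed. The
theorem is therefore a local limit theorem, with a rate, for such sums.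

The transform of the sum over the saturable queues is [omega^xi Psi]: the
transform of a negative binomial law of exponent [xi = xi_n], times a Lipschitz
factor [Psi] equal to 1 at the origin. The other queues add an independent sum
of standard deviation [sigma], small compared with [alpha]. Hence [S / alpha] is
close to a Gamma variable of parameter [xi], and [alpha P(S = M)] is close to
its density at the mean, [g = xi^(xi - 1) e^(- xi) / Gamma xi]: the factor in (i)
is [alpha / g].

The main term is the one with [Psi] replaced by 1. Near [xi alpha] the negative
binomial probabilities are [g / alpha] up to a linear term and an error of the
second order ([negative_binomial_limit]); this rests on two-sided bounds on
quotients of values of [Gamma], obtained by integrating tangent lines. Averaged
over the independent sum, the linear term disappears by centring and the second
order gives [(sigma / alpha)^2 + 1 / alpha] ([main_term]).

The factor [Psi] changes a coefficient by the integral of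
[omega^xi (Psi - 1) phi], where [phi] is the transform of the independent sum.
Here [|omega| <= C / (1 + alpha t)] and [|Psi - 1| <= K t], so the integrand is at
most of order [(1 + alpha t)^(1 - xi) exp (- c sigma^2 t^2) / alpha]. For
[xi <= 3/2] the Gaussian factor makes the integral of order
[(sigma / alpha)^(xi - 1) / sigma] relatively to the main term
([perturbation_small_exponent]). For [xi >= 3/2] one first multiplies the
coefficient by the distance from the position to the mean of the independent
sum, of order [alpha]; this differentiates the transform, which turns the factor
[K t] into a constant, and leaves a relative error of order [1 / alpha]
([perturbation_large_exponent]). Together these give [uniform_local_limit].

The remaining points are the following. The decay [exp (- c sigma^2 t^2)] comes
from [gamma^2]: each pair of neighbouring atoms shortens the transform
([FT_decay]), and by the Lyapunov condition no bounded number of queues carries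
a sizable part of the variance, so that some can be removed. The error
[1 / sigma] is at most a multiple of the Lyapunov ratio, because integer-valued
variables cannot concentrate ([inv_sigma_le]). The mean of a non-saturable queue
follows by summing over its length. For a saturable one the length is too large
for that; instead the identity [i nb_e(i) = e ((1 + alpha) nb_(e + 1)(i) -
nb_e(i))] for negative binomial laws expresses its size-biased law, once the
other queues are added, through laws of total exponents [xi] and [xi + 1]. Their
Gamma densities agree at [xi], and the remainder again decays in Fourier space
([size_bias_remainder_decay]). All constants depend on the uniform bounds of the
hypotheses only ([network_estimates], [network_relative_errors]), and the
finitely many networks that precede the asymptotic regime are absorbed in the
final constants. *)

Set Implicit Arguments.
Unset Strict Implicit.
Unset Printing Implicit Defensive.

(** * Absolutely summable sequences and convolution *)

Definition summable (a : nat -> R) : Prop := ex_series (fun x => Rabs (a x)).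

Definition conv (a b : nat -> R) (n : nat) : R :=
  sum_f_R0 (fun k => a k * b (n - k)%N) n.

Lemma summable_le (a b : nat -> R) :
  (forall x, Rabs (a x) <= b x) -> ex_series b -> summable a.
Proof.
move=> le_ab; apply: ex_series_le => x.
by rewrite /norm /= /abs /= Rabs_Rabsolu.
Qed.

Lemma summable_ex (a : nat -> R) : summable a -> ex_series a.
Proof. exact: ex_series_Rabs. Qed.

Lemma ex_series_nonneg_summable (a : nat -> R) :
  (forall x, 0 <= a x) -> ex_series a -> summable a.
Proof.
move=> a_ge0; apply: summable_le => x; rewrite Rabs_pos_eq //; exact: Rle_refl.
Qed.

Lemma ex_series_bounded (a b : nat -> R) :
  (forall x, Rabs (a x) <= b x) -> ex_series b -> ex_series a.
Proof. by move=> le_ab ex_b; apply: summable_ex; apply: summable_le ex_b. Qed.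

Lemma Series_abs_le (a b : nat -> R) :
  (forall x, Rabs (a x) <= b x) -> ex_series b -> Rabs (Series a) <= Series b.
Proof.
move=> le_ab ex_b; have sa := summable_le le_ab ex_b.
apply: Rle_trans (Series_Rabs _ sa) _.
by apply: Series_le => // x; split; [exact: Rabs_pos | exact: le_ab].
Qed.

Lemma Series_zero : Series (fun=> 0) = 0.
Proof. by rewrite (Series_ext _ (fun=> 0 * 0)) ?Series_scal_l => *; ring. Qed.

Lemma Series_ge0 (a : nat -> R) :
  ex_series a -> (forall x, 0 <= a x) -> 0 <= Series a.
Proof.
move=> ex_a a_ge0; rewrite -Series_zero.
by apply: Series_le => // x; split; [exact: Rle_refl | exact: a_ge0].
Qed.

Lemma Series_monotone (a b : nat -> R) :
  ex_series a -> ex_series b -> (forall x, a x <= b x) -> Series a <= Series b.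
Proof.
move=> ex_a ex_b le_ab.
suff: 0 <= Series (fun x => b x - a x) by rewrite Series_minus //; lra.
apply: Series_ge0 => [|x]; first exact: ex_series_minus.
have := le_ab x; lra.
Qed.

Lemma Series_ge_term (a : nat -> R) (i : nat) :
  ex_series a -> (forall x, 0 <= a x) -> a i <= Series a.
Proof.
move=> ex_a a_ge0.
rewrite (Series_incr_n a i.+1) //; last by lia.
have: 0 <= Series (fun k => a (i.+1 + k)%coq_nat).
  by apply: Series_ge0 => [|x]; [rewrite -ex_series_incr_n | exact: a_ge0].
have: 0 <= sum_f_R0 a i - a i.
  case: i => [|i] /=; first lra.
  have := cond_pos_sum a i a_ge0; lra.
rewrite /=; lra.
Qed.

Lemma is_series_finite (a : nat -> R) (M : nat) :
  (forall x, (M < x)%N -> a x = 0) -> is_series a (sum_f_R0 a M).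
Proof.
move=> a0; apply: is_lim_seq_ext_loc (is_lim_seq_const (sum_f_R0 a M)).
exists M => n /leP le_Mn; rewrite sum_n_Reals.
elim: n le_Mn => [|n IH]; first by rewrite leqn0 => /eqP ->.
rewrite leq_eqVlt => /predU1P[-> //|lt_Mn] /=.
by rewrite a0 // -IH // Rplus_0_r.
Qed.

Lemma is_series_conv (a b : nat -> R) :
  summable a -> summable b -> is_series (conv a b) (Series a * Series b).
Proof.
move=> sa sb; apply: is_series_mult => //; apply: Series_correct;
  exact: summable_ex.
Qed.

Lemma Series_conv (a b : nat -> R) :
  summable a -> summable b -> Series (conv a b) = Series a * Series b.
Proof. by move=> sa sb; apply: is_series_unique; apply: is_series_conv. Qed.

Lemma summable_conv (a b : nat -> R) :
  summable a -> summable b -> summable (conv a b).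
Proof.
move=> sa sb.
apply: (@summable_le _ (conv (fun x => Rabs (a x)) (fun x => Rabs (b x)))).
  move=> x; apply: Rle_trans (Rsum_abs _ _) _; apply: Req_le.
  by rewrite /conv; apply: PartSum.sum_eq => i _; rewrite Rabs_mult.
have sabs c : summable c -> summable (fun x => Rabs (c x)).
  by move=> sc; apply: summable_le sc => x; rewrite Rabs_Rabsolu; apply: Rle_refl.
by eexists; apply: is_series_conv; apply: sabs.
Qed.

Lemma conv_ge0 (a b : nat -> R) :
  (forall x, 0 <= a x) -> (forall x, 0 <= b x) -> forall x, 0 <= conv a b x.
Proof. by move=> a0 b0 x; apply: cond_pos_sum => i; apply: Rmult_le_pos. Qed.

Lemma conv_local (a b a' b' : nat -> R) (M : nat) :
  (forall x, (x <= M)%N -> a x = a' x) -> (forall x, (x <= M)%N -> b x = b' x) ->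
  conv a b M = conv a' b' M.
Proof.
move=> eqa eqb; rewrite /conv; apply: PartSum.sum_eq => i /leP le_iM.
by rewrite eqa // eqb // leq_subr.
Qed.


(** The convolution at [M] as a series, which makes linearity and comparison
of series available. *)
Lemma conv_Series (a b : nat -> R) (M : nat) :
  conv a b M = Series (fun x => a x * (if (x <= M)%N then b (M - x)%N else 0)).
Proof.
symmetry; apply: is_series_unique.
have -> : conv a b M =
    sum_f_R0 (fun x => a x * (if (x <= M)%N then b (M - x)%N else 0)) M.
  by rewrite /conv; apply: PartSum.sum_eq => i /leP ->.
by apply: is_series_finite => x; rewrite ltnNge => /negbTE ->; rewrite Rmult_0_r.
Qed.

(** From [x = i + (x - i)]: the means of the two factors add, and centring a
convolution centres one factor at a time. *)
Lemma conv_weight_add (a b : nat -> R) (u v : R) (x : nat) :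
  conv a b x * (INR x - (u + v)) =
  conv (fun i => a i * (INR i - u)) b x + conv a (fun i => b i * (INR i - v)) x.
Proof.
rewrite /conv Rmult_comm scal_sum -sum_plus; apply: PartSum.sum_eq => i /leP le_ix.
rewrite (_ : INR x = INR i + INR (x - i)%N); first by ring.
by rewrite -plus_INR; congr INR; rewrite plusE subnKC.
Qed.

(** * Fourier transforms of summable sequences *)

Lemma cis_add (s t : R) : cis (s + t) = (cis s * cis t)%C.
Proof. by rewrite /cis /Cmult /= cos_plus sin_plus; congr pair; ring. Qed.

Lemma cis_0 : cis 0 = RtoC 1.
Proof. by rewrite /cis cos_0 sin_0. Qed.

Lemma cis_opp_mul (t : R) : (cis (- t) * cis t)%C = RtoC 1.
Proof. by rewrite -cis_add Rplus_opp_l cis_0. Qed.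

Lemma Cmod_cis (t : R) : Cmod (cis t) = 1.
Proof.
rewrite /Cmod /= !Rmult_1_r Rplus_comm -sqrt_1; congr sqrt; exact: sin2_cos2.
Qed.

(** The modulus is the largest real part over all rotations; this reduces a
bound on a complex number to bounds on real ones. *)
Lemma Cmod_le_rotations (w : C) (b : R) : 0 <= b ->
  (forall c s, c ^ 2 + s ^ 2 = 1 -> c * fst w + s * snd w <= b) -> Cmod w <= b.
Proof.
move=> b_ge0 rot; case: (Req_dec (Cmod w) 0) => [-> //|w_neq0].
have w_gt0 : 0 < Cmod w by have := Cmod_ge_0 w; lra.
have sq : fst w ^ 2 + snd w ^ 2 = Cmod w ^ 2.
  by rewrite /Cmod pow2_sqrt //; nra.
have := rot (fst w / Cmod w) (snd w / Cmod w) _.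
have -> : fst w / Cmod w * fst w + snd w / Cmod w * snd w =
  (fst w ^ 2 + snd w ^ 2) / Cmod w by field.
have -> : (fst w / Cmod w) ^ 2 + (snd w / Cmod w) ^ 2 =
  (fst w ^ 2 + snd w ^ 2) / Cmod w ^ 2 by field.
rewrite sq.
have -> : Cmod w ^ 2 / Cmod w = Cmod w by field.
by apply; field.
Qed.

Lemma rotation_le_Cmod (w : C) (c s : R) :
  c ^ 2 + s ^ 2 = 1 -> Rabs (c * fst w + s * snd w) <= Cmod w.
Proof.
move=> cs1; rewrite -sqrt_Rsqr_abs /Cmod; apply: sqrt_le_1_alt.
have := pow2_ge_0 (c * snd w - s * fst w); rewrite /Rsqr; nra.
Qed.

Lemma fst_le_Cmod (w : C) : Rabs (fst w) <= Cmod w.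
Proof. by apply: Rle_trans (Rmax_Cmod w); apply: Rmax_l. Qed.

Lemma snd_le_Cmod (w : C) : Rabs (snd w) <= Cmod w.
Proof. by apply: Rle_trans (Rmax_Cmod w); apply: Rmax_r. Qed.

Lemma Cmod_Series_le (z : nat -> C) (b : nat -> R) :
  (forall x, Cmod (z x) <= b x) -> ex_series b ->
  Cmod (Series (fun x => fst (z x)), Series (fun x => snd (z x))) <= Series b.
Proof.
move=> le_zb ex_b.
have ex1 : ex_series (fun x => fst (z x)).
  by apply: ex_series_bounded ex_b => x; apply: Rle_trans (fst_le_Cmod _) _.
have ex2 : ex_series (fun x => snd (z x)).
  by apply: ex_series_bounded ex_b => x; apply: Rle_trans (snd_le_Cmod _) _.
apply: Cmod_le_rotations => [|c s cs1 /=].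
  by apply: Series_ge0 => // x; apply: Rle_trans (Cmod_ge_0 _) (le_zb x).
rewrite -!Series_scal_l -Series_plus; [|exact: ex_series_scal_l..].
apply: Series_monotone => // [|x].
  by apply: ex_series_plus; apply: ex_series_scal_l.
apply: Rle_trans (Rle_abs _) _.
by apply: Rle_trans (rotation_le_Cmod _ cs1) (le_zb x).
Qed.

Definition FT (a : nat -> R) (t : R) : C :=
  (Series (fun x => a x * cos (INR x * t)),
   Series (fun x => a x * sin (INR x * t))).

Lemma Rabs_mult_le1 (x y : R) : Rabs y <= 1 -> Rabs (x * y) <= Rabs x.
Proof. rewrite Rabs_mult; have := Rabs_pos x; nra. Qed.

Lemma Rabs_cos_le1 (t : R) : Rabs (cos t) <= 1.
Proof. by apply: Rabs_le; apply: COS_bound. Qed.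

Lemma Rabs_sin_le1 (t : R) : Rabs (sin t) <= 1.
Proof. by apply: Rabs_le; apply: SIN_bound. Qed.

Lemma summable_mul_le1 (a u : nat -> R) :
  summable a -> (forall x, Rabs (u x) <= 1) -> summable (fun x => a x * u x).
Proof. by move=> sa le1; apply: summable_le sa => x; apply: Rabs_mult_le1. Qed.

Lemma summable_cos (a : nat -> R) (t : R) :
  summable a -> summable (fun x => a x * cos (INR x * t)).
Proof. by move/summable_mul_le1; apply=> x; apply: Rabs_cos_le1. Qed.

Lemma summable_sin (a : nat -> R) (t : R) :
  summable a -> summable (fun x => a x * sin (INR x * t)).
Proof. by move/summable_mul_le1; apply=> x; apply: Rabs_sin_le1. Qed.

Lemma FT_ext (a b : nat -> R) (t : R) : (forall x, a x = b x) -> FT a t = FT b t.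
Proof. by move=> eq_ab; rewrite /FT; congr pair; apply: Series_ext => x; rewrite eq_ab. Qed.

Lemma FT_lin (a b : nat -> R) (c t : R) : summable a -> summable b ->
  FT (fun x => a x + c * b x) t = (FT a t + RtoC c * FT b t)%C.
Proof.
move=> sa sb; rewrite /FT /Cplus /Cmult /=; congr pair.
  rewrite Rmult_0_l Rminus_0_r -Series_scal_l -Series_plus.
  - by apply: Series_ext => x; ring.
  - by apply: summable_ex; apply: summable_cos.
  - by apply: ex_series_scal_l; apply: summable_ex; apply: summable_cos.
rewrite Rmult_0_l Rplus_0_r -Series_scal_l -Series_plus.
- by apply: Series_ext => x; ring.
- by apply: summable_ex; apply: summable_sin.
- by apply: ex_series_scal_l; apply: summable_ex; apply: summable_sin.
Qed.


Lemma FT_scal (a : nat -> R) (c t : R) :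
  FT (fun x => c * a x) t = (RtoC c * FT a t)%C.
Proof.
rewrite /FT /Cmult /=; congr pair;
  rewrite Rmult_0_l ?Rminus_0_r ?Rplus_0_r -Series_scal_l;
  by apply: Series_ext => x; ring.
Qed.

Lemma FT_0 (a : nat -> R) : FT a 0 = RtoC (Series a).
Proof.
rewrite /FT /RtoC; congr pair.
  by apply: Series_ext => x; rewrite Rmult_0_r cos_0 Rmult_1_r.
rewrite -[RHS]Series_zero; apply: Series_ext => x.
by rewrite Rmult_0_r sin_0 Rmult_0_r.
Qed.

(** Convolution becomes multiplication: the angle addition formulas turn the
two components into sums and differences of real Cauchy products. *)
Lemma FT_conv (a b : nat -> R) (t : R) : summable a -> summable b ->
  FT (conv a b) t = (FT a t * FT b t)%C.
Proof.
move=> sa sb; rewrite /FT /Cmult /=.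
have sac := summable_cos t sa; have sas := summable_sin t sa.
have sbc := summable_cos t sb; have sbs := summable_sin t sb.
have split_angle i x : (i <= x)%coq_nat ->
    INR x * t = INR i * t + INR (x - i)%N * t.
  by move=> /leP le_ix; rewrite -Rmult_plus_distr_r -plus_INR plusE subnKC.
congr pair.
  rewrite -!Series_conv // -Series_minus;
    [|by apply: summable_ex; apply: summable_conv..].
  apply: Series_ext => x; rewrite /conv -minus_sum Rmult_comm scal_sum.
  apply: PartSum.sum_eq => i le_ix.
  by rewrite (split_angle i x le_ix) cos_plus; ring.
rewrite -!Series_conv // -Series_plus;
  [|by apply: summable_ex; apply: summable_conv..].
apply: Series_ext => x; rewrite /conv -sum_plus Rmult_comm scal_sum.
apply: PartSum.sum_eq => i le_ix.
by rewrite (split_angle i x le_ix) sin_plus; ring.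
Qed.

(** The uniform tail estimate behind the exchange of sums with integrals and
derivatives. *)
Lemma Series_uniform_tail (u : nat -> R -> R) (b : nat -> R) :
  (forall x t, Rabs (u x t) <= b x) -> ex_series b -> forall e, 0 < e ->
  exists N, forall n t, (N <= n)%coq_nat ->
    Rabs (sum_n (fun x => u x t) n - Series (fun x => u x t)) < e.
Proof.
move=> le_ub ex_b e e_gt0.
have b_ge0 x : 0 <= b x by apply: Rle_trans (Rabs_pos (u x 0)) _.
have /is_lim_seq_spec lim_b : is_lim_seq (sum_n b) (Series b).
  exact: Series_correct.
have [N HN] := lim_b (mkposreal e e_gt0).
exists N => n t le_Nn; move: (HN n le_Nn); rewrite /= !sum_n_Reals.
have ex_u : ex_series (fun x => u x t) by apply: ex_series_bounded ex_b => x.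
rewrite (Series_incr_n b n.+1) ?(Series_incr_n (fun x => u x t) n.+1) //=; try lia.
set B := Series _; set A := sum_f_R0 _ _; set U := Series _; set V := sum_f_R0 _ _.
have : Rabs U <= B.
  by apply: Series_abs_le => [x|]; [exact: le_ub | have := ex_series_incr_n b n.+1; tauto].
have B_ge0 : 0 <= B.
  by apply: Series_ge0 => [|x //]; have := ex_series_incr_n b n.+1; tauto.
rewrite (_ : A - (A + B) = - B); last ring.
rewrite (_ : V - (V + U) = - U); last ring.
rewrite !Rabs_Ropp (Rabs_pos_eq B) //; lra.
Qed.

Lemma is_RInt_cos_mul (k : R) : k <> 0 -> sin (k * PI) = 0 ->
  is_RInt (fun t => cos (k * t)) 0 PI 0.
Proof.
move=> k0 sk0.
have eq0 : minus (sin (k * PI) / k) (sin (k * 0) / k) = 0.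
  by rewrite sk0 Rmult_0_r sin_0 /minus /plus /opp /=; field.
rewrite -[X in is_RInt _ _ _ X]eq0.
apply: (@is_RInt_derive R_CompleteNormedModule (fun t => sin (k * t) / k)
  (fun t => cos (k * t))) => t _.
  by auto_derive => //; field.
apply: continuous_comp; last exact: continuous_cos.
exact: (continuous_scal_r k (fun t => t) t (continuous_id t)).
Qed.

Lemma sin_INR_PI (n : nat) : sin (INR n * PI) = 0.
Proof.
elim: n => [|n IH]; first by rewrite Rmult_0_l sin_0.
by rewrite S_INR Rmult_plus_distr_r Rmult_1_l neg_sin IH Ropp_0.
Qed.

Lemma is_RInt_cos_INR (x M : nat) :
  is_RInt (fun t => cos ((INR x - INR M) * t)) 0 PI (if x == M then PI else 0).
Proof.
case: eqP => [->|neq].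
  apply: (is_RInt_ext (fun=> 1)) => [t _|].
    by rewrite Rminus_diag Rmult_0_l cos_0.
  have eqPI : scal (PI - 0) 1 = PI by rewrite /scal /= /mult /=; ring.
  by rewrite -[X in is_RInt _ _ _ X]eqPI; exact: is_RInt_const.
apply: is_RInt_cos_mul.
  by move=> /Rminus_diag_uniq /INR_eq.
rewrite Rmult_minus_distr_r sin_minus.
by rewrite !sin_INR_PI; ring.
Qed.

Lemma sum_f_R0_delta (a : nat -> R) (c : R) (M n : nat) :
  sum_f_R0 (fun x => a x * (if x == M then c else 0)) n =
  if (M <= n)%N then a M * c else 0.
Proof.
elim: n => [|n IH] /=.
  by rewrite leqn0 [M == _]eq_sym; case: eqP => [<-|_] //; rewrite Rmult_0_r.
rewrite IH [(M <= n.+1)%N]leq_eqVlt ltnS [M == _]eq_sym.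
case: eqP => [<-|_] /=; last by rewrite Rmult_0_r Rplus_0_r.
by rewrite ltnn Rplus_0_l.
Qed.

(** Since the coefficients are real, the integrand is even and half a period
suffices. *)
Lemma FT_inversion (a : nat -> R) (M : nat) : summable a ->
  is_RInt (fun t => fst (cis (- (INR M * t)) * FT a t)%C) 0 PI (PI * a M).
Proof.
move=> sa.
pose u x t := a x * cos ((INR x - INR M) * t).
have le_ub x t : Rabs (u x t) <= Rabs (a x).
  by apply: Rabs_mult_le1; apply: Rabs_cos_le1.
have -> : (fun t => fst (cis (- (INR M * t)) * FT a t)%C) =
          (fun t => Series (fun x => u x t)).
  apply: functional_extensionality => t /=.
  rewrite cos_neg sin_neg -!Series_scal_l -Series_minus;
    [|by apply: ex_series_scal_l; apply: summable_ex;
      first [apply: summable_cos | apply: summable_sin]..].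
  apply: Series_ext => x; rewrite /u Rmult_minus_distr_r cos_minus; ring.
pose S n t := sum_n (fun x => u x t) n.
have int_S n : is_RInt (S n) 0 PI (if (M <= n)%N then a M * PI else 0).
  rewrite -sum_f_R0_delta.
  elim: n => [|n IH] /=.
    apply: (is_RInt_ext (fun t => scal (a 0%N) (cos ((INR 0 - INR M) * t)))).
      by move=> t _; rewrite /S sum_O.
    exact: (is_RInt_scal _ _ _ (a 0%N) _ (@is_RInt_cos_INR 0 M)).
  apply: (is_RInt_ext (fun t => plus (sum_n (fun x => u x t) n)
              (scal (a n.+1) (cos ((INR n.+1 - INR M) * t))))).
    by move=> t _; rewrite /S sum_Sn.
  apply: is_RInt_plus IH _.
  exact: (is_RInt_scal _ _ _ (a n.+1) _ (@is_RInt_cos_INR n.+1 M)).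
have lim_S : filterlim S eventually
    (locally (T := fct_UniformSpace R R_UniformSpace) (fun t => Series (fun x => u x t))).
  move=> P [e He].
  have [N HN] := Series_uniform_tail le_ub sa (cond_pos e).
  exists N => n le_Nn; apply: He => t; exact: HN.
have [If [lim_If int_If]] :=
  @filterlim_RInt _ R_CompleteNormedModule S 0 PI eventually _ _ _ int_S lim_S.
suff <- : If = PI * a M by [].
apply: (filterlim_locally_unique (F := eventually) _ _ _ lim_If).
apply: filterlim_ext_loc (filterlim_const _).
by exists M => n /leP ->; rewrite Rmult_comm.
Qed.

Lemma FT_inj (a b : nat -> R) (M : nat) : summable a -> summable b ->
  (forall t, FT a t = FT b t) -> a M = b M.
Proof.
move=> sa sb eqFT.
have := is_RInt_unique _ _ _ _ (@FT_inversion a M sa).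
have -> : (fun t => fst (cis (- (INR M * t)) * FT a t)%C) =
          (fun t => fst (cis (- (INR M * t)) * FT b t)%C).
  by apply: functional_extensionality => t; rewrite eqFT.
rewrite (is_RInt_unique _ _ _ _ (@FT_inversion b M sb)).
by move/Rmult_eq_reg_l => -> //; have := PI_RGT_0; lra.
Qed.

(** All estimates of probabilities below are integrals of bounds on the modulus
of a transform. *)
Lemma coef_le_integral (a : nat -> R) (g : R -> R) (I : R) (M : nat) :
  summable a -> is_RInt g 0 PI I ->
  (forall t, 0 < t < PI -> Cmod (FT a t) <= g t) ->
  PI * Rabs (a M) <= I.
Proof.
move=> sa int_g le_g.
have pi0 := PI_RGT_0.
have int_a := @FT_inversion a M sa.
have le_g' t : 0 < t < PI ->
    Rabs (fst (cis (- (INR M * t)) * FT a t)%C) <= g t.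
  move=> ht; apply: Rle_trans (fst_le_Cmod _) _.
  by rewrite Cmod_mult Cmod_cis Rmult_1_l; apply: le_g.
rewrite -{1}(Rabs_pos_eq PI) -?Rabs_mult; last by lra.
apply: Rabs_le; split.
  apply: (is_RInt_le _ _ _ _ _ _ (Rlt_le _ _ pi0) (is_RInt_opp _ _ _ _ int_g) int_a).
  by move=> t /le_g' /Rabs_le_between; case.
apply: (is_RInt_le _ _ _ _ _ _ (Rlt_le _ _ pi0) int_a int_g).
by move=> t /le_g' /Rabs_le_between; case.
Qed.

(** * Complex-valued functions of a real variable *)

(** Componentwise differentiability, so that the real calculus applies. *)
Definition derC (f : R -> C) (t : R) (d : C) : Prop :=
  is_derive (fun u => fst (f u)) t (fst d) /\
  is_derive (fun u => snd (f u)) t (snd d).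

Lemma derC_is_derive (f : R -> C) (t : R) (d : C) :
  is_derive (V := C_R_NormedModule) f t d -> derC f t d.
Proof.
move=> df; split.
  have dfst := filterdiff_comp' f (fst : C -> R) t _ _ df
    (filterdiff_linear _ is_linear_fst).
  by eapply filterdiff_ext_lin; [exact: dfst | move=> y].
have dsnd := filterdiff_comp' f (snd : C -> R) t _ _ df
  (filterdiff_linear _ is_linear_snd).
by eapply filterdiff_ext_lin; [exact: dsnd | move=> y].
Qed.

Lemma derC_unique (f : R -> C) (t : R) (d d' : C) :
  derC f t d -> derC f t d' -> d = d'.
Proof.
move=> [d1 d2] [e1 e2]; rewrite (surjective_pairing d) (surjective_pairing d').
by rewrite -(is_derive_unique _ _ _ d1) -(is_derive_unique _ _ _ e1)
  -(is_derive_unique _ _ _ d2) -(is_derive_unique _ _ _ e2).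
Qed.

Lemma derC_ext (f g : R -> C) (t : R) (d : C) :
  (forall u, f u = g u) -> derC f t d -> derC g t d.
Proof.
move=> eq_fg [d1 d2]; split.
  by apply: is_derive_ext d1 => u; rewrite eq_fg.
by apply: is_derive_ext d2 => u; rewrite eq_fg.
Qed.

Lemma derC_const (c : C) (t : R) : derC (fun=> c) t (RtoC 0).
Proof. by split; apply: is_derive_const. Qed.

Lemma derC_minus (f g : R -> C) (t : R) (df dg : C) :
  derC f t df -> derC g t dg -> derC (fun u => f u - g u)%C t (df - dg)%C.
Proof.
by move=> [f1 f2] [g1 g2]; split; apply: is_derive_minus.
Qed.

Lemma derC_mult (f g : R -> C) (t : R) (df dg : C) :
  derC f t df -> derC g t dg ->
  derC (fun u => f u * g u)%C t (df * g t + f t * dg)%C.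
Proof.
have com : forall n m : R_AbsRing, mult n m = mult m n by move=> *; exact: Rmult_comm.
move=> [f1 f2] [g1 g2]; split => /=.
  have := is_derive_minus _ _ _ _ _ (is_derive_mult _ _ _ _ _ f1 g1 com)
    (is_derive_mult _ _ _ _ _ f2 g2 com).
  by congr is_derive; rewrite /minus /plus /opp /mult /=; ring.
have := is_derive_plus _ _ _ _ _ (is_derive_mult _ _ _ _ _ f1 g2 com)
  (is_derive_mult _ _ _ _ _ f2 g1 com).
by congr is_derive; rewrite /minus /plus /opp /mult /=; ring.
Qed.

Lemma derC_cis (c t : R) :
  derC (fun u => cis (c * u)) t (Ci * RtoC c * cis (c * t))%C.
Proof. by split => /=; auto_derive => //; ring. Qed.

(** The mean value inequality, applied to every rotation of the increment. *)
Lemma derC_mean_value (f : R -> C) (K T : R) : 0 <= T ->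
  (forall t, 0 <= t <= T -> exists d, derC f t d /\ Cmod d <= K) ->
  Cmod (f T - f 0) <= K * T.
Proof.
move=> T_ge0 derf.
have K_ge0 : 0 <= K.
  have [d [_ le_dK]] := derf 0 (conj (Rle_refl 0) T_ge0).
  exact: Rle_trans (Cmod_ge_0 d) le_dK.
apply: Cmod_le_rotations => [|c s cs1]; first exact: Rmult_le_pos.
pose h u := c * fst (f u) + s * snd (f u).
have derh t : 0 <= t <= T -> is_derive h t (Derive h t) /\ Rabs (Derive h t) <= K.
  move=> /derf [d [[d1 d2] le_dK]].
  have dh : is_derive h t (c * fst d + s * snd d).
    by apply: is_derive_plus; apply: is_derive_scal.
  have -> := is_derive_unique _ _ _ dh; split=> //.
  exact: Rle_trans (rotation_le_Cmod _ cs1) le_dK.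
have [t|t|t [ht]] := MVT_gen h 0 T (Derive h).
- by rewrite Rmin_left ?Rmax_right // => ht; apply: (proj1 (derh t _)); lra.
- rewrite Rmin_left ?Rmax_right // => /derh [dh _].
  apply/continuity_pt_filterlim.
  by apply: (@ex_derive_continuous _ R_NormedModule h t); exists (Derive h t).
move: ht; rewrite Rmin_left ?Rmax_right // => /derh [_ le_K] eqh.
rewrite (_ : c * _ + s * _ = h T - h 0); last by rewrite /h /=; ring.
rewrite eqh Rminus_0_r; apply: Rmult_le_compat_r => //.
exact: Rle_trans (Rle_abs _) le_K.
Qed.

Lemma derC_reflect (f : R -> C) (t : R) (d : C) :
  derC f (- t) d -> derC (fun u => f (- u)) t (- d)%C.
Proof.
have dN : is_derive Ropp t (-1) by auto_derive => //; ring.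
move=> [d1 d2]; split.
  have := is_derive_comp (fun u => fst (f u)) Ropp t _ _ d1 dN.
  by congr is_derive; rewrite /scal /= /mult /=; ring.
have := is_derive_comp (fun u => snd (f u)) Ropp t _ _ d2 dN.
by congr is_derive; rewrite /scal /= /mult /=; ring.
Qed.

Lemma derC_zero_constant (f : R -> C) (T : R) :
  (forall t, derC f t (RtoC 0)) -> f T = f 0.
Proof.
wlog T_ge0 : f T / 0 <= T => [main|] derf.
  case: (Rle_lt_dec 0 T) => hT; first exact: main.
  have := main (fun u => f (- u)) (- T) ltac:(lra); rewrite Ropp_involutive Ropp_0.
  apply=> t; have -> : RtoC 0 = (- RtoC 0)%C by ring.
  exact: derC_reflect.
have /Cmod_eq_0 eq0 : Cmod (f T - f 0) = 0.
  apply: Rle_antisym; last exact: Cmod_ge_0.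
  rewrite -[X in _ <= X](Rmult_0_l T); apply: derC_mean_value => // t _.
  by exists (RtoC 0); rewrite Cmod_0; split => //; apply: Rle_refl.
have -> : f T = (f T - f 0 + f 0)%C by ring.
by rewrite eq0 Cplus_0_l.
Qed.

(** Termwise differentiation under uniform summable bounds. *)
Lemma is_derive_Series (u du : nat -> R -> R) (b db : nat -> R) (t : R) :
  (forall x s, Rabs (u x s) <= b x) -> (forall x s, Rabs (du x s) <= db x) ->
  ex_series b -> ex_series db ->
  (forall x s, is_derive (u x) s (du x s)) ->
  (forall x s, ex_derive (du x) s) ->
  is_derive (fun s => Series (fun x => u x s)) t (Series (fun x => du x t)).
Proof.
move=> le_b le_db ex_b ex_db deru exdu.
pose fn n s := sum_n (fun x => u x s) n.
have derfn n s : is_derive (fn n) s (sum_n (fun x => du x s) n).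
  by apply: is_derive_sum_n => k _.
have Dfn n s : Derive (fn n) s = sum_n (fun x => du x s) n.
  exact: is_derive_unique.
have -> : Series (fun x => du x t) = Lim_seq (fun n => Derive (fn n) t).
  by rewrite /Series; congr real; apply: Lim_seq_ext => n; rewrite Dfn.
apply: (CVU_Derive fn (fun=> True)) => //.
- exact: open_true.
- move=> e; have [M HM] := Series_uniform_tail le_b ex_b (cond_pos e).
  by exists M => n le_Mn s _; apply: HM.
- by move=> n s _; exists (sum_n (fun x => du x s) n).
- move=> n s _; apply/continuity_pt_filterlim.
  have -> : Derive (fn n) = (fun s => sum_n (fun x => du x s) n).
    exact: functional_extensionality.
  apply: (@ex_derive_continuous _ R_NormedModule
    (fun s => sum_n (fun x => du x s) n) s).
  exists (sum_n (fun x => Derive (du x) s) n).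
  by apply: is_derive_sum_n => k _; apply: Derive_correct.
move=> e; have [M HM] := Series_uniform_tail le_db ex_db (cond_pos e).
exists M => n le_Mn s _; rewrite Dfn.
have -> : Lim_seq (fun n => Derive (fn n) s) = Lim_seq (sum_n (fun x => du x s)).
  by apply: Lim_seq_ext => k; rewrite Dfn.
exact: HM.
Qed.

Definition weighted (a : nat -> R) (x : nat) : R := a x * INR x.

Definition centered (a : nat -> R) (m : R) (x : nat) : R := a x * (INR x - m).

Definition moment1 (a : nat -> R) : Prop := summable (weighted a).

Lemma FT_derive (a : nat -> R) (t : R) : summable a -> moment1 a ->
  derC (FT a) t (Ci * FT (weighted a) t)%C.
Proof.
move=> sa ma; split; rewrite /= /weighted.
  have -> : 0 * Series (fun x => a x * INR x * cos (INR x * t)) -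
      1 * Series (fun x => a x * INR x * sin (INR x * t)) =
      Series (fun x => - (a x * INR x * sin (INR x * t))).
    by rewrite Series_opp; ring.
  apply: (@is_derive_Series (fun x s => a x * cos (INR x * s))
    (fun x s => - (a x * INR x * sin (INR x * s)))
    (fun x => Rabs (a x)) (fun x => Rabs (a x * INR x))) => // [x s|x s|x s|x s].
  - by apply: Rabs_mult_le1; apply: Rabs_cos_le1.
  - by rewrite Rabs_Ropp; apply: Rabs_mult_le1; apply: Rabs_sin_le1.
  - by auto_derive => //; ring.
  - by auto_derive.
rewrite Rmult_0_l Rplus_0_l Rmult_1_l.
apply: (@is_derive_Series (fun x s => a x * sin (INR x * s))
  (fun x s => a x * INR x * cos (INR x * s))
  (fun x => Rabs (a x)) (fun x => Rabs (a x * INR x))) => // [x s|x s|x s|x s].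
- by apply: Rabs_mult_le1; apply: Rabs_sin_le1.
- by apply: Rabs_mult_le1; apply: Rabs_cos_le1.
- by auto_derive => //; ring.
- by auto_derive.
Qed.

Lemma summable_shifted_moment (a : nat -> R) (m : R) :
  summable a -> moment1 a -> summable (centered a m).
Proof.
move=> sa ma.
apply: (@summable_le _ (fun x => Rabs (a x * INR x) + Rabs m * Rabs (a x))).
  move=> x; rewrite /centered -Rabs_mult (_ : a x * _ = a x * INR x + - (m * a x)); last ring.
  by rewrite -(Rabs_Ropp (m * a x)); apply: Rabs_triang.
by apply: ex_series_plus => //; apply: ex_series_scal_l.
Qed.

(** Multiplying the transform by a character recentres the weights that
differentiation brings down. *)
Lemma FT_centered_derive (a : nat -> R) (m t : R) : summable a -> moment1 a ->
  derC (fun u => cis (- m * u) * FT a u)%C t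
       (Ci * (cis (- m * t) * FT (centered a m) t))%C.
Proof.
move=> sa ma.
have -> : FT (centered a m) t =
    (FT (weighted a) t + RtoC (- m) * FT a t)%C.
  rewrite -FT_lin //; apply: FT_ext => x; rewrite /centered /weighted; ring.
have := derC_mult (derC_cis (- m) t) (FT_derive t sa ma).
by congr derC; ring.
Qed.

(** * Powers of the geometric transform *)

Lemma sin_ge_third (x : R) : 0 <= x <= PI / 2 -> x / 3 <= sin x.
Proof.
move=> [x0 x1]; have pi4 := PI_4; have pi0 := PI_RGT_0.
have := sin_bound x 0 x0 ltac:(lra); rewrite /sin_approx /= /sin_term /=.
move=> [sx _]; apply: Rle_trans sx.
have : 0 <= x * (4 - x * x) by apply: Rmult_le_pos => //; nra.
lra.
Qed.

Lemma one_minus_cos_ge (t : R) : 0 <= t <= PI -> t ^ 2 / 18 <= 1 - cos t.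
Proof.
move=> ht; have hs := @sin_ge_third (t / 2) ltac:(lra).
have -> : cos t = 1 - 2 * sin (t / 2) * sin (t / 2).
  by rewrite -cos_2a_sin; congr cos; field.
nra.
Qed.

(** The transform of the negative binomial law of exponent [s]. It is locked,
since the power unfolds to a product that rewriting with the multiplicativity
of the modulus would take apart. *)
HB.lock Definition W (rho s t : R) : C := Cpower (omega rho t) s.

Section OmegaPower.

Variable rho : R.
Hypothesis rho_range : 0 < rho < 1.

Let d (t : R) := 1 - rho * cos t.
Let e (t : R) := rho * sin t.
Let D (t : R) := 1 + rho ^ 2 - 2 * rho * cos t.

Let D_eq t : D t = d t ^ 2 + e t ^ 2.
Proof.
rewrite /D /d /e; have := sin2_cos2 t; rewrite /Rsqr => h.
have -> : (1 - rho * cos t) ^ 2 + (rho * sin t) ^ 2 =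
  1 - 2 * rho * cos t + rho ^ 2 * (sin t * sin t + cos t * cos t) by ring.
rewrite h; ring.
Qed.

Let d_gt0 t : 0 < d t.
Proof. rewrite /d; have := COS_bound t; nra. Qed.

Let D_gt0 t : 0 < D t.
Proof. rewrite D_eq; have := d_gt0 t; nra. Qed.

Lemma one_minus_rho_cis_neq0 t : (RtoC 1 - RtoC rho * cis t)%C <> RtoC 0.
Proof. by case=> h _; have := d_gt0 t; rewrite /d; move: h => /=; lra. Qed.

Let omega_eq t :
  omega rho t = ((1 - rho) * d t / D t, (1 - rho) * e t / D t).
Proof.
have D0 := D_gt0 t; rewrite D_eq in D0.
rewrite /omega /Cdiv /Cinv /Cmult /Cplus /Copp /= !D_eq.
have -> : 1 + - (rho * cos t - 0 * sin t) = d t by rewrite /d; ring.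
have -> : 0 + - (rho * sin t + 0 * cos t) = - e t by rewrite /e; ring.
by congr pair; field; nra.
Qed.

Let Cmod_omega_sqr t : Cmod (omega rho t) ^ 2 = (1 - rho) ^ 2 / D t.
Proof.
have D0 := D_gt0 t.
rewrite Cmod2_alt omega_eq /Re /Im /=.
have -> : (1 - rho) * d t / D t * ((1 - rho) * d t / D t * 1) +
  (1 - rho) * e t / D t * ((1 - rho) * e t / D t * 1) =
  (1 - rho) ^ 2 * (d t ^ 2 + e t ^ 2) / D t ^ 2 by field; lra.
by rewrite -D_eq; field; lra.
Qed.

Lemma Cmod_omega_gt0 t : 0 < Cmod (omega rho t).
Proof.
have : 0 < Cmod (omega rho t) ^ 2.
  by rewrite Cmod_omega_sqr; apply: Rdiv_lt_0_compat (D_gt0 t); nra.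
have := Cmod_ge_0 (omega rho t); nra.
Qed.

Lemma Cmod_omega_le1 t : Cmod (omega rho t) <= 1.
Proof.
have D0 := D_gt0 t.
suff : Cmod (omega rho t) ^ 2 <= 1 by have := Cmod_ge_0 (omega rho t); nra.
rewrite Cmod_omega_sqr; apply/Rle_div_l => //.
rewrite /D; have := COS_bound t; nra.
Qed.

(** From [|omega|^-2 = 1 + 2 al (1 + al) (1 - cos t)], where [1 - cos t] is at
least [t^2 / 18]. *)
Lemma Cmod_omega_decay t : 0 <= t <= PI ->
  Cmod (omega rho t) * (1 + alpha rho * t) <= 5.
Proof.
move=> ht; have D0 := D_gt0 t; set w := Cmod _; set al := alpha rho.
have al_eq : al * (1 - rho) = rho by rewrite /al /alpha; field; lra.
have al0 : 0 < al by rewrite /al /alpha; apply: Rdiv_lt_0_compat; lra.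
have w0 : 0 < w := Cmod_omega_gt0 t.
have sq : w ^ 2 * D t = (1 - rho) ^ 2 by rewrite Cmod_omega_sqr; field; lra.
have cs := one_minus_cos_ge ht.
have geD : (1 - rho) ^ 2 * (1 + al ^ 2 * t ^ 2 / 9) <= D t.
  have -> : (1 - rho) ^ 2 * (1 + al ^ 2 * t ^ 2 / 9) =
    (1 - rho) ^ 2 + (al * (1 - rho)) ^ 2 * (t ^ 2 / 9) by field.
  rewrite al_eq /D; nra.
have le1 : w ^ 2 * (1 + al ^ 2 * t ^ 2 / 9) <= 1.
  apply: (Rmult_le_reg_l ((1 - rho) ^ 2)); first by nra.
  rewrite Rmult_1_r -[X in _ <= X]sq; nra.
have : (w * (1 + al * t)) ^ 2 <= 5 ^ 2.
  have -> : (w * (1 + al * t)) ^ 2 = w ^ 2 * (1 + al * t) ^ 2 by ring.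
  have : (1 + al * t) ^ 2 <= 18 * (1 + al ^ 2 * t ^ 2 / 9).
    have := pow2_ge_0 (1 - al * t); nra.
  have : 0 < w ^ 2 by nra.
  nra.
have : 0 <= w * (1 + al * t) by apply: Rmult_le_pos; nra.
nra.
Qed.

Let L t := ln (1 - rho) - ln (D t) / 2.
Let A t := atan (e t / d t).

Let W_eq s t : W rho s t = (RtoC (exp (s * L t)) * cis (s * A t))%C.
Proof.
have D0 := D_gt0 t; have d0 := d_gt0 t.
rewrite unlock /Cpower /Rpower; congr (RtoC (exp (s * _)) * cis (s * _))%C.
  have w0 := Cmod_omega_gt0 t.
  have : ln (Cmod (omega rho t) * Cmod (omega rho t)) = ln ((1 - rho) * (1 - rho) / D t).
    congr ln; have := Cmod_omega_sqr t; rewrite /= !Rmult_1_r => ->; field; lra.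
  rewrite /Rdiv !ln_mult ?ln_Rinv //; try nra; last exact: Rinv_0_lt_compat.
  rewrite /L; lra.
by rewrite /A omega_eq /=; congr atan; field; nra.
Qed.

Lemma W_add s u t : W rho (s + u) t = (W rho s t * W rho u t)%C.
Proof.
rewrite !W_eq !Rmult_plus_distr_r exp_plus cis_add RtoC_mult; ring.
Qed.

Lemma W_zero t : W rho 0 t = RtoC 1.
Proof. by rewrite W_eq !Rmult_0_l exp_0 cis_0 Cmult_1_l. Qed.

Lemma W_opp_mul s t : (W rho (- s) t * W rho s t)%C = RtoC 1.
Proof. by rewrite -W_add Rplus_opp_l W_zero. Qed.

Lemma W_at_0 s : W rho s 0 = RtoC 1.
Proof.
rewrite W_eq /A /L /e /D sin_0 cos_0 Rmult_0_r /Rdiv Rmult_0_l atan_0 Rmult_0_r.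
have -> : 1 + rho ^ 2 - 2 * rho * 1 = (1 - rho) * (1 - rho) by ring.
rewrite ln_mult; [|lra..].
rewrite (_ : s * _ = 0); last by field.
by rewrite exp_0 cis_0 Cmult_1_l.
Qed.

Lemma Cmod_W s t : Cmod (W rho s t) = Rpower (Cmod (omega rho t)) s.
Proof.
rewrite unlock /Cpower Cmod_mult Cmod_cis Rmult_1_r Cmod_R Rabs_pos_eq //.
by apply: Rlt_le; apply: exp_pos.
Qed.

Lemma W_one t : W rho 1 t = omega rho t.
Proof.
have D0 := D_gt0 t; have d0 := d_gt0 t; have w0 := Cmod_omega_gt0 t.
rewrite unlock /Cpower Rpower_1 // Rmult_1_l.
have -> : snd (omega rho t) / fst (omega rho t) = e t / d t.
  by rewrite omega_eq /=; field; nra.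
have sq : sqrt (1 + Rsqr (e t / d t)) = Cmod (omega rho t) * D t / ((1 - rho) * d t).
  rewrite -[RHS]sqrt_Rsqr; last first.
    by apply: Rlt_le; apply: Rdiv_lt_0_compat; apply: Rmult_lt_0_compat => //; lra.
  congr sqrt; rewrite /Rsqr.
  have -> : Cmod (omega rho t) * D t / ((1 - rho) * d t) *
     (Cmod (omega rho t) * D t / ((1 - rho) * d t)) =
     Cmod (omega rho t) ^ 2 * D t ^ 2 / ((1 - rho) ^ 2 * d t ^ 2) by field; nra.
  rewrite Cmod_omega_sqr (_ : (1 - rho) ^ 2 / D t * D t ^ 2 =
    (1 - rho) ^ 2 * D t); last by field; lra.
  by rewrite D_eq; field; nra.
have eqs : (RtoC (Cmod (omega rho t)) * cis (atan (e t / d t)))%C =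
    ((1 - rho) * d t / D t, (1 - rho) * e t / D t).
  rewrite /cis cos_atan sin_atan sq /Cmult /=.
  by congr pair; field; nra.
by rewrite eqs omega_eq.
Qed.

(** The logarithmic derivative of the transform, written with the transform
itself. *)
Lemma W_derive s t : derC (W rho s) t
  (Ci * RtoC s * (RtoC (1 + alpha rho) * omega rho t - RtoC 1) * W rho s t)%C.
Proof.
have D0 := D_gt0 t; have d0 := d_gt0 t.
have dL : is_derive L t (- e t / D t).
  rewrite /L /D /e; auto_derive; first by rewrite -/(D t).
  by field; rewrite -/(D t); lra.
have dA : is_derive A t (d t / D t - 1).
  rewrite /A; apply: (is_derive_ext (fun u => atan (rho * sin u / (1 - rho * cos u)))) => //.
  have ed : 1 + - (rho * cos t) = d t by [].
  auto_derive; rewrite ed; first lra.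
  rewrite -/(e t).
  have -> : rho * (1 * cos t) = 1 - d t by rewrite /d; ring.
  have -> : - - (rho * (1 * - sin t)) = - e t by rewrite /e; ring.
  by rewrite D_eq /Rsqr; field; nra.
apply: (derC_ext (f := fun u => (RtoC (exp (s * L u)) * cis (s * A u))%C)).
  by move=> u; rewrite W_eq.
have -> : (RtoC (1 + alpha rho) * omega rho t - RtoC 1)%C = (d t / D t - 1, e t / D t).
  rewrite omega_eq /alpha /RtoC /Cmult /Cminus /Cplus /Copp /=.
  by congr pair; field; lra.
rewrite W_eq.
have eL : is_derive (fun u => exp (s * L u)) t (s * (- e t / D t) * exp (s * L t)).
  apply: is_derive_comp; first exact: is_derive_exp.
  exact: is_derive_scal.
have cA : is_derive (fun u => cos (s * A u)) t (s * (d t / D t - 1) * - sin (s * A t)).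
  apply: is_derive_comp; first exact: is_derive_cos.
  exact: is_derive_scal.
have sA : is_derive (fun u => sin (s * A u)) t (s * (d t / D t - 1) * cos (s * A t)).
  apply: is_derive_comp; first exact: is_derive_sin.
  exact: is_derive_scal.
have dE : derC (fun u => RtoC (exp (s * L u))) t (RtoC (s * (- e t / D t) * exp (s * L t))).
  by split=> //; apply: is_derive_const.
have dC : derC (fun u => cis (s * A u)) t
  (s * (d t / D t - 1) * - sin (s * A t), s * (d t / D t - 1) * cos (s * A t)) by split.
have := derC_mult dE dC; congr derC.
by rewrite /Cmult /Cplus /RtoC /Ci /cis /=; congr pair; field; lra.
Qed.

(** The logarithmic derivative of a power of [omega] vanishes with [omega]; the
product of the right-hand side with [t] is therefore bounded, uniformly in
[rho]. *)
Lemma omega_increment t :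
  (RtoC (1 + alpha rho) * omega rho t - RtoC 1 = RtoC (alpha rho) * cis t * omega rho t)%C.
Proof.
have z0 := @one_minus_rho_cis_neq0 t.
have rho1 : RtoC (1 - rho) <> RtoC 0 by case; lra.
have -> : (RtoC (1 + alpha rho) = RtoC 1 / RtoC (1 - rho))%C.
  rewrite -RtoC_div; [congr RtoC; rewrite /alpha; field|]; lra.
have -> : (RtoC (alpha rho) = RtoC rho / RtoC (1 - rho))%C.
  by rewrite -RtoC_div //; lra.
by rewrite /omega; field.
Qed.

End OmegaPower.

Lemma Cpower_omega (rho s t : R) : Cpower (omega rho t) s = W rho s t.
Proof. by rewrite unlock. Qed.

(** * Negative binomial laws *)

(** The binomial coefficient [eta (eta + 1) ... (eta + j - 1) / j!]. *)
Fixpoint rising_ratio (eta : R) (j : nat) : R :=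
  if j is i.+1 then rising_ratio eta i * ((eta + INR i) / INR j) else 1.

Definition nb (rho eta : R) (j : nat) : R :=
  Rpower (1 - rho) eta * rho ^ j * rising_ratio eta j.

Lemma INR_S_gt0 (j : nat) : 0 < INR j.+1.
Proof. by apply: lt_0_INR; lia. Qed.

Lemma rising_ratio_gt0 (eta : R) (j : nat) : 0 < eta -> 0 < rising_ratio eta j.
Proof.
move=> eta0; elim: j => [|j IH]; first by rewrite /=; lra.
rewrite -[rising_ratio _ _]/(rising_ratio eta j * ((eta + INR j) / INR j.+1)).
apply: Rmult_lt_0_compat => //.
by apply: Rdiv_lt_0_compat (INR_S_gt0 j); have := pos_INR j; lra.
Qed.

Lemma rising_ratio_S (eta : R) (j : nat) :
  rising_ratio eta j.+1 * INR j.+1 = rising_ratio eta j * (eta + INR j).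
Proof.
have sj := INR_S_gt0 j.
rewrite -[rising_ratio _ _.+1]/(rising_ratio eta j * ((eta + INR j) / INR j.+1)).
by field; lra.
Qed.

Lemma is_lim_seq_rising_quotient (eta c : R) :
  is_lim_seq (fun j => c * ((eta + INR j) / INR j.+1)) c.
Proof.
have -> : Rbar.Finite c = Rbar_mult c (Rbar.Finite (0 + 1)) by rewrite /= Rplus_0_l Rmult_1_r.
apply: is_lim_seq_scal_l.
apply: (is_lim_seq_ext (fun j => (eta - 1) * / INR j.+1 + 1)).
  move=> j; have := INR_S_gt0 j; rewrite S_INR => ?; field; lra.
apply: is_lim_seq_plus'; last exact: is_lim_seq_const.
have -> : Rbar.Finite 0 = Rbar_mult (eta - 1) 0 by rewrite /= Rmult_0_r.
apply: is_lim_seq_scal_l; apply: (proj1 (is_lim_seq_incr_1 (fun j => / INR j) _)).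
have -> : Rbar.Finite 0 = Rbar_inv p_infty by [].
by apply: is_lim_seq_inv => //; exact: is_lim_seq_INR.
Qed.

Section NegativeBinomial.

Variables rho eta : R.
Hypothesis rho_range : 0 < rho < 1.
Hypothesis eta_gt0 : 0 < eta.

Lemma nb_gt0 j : 0 < nb rho eta j.
Proof.
rewrite /nb; apply: Rmult_lt_0_compat (rising_ratio_gt0 j eta_gt0).
by apply: Rmult_lt_0_compat; [exact: exp_pos | apply: pow_lt; lra].
Qed.

Lemma nb_S j : nb rho eta j.+1 * INR j.+1 = rho * (nb rho eta j * (eta + INR j)).
Proof.
rewrite /nb Rmult_assoc rising_ratio_S /=; ring.
Qed.

(** Up to the factor [rho] this is the next weighted term, so one ratio test
serves the law and its first moment. *)
Let majorant_summable : ex_series (fun j => nb rho eta j * (eta + INR j)).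
Proof.
apply: ex_series_Rabs; apply: (@ex_series_DAlembert _ rho); first lra.
  by move=> j; have := nb_gt0 j; have := pos_INR j; nra.
apply: (is_lim_seq_ext (fun j => rho * ((eta + 1 + INR j) / INR j.+1))); last first.
  exact: is_lim_seq_rising_quotient.
move=> j; have nj := nb_gt0 j; have ij := pos_INR j; have sj := INR_S_gt0 j.
have q0 : 0 < rho * ((eta + 1 + INR j) / INR j.+1).
  by apply: Rmult_lt_0_compat; [lra | apply: Rdiv_lt_0_compat; lra].
have -> : nb rho eta j.+1 = rho * (nb rho eta j * (eta + INR j)) / INR j.+1.
  by rewrite -nb_S; field; lra.
have shift : eta + INR j.+1 = eta + 1 + INR j by rewrite S_INR; ring.
rewrite Rabs_pos_eq shift.
  by field; nra.
apply: Rlt_le; apply: Rdiv_lt_0_compat; last by nra.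
apply: Rmult_lt_0_compat; last by lra.
by apply: Rdiv_lt_0_compat => //; apply: Rmult_lt_0_compat; [lra | nra].
Qed.

Lemma nb_moment1 : moment1 (nb rho eta).
Proof.
apply: summable_le majorant_summable => j; rewrite /weighted.
have := nb_gt0 j; have := pos_INR j => ? ?.
rewrite Rabs_pos_eq; nra.
Qed.

Lemma nb_summable : summable (nb rho eta).
Proof.
apply: (@summable_le _ (fun j => / eta * (nb rho eta j * (eta + INR j)))) => [j|]; last first.
  exact: ex_series_scal_l.
have nj := nb_gt0 j; have ij := pos_INR j.
have -> : / eta * (nb rho eta j * (eta + INR j)) =
    nb rho eta j + / eta * (nb rho eta j * INR j) by field; lra.
rewrite Rabs_pos_eq; last lra.
have := Rinv_0_lt_compat _ eta_gt0; have : 0 <= nb rho eta j * INR j by nra.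
nra.
Qed.

(** The binomial series: [f = sum_j rising_ratio eta j x^j] solves
[(1 - x) f' = eta f], hence equals [(1 - x) ^ (- eta)]. *)
Lemma nb_sum : Series (nb rho eta) = 1.
Proof.
pose a := rising_ratio eta.
have cv : CV_radius a = 1.
  have -> : Rbar.Finite 1 = Rbar.Finite (/ 1) by rewrite Rinv_1.
  apply: CV_radius_finite_DAlembert => [j||]; [|lra|].
    by have := rising_ratio_gt0 j eta_gt0; rewrite /a; lra.
  apply: (is_lim_seq_ext (fun j => 1 * ((eta + INR j) / INR j.+1))); last first.
    exact: is_lim_seq_rising_quotient.
  move=> j; have aj := rising_ratio_gt0 j eta_gt0.
  have ij := pos_INR j; have sj := INR_S_gt0 j.
  have q0 : 0 < (eta + INR j) / INR j.+1 by apply: Rdiv_lt_0_compat; lra.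
  rewrite (_ : a j.+1 / a j = (eta + INR j) / INR j.+1) ?Rabs_pos_eq; try lra.
  rewrite /a -[rising_ratio _ _.+1]/(rising_ratio eta j * ((eta + INR j) / INR j.+1)).
  by field; lra.
have inside x : 0 <= x < 1 -> Rbar_lt (Rabs x) (CV_radius a).
  by move=> hx; rewrite cv /= Rabs_pos_eq; lra.
have ode x : 0 <= x < 1 ->
    (1 - x) * PSeries (PS_derive a) x = eta * PSeries a x.
  move=> hx.
  have exd : ex_pseries (PS_derive a) x.
    by apply: CV_radius_inside; rewrite CV_radius_derive; apply: inside.
  rewrite Rmult_minus_distr_r Rmult_1_l -PSeries_incr_1 -PSeries_minus //; last first.
    exact: ex_pseries_incr_1.
  rewrite -PSeries_scal; apply: PSeries_ext => -[|j].
    rewrite /PS_minus /PS_plus /PS_opp /PS_derive /PS_incr_1 /PS_scal.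
    rewrite /plus /opp /scal /mult /zero /= /mult /= /a /=; field.
  rewrite /PS_minus /PS_plus /PS_opp /PS_derive /PS_incr_1 /PS_scal.
  rewrite /plus /opp /scal /mult /zero /= /mult /= -/(INR j.+1) -/(INR j.+2).
  have := rising_ratio_S eta j.+1; rewrite -/(a j.+1) -/(a j.+2) => h.
  rewrite [X in X + _ = _](_ : _ = a j.+2 * INR j.+2); last by rewrite Rmult_comm.
  rewrite h; ring.
pose g x := PSeries a x * Rpower (1 - x) eta.
have dg x : 0 <= x < 1 -> is_derive g x 0.
  move=> hx.
  have d1 := is_derive_PSeries a x (inside x hx).
  have d2 : is_derive (fun y => Rpower (1 - y) eta) x (- eta / (1 - x) * Rpower (1 - x) eta).
    rewrite /Rpower; auto_derive; first lra.
    by change (1 + - x) with (1 - x); field; lra.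
  have com : forall n m : R_AbsRing, mult n m = mult m n by move=> *; exact: Rmult_comm.
  have := is_derive_mult _ _ _ _ _ d1 d2 com; congr is_derive.
  rewrite /plus /mult /=.
  have -> : PSeries a x = (1 - x) * PSeries (PS_derive a) x / eta.
    by rewrite ode //; field; lra.
  by field; lra.
have g_const : g rho = g 0.
  have [x|x|x [hx eqg]] := MVT_gen g 0 rho (fun=> 0).
  - by rewrite Rmin_left ?Rmax_right; try lra; move=> hx; apply: dg; lra.
  - rewrite Rmin_left ?Rmax_right; try lra; move=> hx.
    apply/continuity_pt_filterlim.
    by apply: (@ex_derive_continuous _ R_NormedModule g x); exists 0; apply: dg; lra.
  lra.
have -> : Series (nb rho eta) = g rho.
  rewrite /g /PSeries Rmult_comm -Series_scal_l; apply: Series_ext => j.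
  rewrite /nb /a; ring.
rewrite g_const /g PSeries_0 Rminus_0_r /a /=.
by rewrite /Rpower ln_1 Rmult_0_r exp_0; ring.
Qed.

Lemma FT_shift (a : nat -> R) t : summable a -> a 0%N = 0 ->
  FT a t = (cis t * FT (fun x => a x.+1) t)%C.
Proof.
move=> sa a0.
have sa1 : summable (fun x => a x.+1) by apply/(ex_series_incr_1 (fun x => Rabs (a x))).
have exc := summable_ex (summable_cos t sa1); have exs := summable_ex (summable_sin t sa1).
rewrite /FT /Cmult /cis /=; congr pair.
  rewrite Series_incr_1_aux ?a0 ?Rmult_0_l // -!Series_scal_l -Series_minus;
    [|exact: ex_series_scal_l..].
  apply: Series_ext => x; rewrite -/(INR x.+1) S_INR Rmult_plus_distr_r Rmult_1_l cos_plus; ring.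
rewrite Series_incr_1_aux ?a0 ?Rmult_0_l // -!Series_scal_l -Series_plus;
  [|exact: ex_series_scal_l..].
apply: Series_ext => x; rewrite -/(INR x.+1) S_INR Rmult_plus_distr_r Rmult_1_l sin_plus; ring.
Qed.

(** Both sides solve the same linear differential equation in the angle, the
left one by the recursion of the coefficients. *)
Lemma FT_nb t : FT (nb rho eta) t = W rho eta t.
Proof.
have snb := nb_summable; have mnb := nb_moment1.
have E_eq u : FT (weighted (nb rho eta)) u =
    (RtoC eta * (RtoC (1 + alpha rho) * omega rho u - RtoC 1) * FT (nb rho eta) u)%C.
  have rec : FT (weighted (nb rho eta)) u =
      (cis u * (RtoC rho * (FT (weighted (nb rho eta)) u + RtoC eta * FT (nb rho eta) u)))%C.
    rewrite {1}FT_shift //; last by rewrite /weighted Rmult_0_r.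
    rewrite -FT_lin // -FT_scal; congr Cmult; apply: FT_ext => x.
    by rewrite /weighted nb_S; ring.
  have z0 := @one_minus_rho_cis_neq0 rho rho_range u.
  set E := FT (weighted _) u in rec *; set F := FT _ u in rec *.
  have solved : ((RtoC 1 - RtoC rho * cis u) * E = RtoC rho * cis u * RtoC eta * F)%C.
    have -> : ((RtoC 1 - RtoC rho * cis u) * E = E - RtoC rho * cis u * E)%C by ring.
    by rewrite {1}rec; ring.
  have rho1 : RtoC (1 - rho) <> RtoC 0 by case; lra.
  have -> : (RtoC (1 + alpha rho) = RtoC 1 / RtoC (1 - rho))%C.
    rewrite -RtoC_div; [congr RtoC; rewrite /alpha; field|]; lra.
  rewrite /omega.
  have -> : E = (RtoC rho * cis u * RtoC eta * F / (RtoC 1 - RtoC rho * cis u))%C.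
    by rewrite -solved; field.
  by field.
have der u : derC (fun v => FT (nb rho eta) v * W rho (- eta) v)%C u (RtoC 0).
  have := derC_mult (FT_derive u snb mnb) (W_derive rho_range (- eta) u).
  by rewrite E_eq RtoC_opp; congr derC; ring.
have cst := derC_zero_constant t der.
rewrite W_at_0 // FT_0 nb_sum Cmult_1_r in cst.
have -> : FT (nb rho eta) t = (FT (nb rho eta) t * (W rho (- eta) t * W rho eta t))%C.
  by rewrite W_opp_mul // Cmult_1_r.
by rewrite Cmult_assoc cst Cmult_1_l.
Qed.

End NegativeBinomial.

(** * The Gamma function *)

Lemma ln_le_tangent (u c : R) : 0 < u -> 0 < c -> ln u <= u / c - 1 + ln c.
Proof.
move=> u0 c0; have q0 : 0 < u / c by apply: Rdiv_lt_0_compat.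
have -> : ln u = ln (u / c) + ln c.
  by rewrite -ln_mult //; congr ln; field; lra.
have := exp_ineq1_le (ln (u / c)); rewrite exp_ln //; lra.
Qed.

Lemma exp_monotone (x y : R) : x <= y -> exp x <= exp y.
Proof. by case=> [/exp_increasing /Rlt_le //|->]; apply: Rle_refl. Qed.

Lemma ln_ge0 (c : R) : 1 <= c -> 0 <= ln c.
Proof. by move=> c1; rewrite -ln_1; apply: ln_le; lra. Qed.

Lemma Rpower_gt0 (u a : R) : 0 < Rpower u a.
Proof. exact: exp_pos. Qed.

Lemma Rpower_ln_le (u v a b : R) : a * ln u <= b * ln v -> Rpower u a <= Rpower v b.
Proof. by move=> h; apply: exp_monotone. Qed.

(** A majorant that is integrable and uniform in the exponent, from the tangent
line of the logarithm at [2 b + 1]. *)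
Lemma power_exp_le (a b u : R) : 0 <= a <= b -> 0 < u ->
  Rpower u a * exp (- u) <= Rpower (2 * b + 1) b * exp (- (u / 2)).
Proof.
move=> hab u0; rewrite /Rpower -!exp_plus; apply: exp_monotone.
have c1 : 1 <= 2 * b + 1 by lra.
have := ln_le_tangent u0 (Rlt_le_trans _ _ _ Rlt_0_1 c1); have := ln_ge0 c1.
set c := 2 * b + 1; set l := ln c => l0 hu.
have uc0 : 0 <= u / c by apply: Rlt_le; apply: Rdiv_lt_0_compat; rewrite /c; lra.
have h1 : b * (u / c) <= u / 2.
  rewrite (_ : u / 2 = (c / 2) * (u / c)); last by field; rewrite /c; lra.
  apply: Rmult_le_compat_r => //; rewrite /c; lra.
have : a * ln u <= a * (u / c - 1 + l) by apply: Rmult_le_compat_l; lra.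
have : a * (u / c) <= b * (u / c) by apply: Rmult_le_compat_r; lra.
have : a * l <= b * l by apply: Rmult_le_compat_r; lra.
lra.
Qed.

(** Bernoulli's inequality for the convex powers. *)
Lemma Rpower_tangent (z b : R) : 0 < z -> 1 <= b \/ b <= 0 ->
  1 + b * (z - 1) <= Rpower z b.
Proof.
move=> z0 [b1|b0].
  have zV : 0 < / z by apply: Rinv_0_lt_compat.
  have -> : Rpower z b = z * Rpower z (b - 1).
    by rewrite -{2}(Rpower_1 z) // -Rpower_plus; congr Rpower; ring.
  have h : 1 + (b - 1) * (1 - / z) <= Rpower z (b - 1).
    apply: Rle_trans (exp_ineq1_le _); apply: Rplus_le_compat_l.
    apply: Rmult_le_compat_l; first lra.
    have := @ln_le_tangent (/ z) 1 zV Rlt_0_1; rewrite ln_1 ln_Rinv //; lra.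
  have -> : 1 + b * (z - 1) = z * (1 + (b - 1) * (1 - / z)) by field; lra.
  by apply: Rmult_le_compat_l; lra.
apply: Rle_trans (exp_ineq1_le _); apply: Rplus_le_compat_l.
have := @ln_le_tangent z 1 z0 Rlt_0_1; rewrite ln_1 => h; nra.
Qed.

Lemma at_right_0_gt0 (P : R -> Prop) (d : R) : 0 < d ->
  (forall x, 0 < x < d -> P x) -> at_right 0 P.
Proof.
move=> d0 HP; exists (mkposreal d d0) => x /= hx x0; apply: HP; split=> //.
move: hx; rewrite /ball /= /AbsRing_ball /= /abs /minus /plus /opp /=.
by rewrite Ropp_0 Rplus_0_r Rabs_pos_eq; [move=> ?; lra | lra].
Qed.

(** A nonnegative integrand with bounded integrals over compact intervals has
an improper integral, by monotone convergence. *)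
Lemma ex_RInt_gen_bounded (f : R -> R) (K : R) :
  (forall t, 0 < t -> continuous f t) -> (forall t, 0 < t -> 0 <= f t) ->
  (forall a b, 0 < a <= b -> RInt f a b <= K) ->
  ex_RInt_gen f (at_right 0) (Rbar_locally p_infty).
Proof.
move=> fc f0 fK.
have exf a b : 0 < a <= b -> ex_RInt f a b.
  move=> hab; apply: (@ex_RInt_continuous R_CompleteNormedModule) => t.
  by rewrite Rmin_left ?Rmax_right; try lra; move=> ht; apply: fc; lra.
pose E y := exists a b, 0 < a <= b /\ y = RInt f a b.
have bE : bound E by exists K => y [a [b [hab ->]]]; exact: fK.
have nE : exists y, E y by exists (RInt f 1 1), 1, 1; split=> //; lra.
have [l [ub lub]] := completeness E bE nE.
exists l => P [e He].
have [y [[a [b [hab ->]]] hy]] : exists y, E y /\ l - e < y.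
  apply: Classical_Prop.NNPP => nex.
  have : l <= l - e.
    by apply: lub => y Ey; apply: Rnot_lt_le => hy; apply: nex; exists y.
  have := cond_pos e; lra.
apply: (Filter_prod _ _ _ (fun x => 0 < x < a) (fun x => b < x)).
- by apply: (@at_right_0_gt0 _ a) => [|//]; lra.
- by exists b.
move=> x z hx hz /=; exists (RInt f x z); split.
  by apply: (@RInt_correct R_CompleteNormedModule); apply: exf; lra.
apply: He; rewrite /ball /= /AbsRing_ball /= /abs /minus /plus /opp /=.
have le_l : RInt f x z <= l by apply: ub; exists x, z; split=> //; lra.
have ge : RInt f a b <= RInt f x z.
  have nonneg u v : 0 < u <= v -> 0 <= RInt f u v.
    by move=> huv; apply: RInt_ge_0 => [||t ht]; [lra | exact: exf | apply: f0; lra].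
  have e1 := @RInt_Chasles R_CompleteNormedModule f x a z (exf x a ltac:(lra)) (exf a z ltac:(lra)).
  have e2 := @RInt_Chasles R_CompleteNormedModule f a b z (exf a b ltac:(lra)) (exf b z ltac:(lra)).
  have := nonneg x a ltac:(lra); have := nonneg b z ltac:(lra).
  move: e1 e2; rewrite /plus /=; lra.
rewrite Rabs_left1; lra.
Qed.

Definition half_line_integral (f : R -> R) (l : R) : Prop :=
  is_RInt_gen f (at_right 0) (Rbar_locally p_infty) l.

Lemma half_line_integral_lin (f g : R -> R) (lf lg u v : R) :
  half_line_integral f lf -> half_line_integral g lg ->
  half_line_integral (fun t => u * f t + v * g t) (u * lf + v * lg).
Proof. by move=> If Ig; apply: is_RInt_gen_plus; apply: is_RInt_gen_scal. Qed.

Arguments half_line_integral_lin {f g lf lg} u v _ _ _ _.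

Lemma half_line_integral_unique (f : R -> R) (l l' : R) :
  half_line_integral f l -> half_line_integral f l' -> l = l'.
Proof.
move=> I1 I2; rewrite -(@is_RInt_gen_unique R_CompleteNormedModule _ _ _ _ _ _ I1).
exact: (@is_RInt_gen_unique R_CompleteNormedModule _ _ _ _ _ _ I2).
Qed.

Definition gamma_integrand (x t : R) : R := Rpower t (x - 1) * exp (- t).

Lemma continuous_gamma_integrand (x t : R) : 0 < t -> continuous (gamma_integrand x) t.
Proof.
move=> t0; apply: (@ex_derive_continuous _ R_NormedModule).
by rewrite /gamma_integrand /Rpower; auto_derive.
Qed.

Lemma gamma_integrand_gt0 (x t : R) : 0 < gamma_integrand x t.
Proof. by apply: Rmult_lt_0_compat; apply: exp_pos. Qed.

Lemma is_RInt_gen_Gamma (x : R) : 1 <= x ->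
  half_line_integral (gamma_integrand x) (Gamma x).
Proof.
move=> x1.
apply: (@RInt_gen_correct R_CompleteNormedModule (at_right 0)
  (Rbar_locally p_infty) _ _ (gamma_integrand x)).
set K := Rpower (2 * (x - 1) + 1) (x - 1).
apply: (@ex_RInt_gen_bounded _ (2 * K)).
- by move=> t t0; apply: continuous_gamma_integrand.
- by move=> t _; apply: Rlt_le; apply: gamma_integrand_gt0.
move=> a b hab.
have intK : is_RInt (fun t => K * exp (- (t / 2))) a b
    (minus (- 2 * K * exp (- (b / 2))) (- 2 * K * exp (- (a / 2)))).
  apply: (@is_RInt_derive R_CompleteNormedModule (fun t => - 2 * K * exp (- (t / 2)))
    (fun t => K * exp (- (t / 2)))) => t _.
    by auto_derive => //; rewrite /Rdiv; field.
  by apply: (@ex_derive_continuous _ R_NormedModule); auto_derive.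
apply: Rle_trans (_ : _ <= minus (- 2 * K * exp (- (b / 2))) (- 2 * K * exp (- (a / 2)))) _.
  apply: (is_RInt_le _ _ a b _ _ _ _ intK); first lra.
    apply: (@RInt_correct R_CompleteNormedModule).
    apply: (@ex_RInt_continuous R_CompleteNormedModule) => t.
    rewrite Rmin_left ?Rmax_right; try lra; move=> ht.
    by apply: continuous_gamma_integrand; lra.
  by move=> t ht; apply: power_exp_le; lra.
have K0 : 0 < K := Rpower_gt0 _ _.
have eb := exp_pos (- (b / 2)).
have ea : exp (- (a / 2)) <= 1 by rewrite -[X in _ <= X]exp_0; apply: exp_monotone; lra.
rewrite /minus /plus /opp /=; nra.
Qed.

Lemma half_line_integral_le (f g : R -> R) (lf lg : R) :
  half_line_integral f lf -> half_line_integral g lg ->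
  (forall t, 0 < t -> f t <= g t) -> lf <= lg.
Proof.
move=> If Ig le_fg.
have Id := half_line_integral_lin (-1) 1 If Ig.
have I0 := half_line_integral_lin 0 0 If Ig.
have : norm (0 * lf + 0 * lg) <= -1 * lf + 1 * lg.
  refine (@RInt_gen_norm R_CompleteNormedModule (at_right 0)
    (Rbar_locally p_infty) _ _ _ _ _ _ _ _ I0 Id).
    apply: (Filter_prod _ _ _ (fun x => 0 < x < 1) (fun x => 1 < x)).
    - by apply: (@at_right_0_gt0 _ 1) => [|//]; lra.
    - by exists 1.
    by move=> x z /=; lra.
  apply: (Filter_prod _ _ _ (fun x => 0 < x < 1) (fun x => 1 < x)).
  - by apply: (@at_right_0_gt0 _ 1) => [|//]; lra.
  - by exists 1.
  move=> x z /= hx hz t ht.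
  have := le_fg t ltac:(lra).
  rewrite /norm /= /abs /= !Rmult_0_l Rplus_0_l Rabs_R0; lra.
rewrite /norm /= /abs /= !Rmult_0_l Rplus_0_l Rabs_R0; lra.
Qed.

(** The fundamental theorem of calculus on the open half-line. *)
Lemma half_line_integral_derive (F f : R -> R) (l0 l1 : R) :
  (forall t, 0 < t -> is_derive F t (f t)) ->
  (forall t, 0 < t -> continuous f t) ->
  filterlim F (at_right 0) (locally l0) ->
  filterlim F (Rbar_locally p_infty) (locally l1) ->
  half_line_integral f (l1 - l0).
Proof.
move=> dF cf lim0 lim1.
have pos (P : R -> Prop) : (forall t, 0 < t -> P t) ->
    filter_prod (at_right 0) (Rbar_locally p_infty)
      (fun ab => forall t, Rmin ab.1 ab.2 <= t <= Rmax ab.1 ab.2 -> P t).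
  move=> HP; apply: (Filter_prod _ _ _ (fun x => 0 < x < 1) (fun x => 1 < x)).
  - by apply: (@at_right_0_gt0 _ 1) => [|//]; lra.
  - by exists 1.
  move=> x z hx hz t /=; rewrite Rmin_left ?Rmax_right; try lra.
  by move=> ht; apply: HP; lra.
have dF' t : 0 < t -> Derive F t = f t.
  by move=> t0; apply: is_derive_unique; apply: dF.
apply: (is_RInt_gen_ext (Derive F)).
  apply: filter_imp (pos (fun t => Derive F t = f t) dF') => ab H t ht.
  by apply: H; lra.
apply: is_RInt_gen_Derive => //.
  by apply: pos => t t0; exists (f t); apply: dF.
apply: pos => t t0; apply: (continuous_ext_loc _ f); last exact: cf.
exists (mkposreal t t0) => y /= hy; symmetry; apply: dF'.
move: hy; rewrite /ball /= /AbsRing_ball /= /abs /minus /plus /opp /=.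
by move/Rabs_lt_between => ?; lra.
Qed.

Lemma filterlim_exp_half : filterlim (fun t => exp (- (t / 2)))
  (Rbar_locally p_infty) (locally 0).
Proof.
apply: (filterlim_comp _ _ _ (fun t => - (t / 2)) exp _ (Rbar_locally m_infty)).
  by move=> P [M HM]; exists (- 2 * M) => x hx; apply: HM; lra.
exact: is_lim_exp_m.
Qed.

Lemma Gamma_1 : Gamma 1 = 1.
Proof.
have I1 := is_RInt_gen_Gamma (Rle_refl 1).
have I2 : half_line_integral (gamma_integrand 1) (0 - (-1)).
  apply: (half_line_integral_derive (F := fun t => - exp (- t))).
  - move=> t t0; rewrite /gamma_integrand Rminus_diag Rpower_O //.
    by auto_derive => //; ring.
  - by move=> t; apply: continuous_gamma_integrand.
  - apply: (filterlim_filter_le_1 _ (filter_le_within _)).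
    have -> : -1 = - exp (- 0) by rewrite Ropp_0 exp_0.
    by apply: (@ex_derive_continuous _ R_NormedModule (fun t => - exp (- t))); auto_derive.
  have -> : 0 = - 0 by ring.
  apply: (filterlim_comp _ _ _ (fun t => exp (- t)) Ropp _ (locally 0)); last first.
    exact: (filterlim_opp (V := R_NormedModule) 0).
  apply: (filterlim_comp _ _ _ Ropp exp _ (Rbar_locally m_infty)); last exact: is_lim_exp_m.
  by move=> P [M HM]; exists (- M) => x hx; apply: HM; lra.
have := half_line_integral_unique I1 I2; lra.
Qed.

Lemma Gamma_S (x : R) : 1 <= x -> Gamma (x + 1) = x * Gamma x.
Proof.
move=> x1.
have I1 := is_RInt_gen_Gamma x1.
have I2 := is_RInt_gen_Gamma (ltac:(lra) : 1 <= x + 1).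
have I3 := half_line_integral_lin x (-1) I1 I2.
have I4 : half_line_integral
    (fun t => x * gamma_integrand x t + -1 * gamma_integrand (x + 1) t) (0 - 0).
  have step t : 0 < t -> Rpower t (x + 1 - 1) = t * Rpower t (x - 1).
    move=> t0; rewrite -{2}(Rpower_1 t) // -Rpower_plus; congr Rpower; ring.
  apply: (half_line_integral_derive (F := fun t => gamma_integrand (x + 1) t)).
  - move=> t t0.
    apply: (is_derive_ext (fun s => exp (x * ln s) * exp (- s))) => [s|].
      by rewrite /gamma_integrand /Rpower; congr (exp (_ * _) * _); ring.
    rewrite /gamma_integrand step // /Rpower.
    auto_derive => //; have -> : x * ln t = (x - 1) * ln t + ln t by ring.
    by rewrite exp_plus exp_ln //; field; lra.
  - move=> t t0; apply: continuous_plus; apply: continuous_scal_r;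
      exact: continuous_gamma_integrand.
  - move=> P [e He]; apply: (@at_right_0_gt0 _ (Rmin e 1)).
      by apply: Rmin_pos; [exact: cond_pos | lra].
    move=> t [t0 te]; have := Rmin_l e 1; have := Rmin_r e 1 => ? ?.
    apply: He; rewrite /ball /= /AbsRing_ball /= /abs /minus /plus /opp /= Ropp_0 Rplus_0_r.
    rewrite Rabs_pos_eq; last by apply: Rlt_le; apply: gamma_integrand_gt0.
    apply: Rle_lt_trans (_ : _ <= t * 1 * 1) _; last lra.
    rewrite /gamma_integrand step //.
    apply: Rmult_le_compat.
    + by apply: Rlt_le; apply: Rmult_lt_0_compat => //; apply: Rpower_gt0.
    + by apply: Rlt_le; apply: exp_pos.
    + apply: Rmult_le_compat_l; first lra.
      rewrite -[X in _ <= X]exp_0; apply: exp_monotone.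
      have : ln t <= 0 by rewrite -ln_1; apply: ln_le; lra.
      nra.
    by rewrite -[X in _ <= X]exp_0; apply: exp_monotone; lra.
  have lim0 := filterlim_comp _ _ _ _ _ _ _ _ filterlim_exp_half
    (filterlim_scal_r (V := R_NormedModule) (Rpower (2 * x + 1) x) 0).
  rewrite scal_zero_r in lim0.
  move=> P [e He].
  have [M HM] := lim0 _ (locally_ball 0 e).
  exists (Rmax M 0) => t ht; have := Rmax_l M 0; have := Rmax_r M 0 => ? ?.
  have := HM t ltac:(lra); rewrite /ball /= /AbsRing_ball /= => bt.
  apply: He; rewrite /ball /= /AbsRing_ball /=; apply: Rle_lt_trans bt.
  rewrite /abs /minus /plus /opp /scal /= /mult /= Ropp_0 !Rplus_0_r.
  rewrite !Rabs_pos_eq; first last.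
  - by apply: Rlt_le; apply: gamma_integrand_gt0.
  - by apply: Rlt_le; apply: Rmult_lt_0_compat; apply: exp_pos.
  rewrite /gamma_integrand (_ : x + 1 - 1 = x); last ring.
  have := @power_exp_le x x t ltac:(lra) ltac:(lra); lra.
have := half_line_integral_unique I3 I4; lra.
Qed.

(** Jensen's inequality for [u ^ (a + 1)] under the Gamma law of parameter
[x - 1], in the form of integrating the tangent line at its mean. *)
Lemma Gamma_add_ge (x a : R) : 2 <= x -> 0 <= a ->
  Rpower (x - 1) a * Gamma x <= Gamma (x + a).
Proof.
move=> x2 a0; set y := x - 1; have y1 : 1 <= y by rewrite /y; lra.
have Iy := is_RInt_gen_Gamma y1.
have Ix := is_RInt_gen_Gamma (ltac:(lra) : 1 <= x).
have Ixa := is_RInt_gen_Gamma (ltac:(lra) : 1 <= x + a).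
set c := Rpower y (a + 1).
have Ilow := half_line_integral_lin (- (c * a)) (c * ((a + 1) / y)) Iy Ix.
have := half_line_integral_le Ilow Ixa.
have -> : Gamma x = y * Gamma y by rewrite -Gamma_S // /y; congr Gamma; ring.
have -> : - (c * a) * Gamma y + c * ((a + 1) / y) * (y * Gamma y) = c * Gamma y.
  by field; lra.
have -> : Rpower y a * (y * Gamma y) = c * Gamma y.
  rewrite /c Rpower_plus Rpower_1; [ring | lra].
apply=> t t0; rewrite /gamma_integrand.
have q0 : 0 < t / y by apply: Rdiv_lt_0_compat; lra.
have tan := @Rpower_tangent (t / y) (a + 1) q0 ltac:(left; lra).
have e1 : Rpower t (a + 1) = c * Rpower (t / y) (a + 1).
  rewrite /c Rpower_mult_distr //; last lra.
  by congr Rpower; field; lra.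
have -> : Rpower t (x + a - 1) = Rpower t (a + 1) * Rpower t (y - 1).
  by rewrite -Rpower_plus; congr Rpower; rewrite /y; ring.
have -> : Rpower t (x - 1) = t * Rpower t (y - 1).
  by rewrite -{2}(Rpower_1 t) // -Rpower_plus; congr Rpower; rewrite /y; ring.
rewrite e1; set p := Rpower t (y - 1) * exp (- t).
have p0 : 0 < p by apply: Rmult_lt_0_compat; apply: exp_pos.
have c0 : 0 < c := Rpower_gt0 _ _.
have -> : - (c * a) * (Rpower t (y - 1) * exp (- t)) +
  c * ((a + 1) / y) * (t * Rpower t (y - 1) * exp (- t)) =
  c * (1 + (a + 1) * (t / y - 1)) * p by rewrite /p; field; lra.
have -> : c * Rpower (t / y) (a + 1) * Rpower t (y - 1) * exp (- t) =
  c * Rpower (t / y) (a + 1) * p by rewrite /p; ring.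
apply: Rmult_le_compat_r; first lra.
by apply: Rmult_le_compat_l; lra.
Qed.

(** The same device for [u ^ (- a)] under the Gamma law of parameter [x + a]. *)
Lemma Gamma_add_le (x a : R) : 1 <= x -> 0 <= a ->
  Gamma (x + a) <= Rpower (x + a) a * Gamma x.
Proof.
move=> x1 a0; set y := x + a; have y1 : 1 <= y by rewrite /y; lra.
have Ix := is_RInt_gen_Gamma x1.
have Iy := is_RInt_gen_Gamma y1.
have Iy1 := is_RInt_gen_Gamma (ltac:(lra) : 1 <= y + 1).
set c := Rpower y a; have c0 : 0 < c := Rpower_gt0 _ _.
have Ilow := half_line_integral_lin (1 + a) (- (a / y)) Iy Iy1.
have := half_line_integral_le Ilow (half_line_integral_lin c 0 Ix Ix).
rewrite Gamma_S // Rmult_0_l Rplus_0_r.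
have -> : (1 + a) * Gamma y + - (a / y) * (y * Gamma y) = Gamma y by field; lra.
apply=> t t0; rewrite /gamma_integrand Rmult_0_l Rplus_0_r.
have q0 : 0 < t / y by apply: Rdiv_lt_0_compat; lra.
have tan := @Rpower_tangent (t / y) (- a) q0 ltac:(right; lra).
have e1 : Rpower t (- a) * c = Rpower (t / y) (- a).
  rewrite /c /Rpower -exp_plus /Rdiv ln_mult ?ln_Rinv //; try lra.
    by congr exp; ring.
  by apply: Rinv_0_lt_compat; lra.
have eyx : Rpower t (x - 1) = Rpower t (- a) * Rpower t (y - 1).
  by rewrite -Rpower_plus; congr Rpower; rewrite /y; ring.
have -> : Rpower t (y + 1 - 1) = t * Rpower t (y - 1).
  by rewrite -{2}(Rpower_1 t) // -Rpower_plus; congr Rpower; ring.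
set p := Rpower t (y - 1) * exp (- t).
have p0 : 0 < p by apply: Rmult_lt_0_compat; apply: exp_pos.
have -> : (1 + a) * p + - (a / y) * (t * Rpower t (y - 1) * exp (- t)) =
  (1 + - a * (t / y - 1)) * p by rewrite /p; field; lra.
have -> : c * (Rpower t (x - 1) * exp (- t)) = Rpower (t / y) (- a) * p.
  by rewrite -e1 eyx /p; ring.
by apply: Rmult_le_compat_r; lra.
Qed.

(** This makes the factor [/ Gamma eta] of the local limit bounded for bounded
exponents. *)
Lemma Gamma_lower (a : R) : 0 <= a -> / (1 + a) <= Gamma (1 + a).
Proof.
move=> a0.
have G2 : Gamma 2 = 1 by rewrite (_ : 2 = 1 + 1) ?Gamma_S ?Gamma_1; lra.
have := @Gamma_add_ge 2 a (Rle_refl 2) a0.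
have -> : Rpower (2 - 1) a = 1.
  by rewrite (_ : 2 - 1 = 1); [rewrite /Rpower ln_1 Rmult_0_r exp_0 | ring].
have -> : 2 + a = 1 + a + 1 by ring.
rewrite Gamma_S ?G2; last lra.
move=> h; apply: (Rmult_le_reg_l (1 + a)); first lra.
rewrite Rinv_r; lra.
Qed.

Lemma Gamma_gt0 (x : R) : 1 <= x -> 0 < Gamma x.
Proof.
move=> x1; have := @Gamma_lower (x - 1) ltac:(lra).
rewrite (_ : 1 + (x - 1) = x); last ring.
have : 0 < / x by apply: Rinv_0_lt_compat; lra.
lra.
Qed.

Lemma rising_ratio_Gamma (eta : R) (j : nat) : 1 <= eta ->
  rising_ratio eta j * Gamma eta * Gamma (INR j + 1) = Gamma (INR j + eta).
Proof.
move=> eta1; elim: j => [|j IH].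
  by rewrite /= Rplus_0_l Rplus_0_l Gamma_1; ring.
have ij := pos_INR j.
rewrite (_ : INR j.+1 + eta = INR j + eta + 1); last by rewrite S_INR; ring.
rewrite (@Gamma_S (INR j.+1)); last by rewrite S_INR; lra.
rewrite (@Gamma_S (INR j + eta)); last by lra.
rewrite -IH -S_INR.
have h := rising_ratio_S eta j.
have -> : rising_ratio eta j.+1 * Gamma eta * (INR j.+1 * Gamma (INR j.+1)) =
  rising_ratio eta j.+1 * INR j.+1 * Gamma eta * Gamma (INR j.+1) by ring.
rewrite h; ring.
Qed.

(** The asymptotics [rising_ratio eta j ~ j ^ (eta - 1) / Gamma eta] with explicit
bounds: the left-hand side is a quotient of values of [Gamma] at distance
[eta - 1], which the two inequalities above control. *)
Lemma rising_ratio_bounds (eta : R) (j : nat) : 1 <= eta -> (0 < j)%N ->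
  Rpower (INR j) (eta - 1) <= rising_ratio eta j * Gamma eta
    <= Rpower (INR j + eta) (eta - 1).
Proof.
move=> eta1 j0.
have j1 : 1 <= INR j by apply: (le_INR 1); apply/leP.
have G0 := @Gamma_gt0 (INR j + 1) ltac:(lra).
have := rising_ratio_Gamma j eta1.
have -> : INR j + eta = INR j + 1 + (eta - 1) by ring.
move=> eqG.
have lo := @Gamma_add_ge (INR j + 1) (eta - 1) ltac:(lra) ltac:(lra).
have hi := @Gamma_add_le (INR j + 1) (eta - 1) ltac:(lra) ltac:(lra).
rewrite (_ : INR j + 1 - 1 = INR j) in lo; last ring.
split; apply: (Rmult_le_reg_r (Gamma (INR j + 1))) => //; lra.
Qed.

(** * Local limit of the negative binomial law *)

Definition gamma_density (eta x : R) : R :=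
  Rpower x (eta - 1) * exp (- x) / Gamma eta.

Lemma mean_value_two_sided (f df : R -> R) (x y : R) :
  (forall c, Rmin x y <= c <= Rmax x y -> is_derive f c (df c)) ->
  exists c, Rmin x y <= c <= Rmax x y /\ f y - f x = df c * (y - x).
Proof.
move=> der; apply: MVT_gen => c hc; first by apply: der; lra.
apply/continuity_pt_filterlim.
by apply: (@ex_derive_continuous _ R_NormedModule f c); exists (df c); apply: der.
Qed.

Lemma taylor_quadratic (f df ddf : R -> R) (K x y : R) :
  (forall c, Rmin x y <= c <= Rmax x y -> is_derive f c (df c)) ->
  (forall c, Rmin x y <= c <= Rmax x y -> is_derive df c (ddf c)) ->
  (forall c, Rmin x y <= c <= Rmax x y -> Rabs (ddf c) <= K) ->
  Rabs (f y - f x - df x * (y - x)) <= K * (y - x) ^ 2.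
Proof.
move=> der1 der2 le_K.
have [c [hc ->]] := mean_value_two_sided der1.
have sub d : Rmin x c <= d <= Rmax x c -> Rmin x y <= d <= Rmax x y.
  move: hc.
  by rewrite /Rmin /Rmax; case: (Rle_dec x c); case: (Rle_dec x y) => *; lra.
have [d [hd eqd]] := @mean_value_two_sided df ddf x c (fun d hd => der2 d (sub d hd)).
have -> : df c * (y - x) - df x * (y - x) = ddf d * ((c - x) * (y - x)).
  by rewrite -Rmult_minus_distr_r eqd; ring.
rewrite Rabs_mult; have le_d := le_K d (sub d hd).
apply: Rmult_le_compat => //; try exact: Rabs_pos.
rewrite -(Rabs_pos_eq ((y - x) ^ 2)); last exact: pow2_ge_0.
rewrite /= Rmult_1_r !Rabs_mult; apply: Rmult_le_compat_r; first exact: Rabs_pos.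
move: hc; rewrite /Rmin /Rmax; case: (Rle_dec x y) => h hc.
  by rewrite !Rabs_pos_eq; lra.
by rewrite !Rabs_left1; lra.
Qed.

Section NegativeBinomialLimit.

Variables B rho eta : R.
Hypothesis B_ge1 : 1 <= B.
Hypothesis rho_range : 0 < rho < 1.
Hypothesis eta_range : 1 <= eta <= B + 1.

Let al := alpha rho.
Let K0 := Rpower (2 * B + 1) B.

Let al_gt0 : 0 < al.
Proof. by apply: Rdiv_lt_0_compat; lra. Qed.

Let rho_eq : rho * (1 + al) = al.
Proof. by rewrite /al /alpha; field; lra. Qed.

Let one_rho : 1 - rho = / (1 + al).
Proof. by rewrite /al /alpha; field; lra. Qed.

Let ln_rho_le : ln rho <= - / (1 + al).
Proof.
have := @ln_le_tangent rho 1 (proj1 rho_range) Rlt_0_1; rewrite ln_1.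
have := one_rho; lra.
Qed.

Let ln_rho_ge : - / al <= ln rho.
Proof.
have r0 := proj1 rho_range.
have := @ln_le_tangent (/ rho) 1 (Rinv_0_lt_compat _ r0) Rlt_0_1.
rewrite ln_1 ln_Rinv // (_ : / rho / 1 - 1 = / al); first lra.
by rewrite -{1}(Rmult_1_l (/ rho)) /al /alpha; field; lra.
Qed.

Let Gamma_inv_le : / Gamma eta <= B + 1.
Proof.
have := @Gamma_lower (eta - 1) ltac:(lra).
rewrite (_ : 1 + (eta - 1) = eta); last ring.
move=> h; have := Rinv_le_contravar _ _ (Rinv_0_lt_compat eta ltac:(lra)) h.
rewrite Rinv_inv; lra.
Qed.

Let Gamma_pos : 0 < Gamma eta.
Proof. by apply: Gamma_gt0; lra. Qed.

Let K0_ge1 : 1 <= K0.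
Proof.
rewrite -[X in X <= _]exp_0; apply: exp_monotone; apply: Rmult_le_pos; first lra.
by apply: ln_ge0; lra.
Qed.

Let power_exp_K0 x : 0 < x -> Rpower x (eta - 1) * exp (- x) <= K0.
Proof.
move=> x0; apply: Rle_trans (@power_exp_le _ B _ _ x0) _; first lra.
rewrite -[X in _ <= X]Rmult_1_r; apply: Rmult_le_compat_l.
  by apply: Rlt_le; apply: exp_pos.
by rewrite -[X in _ <= X]exp_0; apply: exp_monotone; lra.
Qed.

Lemma gamma_density_gt0 x : 0 < gamma_density eta x.
Proof. by apply: Rdiv_lt_0_compat => //; apply: Rmult_lt_0_compat; apply: exp_pos. Qed.

Lemma gamma_density_le x : 0 < x -> gamma_density eta x <= (B + 1) * K0.
Proof.
move=> x0; rewrite /gamma_density /Rdiv Rmult_comm.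
apply: Rmult_le_compat => //; last exact: power_exp_K0.
  by apply: Rlt_le; apply: Rinv_0_lt_compat.
by apply: Rlt_le; apply: Rmult_lt_0_compat; apply: exp_pos.
Qed.

Lemma gamma_density_ge x : 1 <= x <= B ->
  exp (- B) * / Rpower (B + 1) B <= gamma_density eta x.
Proof.
move=> hx; rewrite /gamma_density /Rdiv.
apply: Rmult_le_compat.
- by apply: Rlt_le; apply: exp_pos.
- by apply: Rlt_le; apply: Rinv_0_lt_compat; apply: exp_pos.
- rewrite -[X in X <= _]Rmult_1_l; apply: Rmult_le_compat; try lra.
  + by apply: Rlt_le; apply: exp_pos.
  + rewrite -[X in X <= _]exp_0; apply: exp_monotone.
    by have := @ln_ge0 x ltac:(lra); nra.
  by apply: exp_monotone; lra.
apply: Rinv_le_contravar => //.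
have := @Gamma_add_le 1 (eta - 1) ltac:(lra) ltac:(lra).
rewrite (_ : 1 + (eta - 1) = eta) ?Gamma_1 ?Rmult_1_r; last ring.
move=> h; apply: Rle_trans h _; apply: Rpower_ln_le.
have l1 : ln eta <= ln (B + 1) by apply: ln_le; lra.
have l0 := @ln_ge0 eta ltac:(lra).
by apply: Rmult_le_compat; lra.
Qed.

Let nb_exp j : al * nb rho eta j * Gamma eta =
  exp (ln al - eta * ln (1 + al) + INR j * ln rho) * (rising_ratio eta j * Gamma eta).
Proof.
rewrite /nb one_rho -Rpower_pow; last lra.
rewrite /Rpower ln_Rinv; last lra.
rewrite !exp_plus exp_ln // (_ : eta * - ln (1 + al) = - (eta * ln (1 + al))); last ring.
ring.
Qed.

Lemma scaled_nb_le j : al * nb rho eta j <= (B + 1) * (exp (B + 1) * K0).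
Proof.
suff main : al * nb rho eta j * Gamma eta <= exp (B + 1) * K0.
  have -> : al * nb rho eta j = / Gamma eta * (al * nb rho eta j * Gamma eta).
    by field; lra.
  apply: Rmult_le_compat => //.
    by apply: Rlt_le; apply: Rinv_0_lt_compat.
  have := nb_gt0 rho_range (ltac:(lra) : 0 < eta) j => nj.
  by apply: Rlt_le; do 2![apply: Rmult_lt_0_compat => //].
have lnal : ln al <= ln (1 + al) by apply: ln_le; lra.
have lnal0 := @ln_ge0 (1 + al) ltac:(lra).
have IV : 0 < / (1 + al) <= 1.
  split; first by apply: Rinv_0_lt_compat; lra.
  by rewrite -[X in _ <= X]Rinv_1; apply: Rinv_le_contravar; lra.
case: (posnP j) => [->|j0].
  rewrite nb_exp [rising_ratio _ _]/= Rmult_1_l Rmult_0_l Rplus_0_r.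
  have e1 : exp (ln al - eta * ln (1 + al)) <= 1.
    by rewrite -[X in _ <= X]exp_0; apply: exp_monotone; nra.
  have G1 : Gamma eta <= exp (B + 1) * K0.
    have := @Gamma_add_le 1 (eta - 1) ltac:(lra) ltac:(lra).
    rewrite (_ : 1 + (eta - 1) = eta) ?Gamma_1 ?Rmult_1_r; last ring.
    move=> h; apply: Rle_trans h _.
    have -> : Rpower eta (eta - 1) = exp eta * (Rpower eta (eta - 1) * exp (- eta)).
      by rewrite exp_Ropp; field; have := exp_pos eta; lra.
    apply: Rmult_le_compat.
    + by apply: Rlt_le; apply: exp_pos.
    + by apply: Rlt_le; apply: Rmult_lt_0_compat; apply: exp_pos.
    + by apply: exp_monotone; lra.
    by apply: power_exp_K0; lra.
  have := exp_pos (ln al - eta * ln (1 + al)); nra.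
rewrite nb_exp.
have j1 : 1 <= INR j by apply: (le_INR 1); apply/leP.
have [_ hi] := @rising_ratio_bounds eta j ltac:(lra) j0.
apply: Rle_trans (Rmult_le_compat_l _ _ _ (Rlt_le _ _ (exp_pos _)) hi) _.
set u := (INR j + eta) / (1 + al).
have u0 : 0 < u by apply: Rdiv_lt_0_compat; lra.
apply: Rle_trans (_ : _ <= exp (B + 1) * (Rpower u (eta - 1) * exp (- u))) _; last first.
  apply: Rmult_le_compat_l; last exact: power_exp_K0.
  by apply: Rlt_le; apply: exp_pos.
rewrite /Rpower -!exp_plus; apply: exp_monotone.
have -> : ln u = ln (INR j + eta) - ln (1 + al).
  by rewrite /u /Rdiv ln_mult ?ln_Rinv //; try lra; apply: Rinv_0_lt_compat; lra.
have h1 : INR j * ln rho <= INR j * - / (1 + al) by apply: Rmult_le_compat_l; lra.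
have h2 : u = INR j * / (1 + al) + eta * / (1 + al) by rewrite /u; field; lra.
have h3 : eta * / (1 + al) <= (B + 1) * 1 by apply: Rmult_le_compat; lra.
nra.
Qed.

(** Near [xi al] the two-sided bounds on the binomial ratio and on [ln rho] give
the relative precision [C2 / al]. *)
Let C2 := (B + 1) + 2 * (B + 1) ^ 2.

Lemma scaled_nb_near j xi : 1 <= al -> 1 <= xi <= B -> Rabs (INR j / al - xi) <= / 2 ->
  Rabs (al * nb rho eta j - gamma_density eta (INR j / al))
    <= (B + 1) * K0 * (C2 * exp C2) / al.
Proof.
move=> al1 hxi /Rabs_le_between; set x := INR j / al => hx.
have x_half : / 2 <= x by lra.
have j_eq : INR j = x * al by rewrite /x; field; lra.
have j0 : (0 < j)%N.
  by case: (posnP j) => // j0; move: j_eq; rewrite j0 /=; nra.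
have j_gt0 : 0 < INR j by apply: lt_0_INR; apply/ltP.
have [lo hi] := @rising_ratio_bounds eta j ltac:(lra) j0.
have C2_gt0 : 0 < C2 by rewrite /C2; nra.
set T := al * nb rho eta j * Gamma eta.
set T0 := Rpower x (eta - 1) * exp (- x).
have T0_gt0 : 0 < T0 by apply: Rmult_lt_0_compat; apply: exp_pos.
have ln_al : ln al = ln rho + ln (1 + al) by rewrite -ln_mult ?rho_eq //; lra.
have ln_j : ln (INR j) = ln x + ln al by rewrite j_eq ln_mult //; lra.
have alV : 0 < / al by apply: Rinv_0_lt_compat.
have Tlo : T0 * exp (- (C2 * / al)) <= T.
  rewrite /T nb_exp.
  apply: Rle_trans (Rmult_le_compat_l _ _ _ (Rlt_le _ _ (exp_pos _)) lo).
  rewrite /T0 /Rpower -!exp_plus; apply: exp_monotone.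
  rewrite ln_j ln_al.
  have h1 : (eta + INR j) * - / al <= (eta + INR j) * ln rho by apply: Rmult_le_compat_l; lra.
  have h2 : INR j * / al = x by rewrite j_eq; field; lra.
  have h3 : eta * / al <= C2 * / al by apply: Rmult_le_compat_r; rewrite /C2; nra.
  nra.
have Thi : T <= T0 * exp (C2 * / al).
  rewrite /T nb_exp.
  apply: Rle_trans (Rmult_le_compat_l _ _ _ (Rlt_le _ _ (exp_pos _)) hi) _.
  rewrite /T0 /Rpower -!exp_plus; apply: exp_monotone.
  have h0 : ln (INR j + eta) <= ln (INR j) + eta / INR j.
    have := @ln_le_tangent (INR j + eta) (INR j) ltac:(lra) j_gt0.
    rewrite (_ : (INR j + eta) / INR j - 1 = eta / INR j); [lra | field; lra].
  have h1 : (eta + INR j) * ln rho <= (eta + INR j) * - / (1 + al) by apply: Rmult_le_compat_l; lra.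
  have IV : 0 < / (1 + al) by apply: Rinv_0_lt_compat; lra.
  have h2 : INR j * / (1 + al) = x - x * / (1 + al) by rewrite j_eq; field; lra.
  have h3 : / (1 + al) <= / al by apply: Rinv_le_contravar; lra.
  have h4 : x * / (1 + al) <= (B + 1) * / al by apply: Rmult_le_compat; lra.
  have h5 : (eta - 1) * (eta / INR j) <= 2 * (B + 1) ^ 2 * / al.
    have -> : (eta - 1) * (eta / INR j) = (eta - 1) * eta * / x * / al.
      by rewrite j_eq; field; lra.
    apply: Rmult_le_compat_r; first lra.
    have xV : / x <= 2 by rewrite -(Rinv_inv 2); apply: Rinv_le_contravar; lra.
    have xV0 : 0 < / x by apply: Rinv_0_lt_compat; lra.
    have : (eta - 1) * eta <= (B + 1) ^ 2 by nra.
    have : 0 <= (eta - 1) * eta by nra.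
    nra.
  have h6 : (eta - 1) * ln (INR j + eta) <= (eta - 1) * (ln (INR j) + eta / INR j).
    by apply: Rmult_le_compat_l; lra.
  have h7 : 0 < eta * / (1 + al) by apply: Rmult_lt_0_compat; lra.
  rewrite ln_j ln_al in h6 *; rewrite /C2.
  nra.
have dT : Rabs (T - T0) <= K0 * (C2 * exp C2) / al.
  have T0K : T0 <= K0 by apply: power_exp_K0; lra.
  set z := C2 * / al in Tlo Thi *.
  have z0 : 0 < z by apply: Rmult_lt_0_compat.
  have zC : z <= C2.
    rewrite -[X in _ <= X]Rmult_1_r; apply: Rmult_le_compat_l; first lra.
    by rewrite -[X in _ <= X]Rinv_1; apply: Rinv_le_contravar; lra.
  have e1 : exp (- z) >= 1 - z by have := exp_ineq1_le (- z); lra.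
  have e2 : exp z * (1 - z) <= 1.
    have ez : exp z * exp (- z) = 1 by rewrite -exp_plus Rplus_opp_r exp_0.
    rewrite -ez; apply: Rmult_le_compat_l; last lra.
    by apply: Rlt_le; apply: exp_pos.
  have e3 : exp z <= exp C2 by apply: exp_monotone.
  have e4 : 1 <= exp C2 by rewrite -[X in X <= _]exp_0; apply: exp_monotone; lra.
  have e5 : exp z - 1 <= z * exp C2 by nra.
  have -> : K0 * (C2 * exp C2) / al = K0 * (z * exp C2) by rewrite /z; field; lra.
  have m1 : T0 * (z * exp C2) <= K0 * (z * exp C2).
    by apply: Rmult_le_compat_r => //; apply: Rmult_le_pos; lra.
  have m2 : T0 * (exp z - 1) <= T0 * (z * exp C2) by apply: Rmult_le_compat_l; lra.
  have m3 : T0 * (1 - exp (- z)) <= T0 * (z * exp C2).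
    by apply: Rmult_le_compat_l; nra.
  by apply: Rabs_le; split; lra.
have -> : al * nb rho eta j - gamma_density eta x = / Gamma eta * (T - T0).
  by rewrite /T /T0 /gamma_density; field; lra.
rewrite Rabs_mult (Rabs_pos_eq (/ _)); last by apply: Rlt_le; apply: Rinv_0_lt_compat.
have -> : (B + 1) * K0 * (C2 * exp C2) / al = (B + 1) * (K0 * (C2 * exp C2) / al).
  by field; lra.
apply: Rmult_le_compat => //; last exact: Rabs_pos.
by apply: Rlt_le; apply: Rinv_0_lt_compat.
Qed.

Let G := (B + 1) * K0.

Lemma gamma_density_taylor xi x : 1 <= xi <= B -> Rabs (x - xi) <= / 2 ->
  Rabs (gamma_density eta x - gamma_density eta xi
        - gamma_density eta xi * ((eta - 1) / xi - 1) * (x - xi))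
    <= G * ((2 * B + 1) ^ 2 + 4 * B) * (x - xi) ^ 2.
Proof.
move=> hxi /Rabs_le_between hx.
pose df c := gamma_density eta c * ((eta - 1) / c - 1).
pose ddf c := gamma_density eta c * (((eta - 1) / c - 1) ^ 2 - (eta - 1) / c ^ 2).
have pos c : Rmin xi x <= c <= Rmax xi x -> / 2 <= c.
  by rewrite /Rmin /Rmax; case: (Rle_dec xi x) => ? ?; lra.
have der1 c : / 2 <= c -> is_derive (gamma_density eta) c (df c).
  move=> hc; rewrite /df /gamma_density /Rpower; auto_derive; first lra.
  by field; lra.
apply: (taylor_quadratic (df := df) (ddf := ddf)) => c /pos hc.
- exact: der1.
- have com : forall n m : R_AbsRing, mult n m = mult m n by move=> *; exact: Rmult_comm.
  have d2 : is_derive (fun c => (eta - 1) / c - 1) c (- (eta - 1) / c ^ 2).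
    by auto_derive; [lra | field; lra].
  have := is_derive_mult _ _ _ _ _ (der1 c hc) d2 com; congr is_derive.
  by rewrite /plus /mult /= /ddf /df; field; lra.
have cV : 0 < / c by apply: Rinv_0_lt_compat; lra.
have cV2 : / c <= 2 by rewrite -(Rinv_inv 2); apply: Rinv_le_contravar; lra.
have g0 := gamma_density_gt0 c; have gG : gamma_density eta c <= G.
  by apply: gamma_density_le; lra.
rewrite /ddf Rabs_mult (Rabs_pos_eq (gamma_density _ _)); last lra.
apply: Rmult_le_compat => //; [lra | exact: Rabs_pos|].
have q1 : 0 <= (eta - 1) * / c <= B * 2.
  by split; [apply: Rmult_le_pos; lra | apply: Rmult_le_compat; lra].
have q2 : (eta - 1) / c ^ 2 = (eta - 1) * / c * / c by field; lra.
rewrite q2 /Rdiv; set q := (eta - 1) * / c in q1 *.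
have q3 : 0 <= q * / c <= B * 2 * 2.
  by split; [apply: Rmult_le_pos; lra | apply: Rmult_le_compat; lra].
have q4 : 0 <= (q - 1) ^ 2 <= (2 * B + 1) ^ 2.
  by split; [exact: pow2_ge_0 | nra].
by apply: Rabs_le; split; lra.
Qed.

Lemma gamma_density_slope_le xi : 1 <= xi <= B ->
  Rabs (gamma_density eta xi * ((eta - 1) / xi - 1)) <= G * (B + 1).
Proof.
move=> hxi; rewrite Rabs_mult.
apply: Rmult_le_compat; [exact: Rabs_pos.. | |].
  rewrite Rabs_pos_eq; first by apply: gamma_density_le; lra.
  by apply: Rlt_le; apply: gamma_density_gt0.
have xV : 0 < / xi <= 1.
  split; first by apply: Rinv_0_lt_compat; lra.
  by rewrite -[X in _ <= X]Rinv_1; apply: Rinv_le_contravar; lra.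
have : 0 <= (eta - 1) * / xi <= B * 1.
  by split; [apply: Rmult_le_pos; lra | apply: Rmult_le_compat; lra].
by rewrite /Rdiv => ?; apply: Rabs_le; lra.
Qed.

Let N := (B + 1) * (exp (B + 1) * K0).

(** Within distance 1/2 of [xi] this is the second-order expansion of the limit
density; further away the right-hand side is at least of order 1, and both
sides being bounded is enough. *)
Lemma scaled_nb_taylor xi j : 1 <= al -> 1 <= xi <= B ->
  Rabs (al * nb rho eta j - gamma_density eta xi
        - gamma_density eta xi * ((eta - 1) / xi - 1) * (INR j / al - xi))
  <= (4 * N + 4 * G + 2 * (G * (B + 1)) + G * ((2 * B + 1) ^ 2 + 4 * B)
      + (B + 1) * K0 * (C2 * exp C2)) * ((INR j / al - xi) ^ 2 + / al).
Proof.
move=> al1 hxi; set u := INR j / al - xi; set s := _ * (_ - 1).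
have alV : 0 < / al by apply: Rinv_0_lt_compat.
have G0 : 0 < G by apply: Rmult_lt_0_compat; [lra | exact: exp_pos].
have N0 : 0 < N by do 2![apply: Rmult_lt_0_compat; try lra; try exact: exp_pos].
have C20 : 0 < C2 by rewrite /C2; nra.
have M0 : 0 < (B + 1) * K0 * (C2 * exp C2).
  by apply: Rmult_lt_0_compat => //; apply: Rmult_lt_0_compat => //; exact: exp_pos.
set M := _ * (C2 * exp C2) in M0 *.
have T0 : 0 < G * ((2 * B + 1) ^ 2 + 4 * B) by apply: Rmult_lt_0_compat => //; nra.
set T := G * (_ + 4 * B) in T0 *.
have GB0 : 0 < G * (B + 1) by apply: Rmult_lt_0_compat => //; lra.
have u2 := pow2_ge_0 u.
case: (Rle_lt_dec (Rabs u) (/ 2)) => [near|far].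
  have h1 := scaled_nb_near al1 hxi near.
  have h2 := gamma_density_taylor hxi near.
  rewrite -/u -/s -/T in h2; rewrite -/M in h1.
  set x := INR j / al in h1 h2 *.
  have -> : al * nb rho eta j - gamma_density eta xi - s * u =
    (al * nb rho eta j - gamma_density eta x) +
    (gamma_density eta x - gamma_density eta xi - s * u) by ring.
  apply: Rle_trans (Rabs_triang _ _) _.
  have : 0 <= T * / al by apply: Rmult_le_pos; lra.
  have : 0 <= M * u ^ 2 by apply: Rmult_le_pos; lra.
  have : 0 <= (4 * N + 4 * G + 2 * (G * (B + 1))) * (u ^ 2 + / al) by apply: Rmult_le_pos; lra.
  rewrite /Rdiv in h1; lra.
have nb0 := nb_gt0 rho_range (ltac:(lra) : 0 < eta) j.
have h1 : 0 <= al * nb rho eta j <= N.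
  by split; [apply: Rmult_le_pos; lra | exact: scaled_nb_le].
have h2 : 0 < gamma_density eta xi <= G.
  by split; [exact: gamma_density_gt0 | apply: gamma_density_le; lra].
have h3 : Rabs (s * u) <= G * (B + 1) * Rabs u.
  by rewrite Rabs_mult; apply: Rmult_le_compat_r; [exact: Rabs_pos | exact: gamma_density_slope_le].
have h4 : Rabs u <= 2 * u ^ 2 by rewrite -(pow2_abs u); nra.
have h5 : 1 <= 4 * u ^ 2 by rewrite -(pow2_abs u); nra.
have h6 : G * (B + 1) * Rabs u <= G * (B + 1) * (2 * u ^ 2) by apply: Rmult_le_compat_l; lra.
have h7 : N * 1 <= N * (4 * u ^ 2) by apply: Rmult_le_compat_l; lra.
have h8 : G * 1 <= G * (4 * u ^ 2) by apply: Rmult_le_compat_l; lra.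
apply: Rle_trans (_ : _ <= N + G + G * (B + 1) * Rabs u) _.
  move/Rabs_le_between: h3 => h3; apply: Rabs_le; lra.
have : 0 <= (T + M) * (u ^ 2 + / al) by apply: Rmult_le_pos; lra.
have : 0 <= (4 * N + 4 * G + 2 * (G * (B + 1))) * / al by apply: Rmult_le_pos; lra.
lra.
Qed.

End NegativeBinomialLimit.

(** The expansion is of second order in the position because the position will
be averaged over an independent centred sum, which removes the linear term.
The constants above depend on [B] only; from here on just their existence
matters. *)
Lemma negative_binomial_limit (B : R) : 1 <= B -> exists K, 0 < K /\
  forall rho eta xi, 0 < rho < 1 -> 1 <= alpha rho -> 1 <= eta <= B + 1 ->
  1 <= xi <= B ->
  let g := gamma_density eta xi in
  [/\ / K <= g <= K,
      Rabs (g * ((eta - 1) / xi - 1)) <= K,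
      forall j, alpha rho * nb rho eta j <= K &
      forall j, Rabs (alpha rho * nb rho eta j - g
                      - g * ((eta - 1) / xi - 1) * (INR j / alpha rho - xi))
                <= K * ((INR j / alpha rho - xi) ^ 2 + / alpha rho)].
Proof.
move=> B1.
pose K0 := Rpower (2 * B + 1) B; pose C2 := (B + 1) + 2 * (B + 1) ^ 2.
pose G := (B + 1) * K0; pose N := (B + 1) * (exp (B + 1) * K0).
pose K1 := 4 * N + 4 * G + 2 * (G * (B + 1)) + G * ((2 * B + 1) ^ 2 + 4 * B)
      + (B + 1) * K0 * (C2 * exp C2).
pose K2 := exp (- B) * / Rpower (B + 1) B.
have K00 : 0 < K0 := exp_pos _.
have G0 : 0 < G by apply: Rmult_lt_0_compat; lra.
have N0 : 0 < N.
  by apply: Rmult_lt_0_compat; [lra | apply: Rmult_lt_0_compat => //; exact: exp_pos].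
have C20 : 0 < C2 by rewrite /C2; nra.
have M0 : 0 < (B + 1) * K0 * (C2 * exp C2).
  by apply: Rmult_lt_0_compat => //; apply: Rmult_lt_0_compat => //; exact: exp_pos.
have T0 : 0 < G * ((2 * B + 1) ^ 2 + 4 * B) by apply: Rmult_lt_0_compat => //; nra.
have GB0 : 0 < G * (B + 1) by apply: Rmult_lt_0_compat => //; lra.
have K10 : 0 < K1 by rewrite /K1; lra.
have K20 : 0 < K2.
  by apply: Rmult_lt_0_compat; [|apply: Rinv_0_lt_compat]; exact: exp_pos.
have K20V := Rinv_0_lt_compat _ K20.
have slope_K1 : G * (B + 1) <= K1 by rewrite /K1; lra.
exists (K1 + / K2); split; first lra.
move=> rho eta xi hrho al1 heta hxi g; split.
- split.
    apply: Rle_trans (gamma_density_ge heta hxi); rewrite -[X in _ <= X]Rinv_inv.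
    by apply: Rinv_le_contravar; rewrite -/K2; lra.
  have := @gamma_density_le B eta heta xi ltac:(lra); rewrite -/K0 -/G -/g /K1; lra.
- have h := gamma_density_slope_le B1 hrho heta hxi; rewrite -/K0 -/G in h; apply: Rle_trans h _; lra.
- move=> j; have := @scaled_nb_le B rho eta hrho heta j; rewrite -/K0 -/N /K1; lra.
move=> j; have alV : 0 < / alpha rho by apply: Rinv_0_lt_compat; lra.
apply: Rle_trans (scaled_nb_taylor B1 hrho heta j al1 hxi) _.
rewrite -/K0 -/C2 -/G -/N -/K1; apply: Rmult_le_compat_r; last lra.
have := pow2_ge_0 (INR j / alpha rho - xi); lra.
Qed.

(** * Bounds on coefficients through the decay of the transform *)

Lemma moment1_conv (a b : nat -> R) :
  summable a -> summable b -> moment1 a -> moment1 b -> moment1 (conv a b).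
Proof.
move=> sa sb ma mb.
apply: (@summable_le _ (fun x => Rabs (conv (weighted a) b x) + Rabs (conv a (weighted b) x))).
  move=> x; have := conv_weight_add a b 0 0 x; rewrite Rplus_0_l Rminus_0_r.
  rewrite (@conv_local (fun i => a i * (INR i - 0)) b (weighted a) b) //
    ?(@conv_local a (fun i => b i * (INR i - 0)) a (weighted b)) //;
    try by move=> i _; rewrite Rminus_0_r.
  by move=> h; rewrite [weighted (conv a b) x]/weighted h; apply: Rabs_triang.
by apply: ex_series_plus; apply: summable_conv.
Qed.

(** The damping [exp (- c v^2)] beats the exponential growth of the square
root: this allows a single explicit primitive to control the Gaussian-damped
integrals, also for exponents close to those where they would diverge. *)
Lemma damped_power_le (c s v a : R) : 0 < c -> 0 < s <= 1 -> 0 <= v -> 0 <= a <= / 2 ->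
  Rpower (s + v) (- a) * exp (- (c * v ^ 2)) <=
    exp (2 + / c) * (exp (- sqrt (s + v)) / sqrt (s + v)).
Proof.
move=> c0 hs v0 ha; set w := sqrt (s + v).
have w0 : 0 < w by apply: sqrt_lt_R0; lra.
have ww : w * w = s + v by rewrite sqrt_sqrt; lra.
have w1 : w <= 1 + v by nra.
have -> : Rpower (s + v) (- a) = Rpower w (1 - 2 * a) / w.
  rewrite -ww /Rpower ln_mult // /Rdiv -[X in _ = _ * X]exp_ln; last exact: Rinv_0_lt_compat.
  by rewrite ln_Rinv // -exp_plus; congr exp; ring.
have le_w : Rpower w (1 - 2 * a) <= exp w.
  apply: exp_monotone; have := @ln_le_tangent w 1 w0 Rlt_0_1; rewrite ln_1 => h.
  have : (1 - 2 * a) * ln w <= (1 - 2 * a) * w by apply: Rmult_le_compat_l; lra.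
  have : (1 - 2 * a) * w <= 1 * w by apply: Rmult_le_compat_r; lra.
  lra.
have -> : Rpower w (1 - 2 * a) / w * exp (- (c * v ^ 2)) =
  Rpower w (1 - 2 * a) * exp (- (c * v ^ 2)) * / w by field; lra.
have -> : exp (2 + / c) * (exp (- w) / w) = exp (2 + / c) * exp (- w) * / w by field; lra.
apply: Rmult_le_compat_r; first by apply: Rlt_le; apply: Rinv_0_lt_compat.
apply: Rle_trans (_ : _ <= exp w * exp (- (c * v ^ 2))) _.
  by apply: Rmult_le_compat_r => //; apply: Rlt_le; apply: exp_pos.
rewrite -!exp_plus; apply: exp_monotone.
have cV : c * / c = 1 by field; lra.
have : 2 * v - c * v ^ 2 <= / c.
  have : 0 <= c * (v - / c) ^ 2 by apply: Rmult_le_pos; [lra | exact: pow2_ge_0].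
  have -> : c * (v - / c) ^ 2 = c * v ^ 2 - 2 * v * (c * / c) + (c * / c) * / c by ring.
  rewrite cV; lra.
lra.
Qed.

Lemma is_RInt_damped (s sig : R) : 0 < s -> 0 < sig -> exists I,
  is_RInt (fun t => exp (- sqrt (s + sig * t)) / sqrt (s + sig * t)) 0 PI I /\ I <= 2 / sig.
Proof.
move=> s0 sig0; have pi0 := PI_RGT_0.
pose F t := - (2 / sig) * exp (- sqrt (s + sig * t)).
exists (F PI - F 0); split.
  apply: (@is_RInt_derive R_CompleteNormedModule F) => t.
    rewrite Rmin_left ?Rmax_right; try lra; move=> ht.
    have st : 0 < s + sig * t by nra.
    have q0 := sqrt_lt_R0 _ st.
    by rewrite /F; auto_derive => //; field; lra.
  rewrite Rmin_left ?Rmax_right; try lra; move=> ht.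
  have st : 0 < s + sig * t by nra.
  have q0 := sqrt_lt_R0 _ st.
  apply: (@ex_derive_continuous _ R_NormedModule).
  by auto_derive; repeat split => //; lra.
have s2 : 0 < 2 / sig by apply: Rdiv_lt_0_compat; lra.
have e1 := exp_pos (- sqrt (s + sig * PI)).
have e2 : exp (- sqrt (s + sig * 0)) <= 1.
  rewrite -[X in _ <= X]exp_0; apply: exp_monotone.
  have := sqrt_pos (s + sig * 0); lra.
rewrite /F; nra.
Qed.

Lemma is_RInt_three_halves (al : R) : 0 < al -> exists I,
  is_RInt (fun t => Rpower (1 + al * t) (- (3 / 2))) 0 PI I /\ I <= 2 / al.
Proof.
move=> al0; have pi0 := PI_RGT_0.
pose F t := - (2 / al) * Rpower (1 + al * t) (- (1 / 2)).
exists (F PI - F 0); split.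
  apply: (@is_RInt_derive R_CompleteNormedModule F) => t.
    rewrite Rmin_left ?Rmax_right; try lra; move=> ht.
    have st : 0 < 1 + al * t by nra.
    have -> : Rpower (1 + al * t) (- (3 / 2)) =
        Rpower (1 + al * t) (- (1 / 2)) * / (1 + al * t).
      rewrite -{3}(Rpower_1 (1 + al * t)) // -Rpower_Ropp -Rpower_plus.
      by congr Rpower; field.
    by rewrite /F /Rpower; auto_derive => //; field; lra.
  rewrite Rmin_left ?Rmax_right; try lra; move=> ht.
  have st : 0 < 1 + al * t by nra.
  apply: (@ex_derive_continuous _ R_NormedModule).
  by rewrite /Rpower; auto_derive.
have s2 : 0 < 2 / al by apply: Rdiv_lt_0_compat; lra.
have e1 := Rpower_gt0 (1 + al * PI) (- (1 / 2)).
have e2 : Rpower (1 + al * 0) (- (1 / 2)) = 1.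
  by rewrite Rmult_0_r Rplus_0_r /Rpower ln_1 Rmult_0_r exp_0.
rewrite /F e2; nra.
Qed.

Lemma Rpower_le_1 (u a : R) : 0 < u <= 1 -> 0 <= a -> Rpower u a <= 1.
Proof.
move=> hu a0; rewrite -[X in _ <= X]exp_0; apply: exp_monotone.
have : ln u <= 0 by rewrite -ln_1; apply: ln_le; lra.
nra.
Qed.

Lemma Rpower_antitone (u a b : R) : 0 < u <= 1 -> a <= b -> Rpower u b <= Rpower u a.
Proof.
move=> hu ab; apply: exp_monotone.
have : ln u <= 0 by rewrite -ln_1; apply: ln_le; lra.
nra.
Qed.

Lemma omega_power_le (rho t a : R) : 0 < rho < 1 -> 0 <= t <= PI -> 0 <= a <= 3 / 2 ->
  Rpower (Cmod (omega rho t)) a <= 25 * Rpower (1 + alpha rho * t) (- a).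
Proof.
move=> hrho ht ha.
have al0 : 0 < alpha rho by apply: Rdiv_lt_0_compat; lra.
have w0 := Cmod_omega_gt0 hrho t; have dec := Cmod_omega_decay hrho ht.
set w := Cmod _ in w0 dec *; set u := 1 + alpha rho * t.
have u0 : 0 < u by rewrite /u; nra.
have le_w : w <= 5 / u by apply/Rle_div_r.
have -> : Rpower u (- a) = Rpower (/ u) a by rewrite /Rpower ln_Rinv //; congr exp; ring.
have uV : 0 < / u by apply: Rinv_0_lt_compat.
apply: Rle_trans (_ : _ <= Rpower 5 a * Rpower (/ u) a) _.
  rewrite Rpower_mult_distr //; last lra.
  by apply: Rle_Rpower_l; [lra | split].
apply: Rmult_le_compat_r; first by apply: Rlt_le; apply: exp_pos.
apply: Rle_trans (_ : _ <= Rpower 5 2) _; first by apply: Rle_Rpower; lra.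
have -> : Rpower 5 2 = 5 ^ 2 by rewrite -Rpower_pow; [congr Rpower; rewrite /=; ring | lra].
by rewrite /=; lra.
Qed.

(** For exponents up to 3/2 the power [(1 + al t)^(1 - eta)] decays too slowly
for a bound of order [1 / al]. The Gaussian factor cuts the integral off at
[t] of order [1 / sig], where the power has size [(sig / al)^(eta - 1)]. *)
Lemma coef_le_damped (a : nat -> R) (M : nat) (c K rho sig eta : R) :
  0 < c -> 0 <= K -> 0 < rho < 1 -> 0 < sig <= alpha rho -> 1 <= eta <= 3 / 2 ->
  summable a ->
  (forall t, 0 < t < PI -> Cmod (FT a t) <=
     K * (Rpower (1 + alpha rho * t) (1 - eta) * exp (- (c * (sig * t) ^ 2)))) ->
  Rabs (a M) <= K * exp (2 + / c) * (/ sig * Rpower (sig / alpha rho) (eta - 1)).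
Proof.
move=> c0 K0 hrho hsig heta sa le_a.
set al := alpha rho in hsig le_a *.
have al0 : 0 < al by lra.
set s := sig / al.
have hs : 0 < s <= 1.
  by split; [apply: Rdiv_lt_0_compat; lra | apply/Rle_div_l; lra].
have [I [intI le_I]] := is_RInt_damped (proj1 hs) (proj1 hsig).
set K' := K * exp (2 + / c) * Rpower s (eta - 1).
have K'0 : 0 <= K'.
  by do ![apply: Rmult_le_pos => //]; apply: Rlt_le; apply: exp_pos.
have int' := is_RInt_scal _ _ _ K' _ intI.
have le_g t : 0 < t < PI -> Cmod (FT a t) <=
    K' * (exp (- sqrt (s + sig * t)) / sqrt (s + sig * t)).
  move=> ht; apply: Rle_trans (le_a t ht) _.
  have -> : Rpower (1 + al * t) (1 - eta) =
      Rpower s (eta - 1) * Rpower (s + sig * t) (- (eta - 1)).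
    have -> : 1 + al * t = / s * (s + sig * t) by rewrite /s; field; lra.
    rewrite -Rpower_mult_distr; [|by apply: Rinv_0_lt_compat; lra | by nra].
    by congr Rmult; rewrite /Rpower ?ln_Rinv; try lra; congr exp; ring.
  have := @damped_power_le c s (sig * t) (eta - 1) c0 hs ltac:(nra) ltac:(lra).
  set A := Rpower _ _ * exp _; set B := exp _ * _ => hAB.
  rewrite /K'.
  have : K * Rpower s (eta - 1) * A <= K * Rpower s (eta - 1) * B.
    by apply: Rmult_le_compat_l => //; apply: Rmult_le_pos => //; apply: Rlt_le; apply: exp_pos.
  rewrite /A /B; lra.
have := @coef_le_integral a _ _ M sa int' le_g.
rewrite /scal /= /mult /= => hM.
have hI : K' * I <= K' * (2 / sig) by apply: Rmult_le_compat_l.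
have pi2 : 2 <= PI by have := PI2_1; lra.
have a0 := Rabs_pos (a M).
have h2 : 2 * Rabs (a M) <= K' * (2 / sig).
  by apply: Rle_trans (Rle_trans _ _ _ hM hI); apply: Rmult_le_compat_r.
rewrite -/s.
have -> : K * exp (2 + / c) * (/ sig * Rpower s (eta - 1)) = K' * (2 / sig) / 2.
  by rewrite /K'; field; lra.
lra.
Qed.

(** The exponent 3/2 is integrable on its own, with integral of order [1 / al]. *)
Lemma coef_le_three_halves (a : nat -> R) (M : nat) (K rho : R) :
  0 <= K -> 0 < rho < 1 -> summable a ->
  (forall t, 0 < t < PI -> Cmod (FT a t) <= K * Rpower (Cmod (omega rho t)) (3 / 2)) ->
  Rabs (a M) <= 25 * K / alpha rho.
Proof.
move=> K0 hrho sa le_a.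
have al0 : 0 < alpha rho by apply: Rdiv_lt_0_compat; lra.
have [I [intI le_I]] := is_RInt_three_halves al0.
have int' := is_RInt_scal _ _ _ (25 * K) _ intI.
have le_g t : 0 < t < PI -> Cmod (FT a t) <=
    25 * K * (Rpower (1 + alpha rho * t) (- (3 / 2))).
  move=> ht; apply: Rle_trans (le_a t ht) _.
  have := @omega_power_le rho t (3 / 2) hrho ltac:(lra) ltac:(lra).
  nra.
have := @coef_le_integral a _ _ M sa int' le_g.
rewrite /scal /= /mult /= => hM.
have hI : 25 * K * I <= 25 * K * (2 / alpha rho) by apply: Rmult_le_compat_l; lra.
have pi2 : 2 <= PI by have := PI2_1; lra.
have a0 := Rabs_pos (a M).
have h2 : 2 * Rabs (a M) <= 25 * K * (2 / alpha rho).
  by apply: Rle_trans (Rle_trans _ _ _ hM hI); apply: Rmult_le_compat_r.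
have -> : 25 * K / alpha rho = 25 * K * (2 / alpha rho) / 2 by field; lra.
lra.
Qed.

(** * The main term of the local limit *)

Lemma Series_lin3 (y u v w : nat -> R) (a b c : R) :
  ex_series (fun x => y x * u x) -> ex_series (fun x => y x * v x) ->
  ex_series (fun x => y x * w x) ->
  ex_series (fun x => y x * (a * u x + b * v x + c * w x)) /\
  Series (fun x => y x * (a * u x + b * v x + c * w x)) =
  a * Series (fun x => y x * u x) + b * Series (fun x => y x * v x)
  + c * Series (fun x => y x * w x).
Proof.
move=> eu ev ew.
have S : is_series (fun x => y x * (a * u x + b * v x + c * w x))
   (a * Series (fun x => y x * u x) + b * Series (fun x => y x * v x)
    + c * Series (fun x => y x * w x)).
  apply: (is_series_ext (fun x => a * (y x * u x) + b * (y x * v x) + c * (y x * w x))).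
    by move=> x; rewrite -[_ = _]/(@eq R _ _); ring.
  by apply: is_series_plus; [apply: is_series_plus|];
     apply: is_series_scal_l; exact: Series_correct.
by split; [exists (a * Series (fun x => y x * u x) + b * Series (fun x => y x * v x)
    + c * Series (fun x => y x * w x)) | exact: is_series_unique].
Qed.

Record law_with_moments (y : nat -> R) (mu v : R) : Prop := LawWithMoments {
  law_ge0 : forall x, 0 <= y x;
  law_sum : is_series y 1;
  law_mean : is_series (centered y mu) 0;
  law_moment1 : moment1 y;
  law_variance : is_series (fun x => y x * (INR x - mu) ^ 2) v
}.

Lemma law_summable y mu v : law_with_moments y mu v -> summable y.
Proof.
by case=> y0 ys _ _ _; apply: ex_series_nonneg_summable => //; exists 1.
Qed.

(** A quadratic approximation of the local probabilities needs only the mean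
and the variance of the independent summand: the linear term averages out. *)
Lemma main_term (B : R) : 1 <= B -> exists K, 0 < K /\
  forall rho eta xi sig y mu v M, 0 < rho < 1 -> 1 <= alpha rho ->
  1 <= eta <= B + 1 -> 1 <= xi <= B -> law_with_moments y mu v -> v <= sig ^ 2 ->
  Rabs (alpha rho * conv y (nb rho eta) M - gamma_density eta xi) <=
    K * ((sig / alpha rho) ^ 2 + / alpha rho
         + Rabs (INR M - mu - xi * alpha rho) / alpha rho).
Proof.
move=> B1; have [K [K0 HK]] := negative_binomial_limit B1.
exists (4 * K); split; first lra.
move=> rho eta xi sig y mu v M hrho al1 heta hxi ly le_v.
have [[_ gK] sK nbK tK] := HK rho eta xi hrho al1 heta hxi.
set g := gamma_density eta xi in gK sK tK *; set s := g * _ in sK tK.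
set al := alpha rho in al1 nbK tK *; set Delta := INR M - mu - xi * al.
have alV : 0 < / al <= 1.
  split; first by apply: Rinv_0_lt_compat; lra.
  by rewrite -[X in _ <= X]Rinv_1; apply: Rinv_le_contravar; lra.
have g0 : 0 < g by apply: (@gamma_density_gt0 B).
pose h x := if (x <= M)%N then nb rho eta (M - x) else 0.
pose Z x := (INR M - INR x) / al - xi.
have h_range x : 0 <= al * h x <= K.
  rewrite /h; case: ifP => _; last by rewrite Rmult_0_r; lra.
  by split=> //; apply: Rmult_le_pos; [lra | apply: Rlt_le; apply: nb_gt0; lra].
have approx x : Rabs (al * h x - g - s * Z x) <= 2 * K * (Z x ^ 2 + / al).
  have Z2 := pow2_ge_0 (Z x).
  rewrite /h /Z; case: (leqP x M) => hx.
    have -> : INR M - INR x = INR (M - x).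
      by rewrite -minusE minus_INR //; apply/leP.
    apply: Rle_trans (tK _) _; apply: Rmult_le_compat_r; last lra.
    by have := pow2_ge_0 (INR (M - x) / al - xi); lra.
  have neg : (INR M - INR x) / al < 0.
    apply: (Rmult_lt_reg_r al); first lra.
    have : INR M < INR x by apply: lt_INR; apply/ltP.
    by rewrite /Rdiv Rmult_assoc Rinv_l; lra.
  have Zx : Z x <= - 1 by rewrite /Z; lra.
  rewrite -/(Z x) in Zx *.
  rewrite Rmult_0_r; apply: Rle_trans (_ : _ <= K + K * Rabs (Z x)) _.
    have : Rabs (s * Z x) <= K * Rabs (Z x).
      by rewrite Rabs_mult; apply: Rmult_le_compat_r => //; exact: Rabs_pos.
    by move/Rabs_le_between => ?; apply: Rabs_le; lra.
  rewrite Rabs_left1; last lra.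
  have : 0 <= K * / al by apply: Rmult_le_pos; lra.
  have : K * - Z x <= K * Z x ^ 2 by apply: Rmult_le_compat_l; nra.
  have : K * 1 <= K * Z x ^ 2 by apply: Rmult_le_compat_l; nra.
  lra.
have sy := law_summable ly; case: ly => y0 ys ym _ yv.
have ey1 : ex_series (fun x => y x * 1).
  by exists 1; apply: is_series_ext ys => x; rewrite Rmult_1_r.
have S1 : Series (fun x => y x * 1) = 1.
  by rewrite -[RHS](is_series_unique _ _ ys); apply: Series_ext => x; rewrite Rmult_1_r.
have eyc : ex_series (fun x => y x * (INR x - mu)) by exists 0.
have Sc : Series (fun x => y x * (INR x - mu)) = 0 by exact: is_series_unique.
have eyv : ex_series (fun x => y x * (INR x - mu) ^ 2) by exists v.
have Sv : Series (fun x => y x * (INR x - mu) ^ 2) = v by exact: is_series_unique.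
have eyh : ex_series (fun x => y x * h x).
  apply: (@ex_series_bounded _ (fun x => K / al * (y x * 1))); last exact: ex_series_scal_l.
  move=> x; rewrite Rabs_mult (Rabs_pos_eq (y x)) //.
  have := h_range x; have := y0 x => hy [hl hu].
  have hx : 0 <= h x <= K / al.
    split; last by apply/Rle_div_r; lra.
    by apply: (Rmult_le_reg_l al); lra.
  by rewrite Rabs_pos_eq; [nra | lra].
have Sh : Series (fun x => y x * h x) = conv y (nb rho eta) M by rewrite conv_Series.
have [eZ SZ] := @Series_lin3 y (fun=> 1) (fun x => INR x - mu) (fun=> 1)
  (Delta / al) (- / al) 0 ey1 eyc ey1.
have Zeq x : Delta / al * 1 + - / al * (INR x - mu) + 0 * 1 = Z x.
  by rewrite /Delta /Z; field; lra.
rewrite S1 Sc Rmult_0_r Rmult_0_l !Rplus_0_r Rmult_1_r in SZ.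
have eZ' : ex_series (fun x => y x * Z x).
  by apply: ex_series_ext eZ => x; congr (_ * _); exact: Zeq.
have SZ' : Series (fun x => y x * Z x) = Delta / al.
  by rewrite -SZ; apply: Series_ext => x; rewrite -Zeq; ring.
have [eQ SQ] := @Series_lin3 y (fun=> 1) (fun x => INR x - mu) (fun x => (INR x - mu) ^ 2)
  ((Delta / al) ^ 2 + / al) (- 2 * (Delta / al) * / al) ((/ al) ^ 2) ey1 eyc eyv.
have Qeq x : ((Delta / al) ^ 2 + / al) * 1 + - 2 * (Delta / al) * / al * (INR x - mu)
   + (/ al) ^ 2 * (INR x - mu) ^ 2 = Z x ^ 2 + / al.
  by rewrite -Zeq; ring.
have eQ' : ex_series (fun x => 2 * K * (y x * (Z x ^ 2 + / al))).
  by apply: ex_series_scal_l; apply: ex_series_ext eQ => x; congr (_ * _); exact: Qeq.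
have SQ' : Series (fun x => 2 * K * (y x * (Z x ^ 2 + / al))) =
    2 * K * ((Delta / al) ^ 2 + / al + (/ al) ^ 2 * v).
  rewrite Series_scal_l; congr (_ * _).
  rewrite (Series_ext _ (fun x => y x * (((Delta / al) ^ 2 + / al) * 1 +
    - 2 * (Delta / al) * / al * (INR x - mu) + (/ al) ^ 2 * (INR x - mu) ^ 2))).
    by rewrite SQ S1 Sc Sv; ring.
  by move=> x; congr (_ * _); symmetry; exact: Qeq.
have [eD SD] := @Series_lin3 y h (fun=> 1) Z al (- g) (- s) eyh ey1 eZ'.
rewrite Sh S1 SZ' in SD.
have bound : Rabs (al * conv y (nb rho eta) M + - g * 1 + - s * (Delta / al)) <=
    2 * K * ((Delta / al) ^ 2 + / al + (/ al) ^ 2 * v).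
  rewrite -SD -SQ'; apply: Series_abs_le => // x.
  rewrite Rabs_mult (Rabs_pos_eq (y x)) // -Rmult_assoc (Rmult_comm (2 * K)) Rmult_assoc.
  apply: Rmult_le_compat_l => //; apply: Rle_trans (approx x); apply: Req_le.
  by congr Rabs; ring.
have sl : Rabs (s * (Delta / al)) <= K * (Rabs Delta / al).
  rewrite Rabs_mult /Rdiv Rabs_mult (Rabs_pos_eq (/ al)); last lra.
  apply: Rmult_le_compat_r => //; apply: Rmult_le_pos; [exact: Rabs_pos | lra].
have vv : (/ al) ^ 2 * v <= (sig / al) ^ 2.
  have -> : (sig / al) ^ 2 = (/ al) ^ 2 * sig ^ 2 by field; lra.
  by apply: Rmult_le_compat_l => //; exact: pow2_ge_0.
have sq0 := pow2_ge_0 (sig / al).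
have D0 := Rabs_pos Delta.
case: (Rle_lt_dec (Rabs Delta) al) => hD.
  have Dq : 0 <= Rabs Delta / al <= 1.
    by split; [apply: Rmult_le_pos; lra | apply/Rle_div_l; lra].
  have D2 : (Delta / al) ^ 2 <= Rabs Delta / al.
    have -> : (Delta / al) ^ 2 = (Rabs Delta / al) ^ 2.
      by rewrite -pow2_abs /Rdiv Rabs_mult (Rabs_pos_eq (/ al)) //; lra.
    nra.
  move/Rabs_le_between: bound => bound; move/Rabs_le_between: sl => sl.
  have : K * ((Delta / al) ^ 2 + / al + (/ al) ^ 2 * v) <=
         K * (Rabs Delta / al + / al + (sig / al) ^ 2) by apply: Rmult_le_compat_l; lra.
  have : 0 <= K * (/ al + (sig / al) ^ 2) by apply: Rmult_le_pos; lra.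
  by move=> *; apply: Rabs_le; lra.
have Dq : 1 <= Rabs Delta / al by apply/Rle_div_r; lra.
have conv_range : 0 <= al * conv y (nb rho eta) M <= K.
  have e1 : ex_series (fun x => K * (y x * 1)) by apply: ex_series_scal_l.
  rewrite -Sh -Series_scal_l; split.
    apply: Series_ge0 => [|x]; first exact: ex_series_scal_l.
    have := h_range x; have := y0 x; nra.
  have -> : K = Series (fun x => K * (y x * 1)) by rewrite Series_scal_l S1; ring.
  apply: Series_monotone => // [|x]; first exact: ex_series_scal_l.
  have := h_range x; have := y0 x; nra.
have : K * 1 <= K * (Rabs Delta / al) by apply: Rmult_le_compat_l; lra.
have : 0 <= K * (/ al + (sig / al) ^ 2) by apply: Rmult_le_pos; lra.
by move=> *; apply: Rabs_le; lra.
Qed.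

(** * The effect of a perturbation of the transform *)

(** [s] differs from the convolution of [y] with a negative binomial law by a
factor [Psi] of its transform that is Lipschitz and equals 1 at the origin;
the bounds on [y] are those satisfied by a sum of independent variables with
total variance of order [sig^2]. *)
Record perturbed_nb (c K rho eta sig : R) (s y : nat -> R) (Psi : R -> C) (mu : R)
    : Prop := PerturbedNb {
  pnb_summable : summable s;
  pnb_moment1 : moment1 s;
  pnb_FT : forall t, FT s t = (W rho eta t * Psi t * FT y t)%C;
  pnb_Psi_0 : forall t, 0 <= t <= PI -> Cmod (Psi t - RtoC 1) <= K * t;
  pnb_Psi_derive : forall t, 0 <= t <= PI -> exists d, derC Psi t d /\ Cmod d <= K;
  pnb_decay : forall t, 0 <= t <= PI -> Cmod (FT y t) <= exp (- (c * (sig * t) ^ 2));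
  pnb_derive_decay : forall t, 0 <= t <= PI ->
    Cmod (FT (centered y mu) t) <= sig ^ 2 * t * exp (- (c * (sig * t) ^ 2))
}.

Section Perturbation.

Variables (B c K rho eta sig : R) (s y : nat -> R) (Psi : R -> C) (mu v : R).
Hypotheses (c_gt0 : 0 < c) (K_ge0 : 0 <= K) (rho_range : 0 < rho < 1).
Hypotheses (eta_range : 1 <= eta <= B + 1) (sig_range : 0 < sig <= alpha rho).
Hypotheses (ly : law_with_moments y mu v) (pnb : perturbed_nb c K rho eta sig s y Psi mu).

Let al := alpha rho.

Let eta_gt0 : 0 < eta.
Proof. lra. Qed.

Let snb := nb_summable rho_range eta_gt0.
Let sy := law_summable ly.

Let a x := s x + (-1) * conv y (nb rho eta) x.

Let al_gt0 : 0 < al.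
Proof. by rewrite /al; lra. Qed.

Let summable_sub (p q : nat -> R) : summable p -> summable q ->
  summable (fun x => p x + (-1) * q x).
Proof.
move=> sp sq; apply: (@summable_le _ (fun x => Rabs (p x) + Rabs (q x))).
  move=> x; apply: Rle_trans (Rabs_triang _ _) _; apply: Rplus_le_compat_l.
  by rewrite Rabs_mult (Rabs_left (-1)); lra.
exact: ex_series_plus.
Qed.

Let sa : summable a.
Proof.
by apply: summable_sub; [exact: (pnb_summable pnb) | apply: summable_conv].
Qed.

Let ma : moment1 a.
Proof.
apply: (@summable_le _ (fun x => Rabs (weighted s x + (-1) * weighted (conv y (nb rho eta)) x))).
  by move=> x; apply: Req_le; congr Rabs; rewrite /weighted /a; ring.
apply: summable_sub; first exact: (pnb_moment1 pnb).
by apply: moment1_conv => //; [exact: (law_moment1 ly) | exact: nb_moment1].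
Qed.

Let FT_a t : FT a t = (W rho eta t * (Psi t - RtoC 1) * FT y t)%C.
Proof.
rewrite FT_lin; [|exact: (pnb_summable pnb) | exact: summable_conv].
have -> : RtoC (-1) = (- RtoC 1)%C by rewrite -RtoC_opp; congr RtoC; ring.
by rewrite FT_conv // FT_nb // (pnb_FT pnb); ring.
Qed.

Let w t := Cmod (omega rho t).
Let w_range t : 0 < w t <= 1.
Proof. by split; [exact: Cmod_omega_gt0 | exact: Cmod_omega_le1]. Qed.

Let decay t : 0 <= t <= PI -> w t * (1 + al * t) <= 5.
Proof. exact: Cmod_omega_decay. Qed.

Let Cmod_FT_a t : 0 <= t <= PI ->
  Cmod (FT a t) <= Rpower (w t) eta * (K * t) * exp (- (c * (sig * t) ^ 2)).
Proof.
move=> ht; rewrite FT_a !Cmod_mult Cmod_W //.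
have w0 := Rpower_gt0 (w t) eta; rewrite -/(w t).
apply: Rmult_le_compat; try exact: Cmod_ge_0; last exact: (pnb_decay pnb).
  by apply: Rmult_le_pos; [lra | exact: Cmod_ge_0].
by apply: Rmult_le_compat_l; [lra | exact: (pnb_Psi_0 pnb)].
Qed.

(** The factor [K t] bounding [Psi t - 1] lowers the exponent of the decay by one
and gains [1 / al]. *)
Lemma perturbation_small_exponent M : eta <= 3 / 2 ->
  al * Rabs (a M) <= 25 * K * exp (2 + / c) * (/ sig * Rpower (sig / al) (eta - 1)).
Proof.
move=> eta2.
have bnd t : 0 < t < PI -> Cmod (FT a t) <=
    25 * K / al * (Rpower (1 + al * t) (1 - eta) * exp (- (c * (sig * t) ^ 2))).
  move=> ht; apply: Rle_trans (Cmod_FT_a (ltac:(lra) : 0 <= t <= PI)) _.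
  have u0 : 0 < 1 + al * t by nra.
  rewrite -[X in _ <= X]Rmult_assoc.
  apply: Rmult_le_compat_r; first by apply: Rlt_le; exact: exp_pos.
  have h := @omega_power_le rho t eta rho_range ltac:(lra) ltac:(lra).
  rewrite -/al -/(w t) in h.
  have e : Rpower (1 + al * t) (1 - eta) = Rpower (1 + al * t) (- eta) * (1 + al * t).
    by rewrite -{3}(Rpower_1 (1 + al * t)) // -Rpower_plus; congr Rpower; ring.
  rewrite e.
  have p0 := Rpower_gt0 (1 + al * t) (- eta).
  have t_le : t <= (1 + al * t) / al by apply/Rle_div_r => //; lra.
  apply: Rle_trans (_ : _ <= 25 * Rpower (1 + al * t) (- eta) * (K * ((1 + al * t) / al))) _.
    apply: Rmult_le_compat => //.
    - by apply: Rlt_le; exact: Rpower_gt0.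
    - by apply: Rmult_le_pos; lra.
    by apply: Rmult_le_compat_l.
  by apply: Req_le; field; lra.
have K'0 : 0 <= 25 * K / al by apply: Rmult_le_pos; [lra | apply: Rlt_le; exact: Rinv_0_lt_compat].
have := @coef_le_damped a M c _ rho sig eta c_gt0 K'0 rho_range sig_range ltac:(lra) sa bnd.
rewrite -/al => h.
have := Rmult_le_compat_l _ _ _ (Rlt_le _ _ al_gt0) h.
rewrite (_ : al * (25 * K / al * _ * _) =
  25 * K * exp (2 + / c) * (/ sig * Rpower (sig / al) (eta - 1))) //; field; lra.
Qed.

(** As [|omega t| * t] is of order [1 / al], the integrand is of that order all
along the period. This serves positions far from the bulk, where the error
allowed is of order 1. *)
Lemma perturbation_trivial M : al * Rabs (a M) <= 5 * K.
Proof.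
have pi0 := PI_RGT_0.
have bnd t : 0 < t < PI -> Cmod (FT a t) <= 5 * K / al.
  move=> ht; apply: Rle_trans (Cmod_FT_a (ltac:(lra) : 0 <= t <= PI)) _.
  have e1 : exp (- (c * (sig * t) ^ 2)) <= 1.
    rewrite -[X in _ <= X]exp_0; apply: exp_monotone.
    have := Rmult_le_pos _ _ (Rlt_le _ _ c_gt0) (pow2_ge_0 (sig * t)); lra.
  have e0 := exp_pos (- (c * (sig * t) ^ 2)).
  have p1 : Rpower (w t) eta <= w t.
    rewrite -[X in _ <= X](Rpower_1 (w t)); last by case: (w_range t).
    by apply: Rpower_antitone; [exact: w_range | lra].
  have p0 := Rpower_gt0 (w t) eta.
  have d := @decay t ltac:(lra); have [w0 w1] := w_range t.
  have h1 : Rpower (w t) eta * (K * t) <= w t * (K * t).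
    by apply: Rmult_le_compat_r => //; apply: Rmult_le_pos; lra.
  have h2 : w t * t <= 5 / al.
    apply: (proj1 (Rle_div_r _ _ _ al_gt0)).
    have -> : w t * t * al = w t * (1 + al * t) - w t by ring.
    lra.
  have h3 : K * (w t * t) <= K * (5 / al) by apply: Rmult_le_compat_l.
  have h4 : 0 <= Rpower (w t) eta * (K * t) by apply: Rmult_le_pos; [lra | apply: Rmult_le_pos; lra].
  have h5 : 5 * K / al = K * (5 / al) by field; lra.
  have h6 : Rpower (w t) eta * (K * t) * exp (- (c * (sig * t) ^ 2)) <=
      Rpower (w t) eta * (K * t) * 1 by apply: Rmult_le_compat_l.
  lra.
have := @coef_le_integral a _ _ M sa (@is_RInt_const R_NormedModule 0 PI (5 * K / al)) bnd.
rewrite /scal /= /mult /= Rminus_0_r => h.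
have h' := Rmult_le_reg_l _ _ _ pi0 h.
have := Rmult_le_compat_l _ _ _ (Rlt_le _ _ al_gt0) h'.
by rewrite (_ : al * (5 * K / al) = 5 * K) //; field; lra.
Qed.

(** The plain integral has the right order for exponents above 2 only, and not
uniformly near 2. Differentiating the transform multiplies the coefficient by
[M - mu], of order [al], and turns the factor [K t] into a constant. *)
Lemma perturbation_large_exponent M : 3 / 2 <= eta -> al / 2 <= INR M - mu ->
  al * Rabs (a M) <= 50 * K * (5 * (B + 1) + 1 + / c) / al.
Proof.
move=> eta2 farM.
pose b := centered a mu.
have sb : summable b by apply: summable_shifted_moment.
have B0 : 0 <= B + 1 by lra.
have cV := Rinv_0_lt_compat _ c_gt0.
have K'0 : 0 <= K * (5 * (B + 1) + 1 + / c) by apply: Rmult_le_pos; lra.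
have bnd t : 0 < t < PI -> Cmod (FT b t) <=
    K * (5 * (B + 1) + 1 + / c) * Rpower (Cmod (omega rho t)) (3 / 2).
  move=> ht.
  have ht' : 0 <= t <= PI by lra.
  have [dPsi [derPsi le_dPsi]] := pnb_Psi_derive pnb ht'.
  have d1 := W_derive rho_range eta t.
  have d2 := derC_minus derPsi (derC_const (RtoC 1) t).
  have d3 := FT_centered_derive mu t sy (law_moment1 ly).
  have d := derC_mult (derC_mult d1 d2) d3.
  have d' := FT_centered_derive mu t sa ma.
  have FT_a' u : (cis (- mu * u) * FT a u =
      W rho eta u * (Psi u - RtoC 1) * (cis (- mu * u) * FT y u))%C.
    by rewrite FT_a; ring.
  have {}d' := derC_ext FT_a' d'.
  have eq_d := derC_unique d' d.
  have -> : Cmod (FT b t) = Cmod (Ci * (cis (- mu * t) * FT b t))%C.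
    by rewrite !Cmod_mult Cmod_Ci Cmod_cis; ring.
  rewrite eq_d omega_increment //.
  have [w0 w1] := w_range t; have dec := @decay t ltac:(lra).
  have pw0 := Rpower_gt0 (w t) eta.
  set E := exp (- (c * (sig * t) ^ 2)).
  have E0 : 0 < E := exp_pos _.
  have E1 : E <= 1.
    rewrite -[X in _ <= X]exp_0; apply: exp_monotone.
    have := Rmult_le_pos _ _ (Rlt_le _ _ c_gt0) (pow2_ge_0 (sig * t)); lra.
  have EE : (sig * t) ^ 2 * E <= / c.
    have h := exp_ineq1_le (c * (sig * t) ^ 2).
    have e1 : exp (c * (sig * t) ^ 2) * E = 1 by rewrite -exp_plus Rplus_opp_r exp_0.
    apply: (Rmult_le_reg_l c) => //; rewrite Rinv_r; last lra.
    by rewrite -e1 -Rmult_assoc; apply: Rmult_le_compat_r; lra.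
  have Psi1 := pnb_Psi_0 pnb ht'.
  have FTy : Cmod (FT y t) <= E := pnb_decay pnb ht'.
  have FTc := pnb_derive_decay pnb ht'; rewrite -/E in FTc.
  have t1 : Cmod (Ci * RtoC eta * (RtoC (alpha rho) * cis t * omega rho t) * W rho eta t *
       (Psi t - RtoC 1) * (cis (- mu * t) * FT y t)) <=
       Rpower (w t) eta * (K * (5 * (B + 1))).
    have modulus (o : C) : Cmod (Ci * RtoC eta * (RtoC al * cis t * o) * W rho eta t *
       (Psi t - RtoC 1) * (cis (- mu * t) * FT y t)) =
       1 * eta * (al * 1 * Cmod o) * Rpower (w t) eta * Cmod (Psi t - RtoC 1) *
       (1 * Cmod (FT y t)).
      rewrite !Cmod_mult Cmod_Ci !Cmod_R !Cmod_cis Cmod_W //.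
      by rewrite (Rabs_pos_eq eta) ?(Rabs_pos_eq al); try lra.
    rewrite -/al modulus -/(w t).
    have h1 : al * w t * t <= 5 by nra.
    have h2 : Cmod (Psi t - RtoC 1) * Cmod (FT y t) <= K * t * 1.
      by apply: Rmult_le_compat; try exact: Cmod_ge_0; lra.
    have -> : 1 * eta * (al * 1 * w t) * Rpower (w t) eta * Cmod (Psi t - RtoC 1) *
       (1 * Cmod (FT y t)) = Rpower (w t) eta * (eta * (al * w t) *
       (Cmod (Psi t - RtoC 1) * Cmod (FT y t))) by ring.
    apply: Rmult_le_compat_l; first lra.
    apply: Rle_trans (_ : _ <= eta * (al * w t) * (K * t * 1)) _.
      by apply: Rmult_le_compat_l => //; do ![apply: Rmult_le_pos; try lra].
    have -> : eta * (al * w t) * (K * t * 1) = K * (al * w t * t * eta) by ring.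
    apply: Rmult_le_compat_l => //; apply: Rmult_le_compat; try lra.
    by do ![apply: Rmult_le_pos; try lra].
  have t2 : Cmod (W rho eta t * (dPsi - RtoC 0) * (cis (- mu * t) * FT y t)) <=
       Rpower (w t) eta * K.
    rewrite !Cmod_mult !Cmod_cis Cmod_W // -/(w t) Rmult_1_l.
    have -> : (dPsi - RtoC 0 = dPsi)%C by ring.
    rewrite Rmult_assoc; apply: Rmult_le_compat_l; first lra.
    rewrite -[X in _ <= X]Rmult_1_r.
    by apply: Rmult_le_compat; try exact: Cmod_ge_0; lra.
  have t3 : Cmod (W rho eta t * (Psi t - RtoC 1) *
       (Ci * (cis (- mu * t) * FT (centered y mu) t))) <= Rpower (w t) eta * (K * / c).
    rewrite !Cmod_mult Cmod_Ci !Cmod_cis Cmod_W // -/(w t) !Rmult_1_l.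
    rewrite Rmult_assoc; apply: Rmult_le_compat_l; first lra.
    apply: Rle_trans (_ : _ <= K * t * (sig ^ 2 * t * E)) _.
      by apply: Rmult_le_compat; try exact: Cmod_ge_0.
    have -> : K * t * (sig ^ 2 * t * E) = K * ((sig * t) ^ 2 * E) by ring.
    exact: Rmult_le_compat_l.
  have pw : Rpower (w t) eta <= Rpower (w t) (3 / 2) by apply: Rpower_antitone.
  apply: Rle_trans (_ : _ <= Rpower (w t) eta * (K * (5 * (B + 1) + 1 + / c))) _; last first.
    by rewrite Rmult_comm; apply: Rmult_le_compat_l.
  rewrite Cmult_plus_distr_r.
  apply: Rle_trans (Cmod_triangle _ _) _.
  have := Cmod_triangle (Ci * RtoC eta * (RtoC (alpha rho) * cis t * omega rho t) * W rho eta t *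
       (Psi t - RtoC 1) * (cis (- mu * t) * FT y t))
     (W rho eta t * (dPsi - RtoC 0) * (cis (- mu * t) * FT y t)).
  lra.
have := @coef_le_three_halves b M _ rho K'0 rho_range sb bnd.
rewrite /b /centered Rabs_mult (Rabs_pos_eq (_ - mu)) -/al; last lra.
move=> h.
have a0 := Rabs_pos (a M).
have h1 : Rabs (a M) * (al / 2) <= Rabs (a M) * (INR M - mu) by apply: Rmult_le_compat_l.
rewrite (_ : 50 * K * (5 * (B + 1) + 1 + / c) / al =
  2 * (25 * (K * (5 * (B + 1) + 1 + / c)) / al)); last by field; lra.
lra.
Qed.

End Perturbation.

(** * The uniform local limit *)

Definition error_rate (al sig eta : R) : R :=
  (sig / al) ^ 2 + / al + / sig * Rpower (sig / al) (eta - 1).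

Lemma rate_terms (al sig eta : R) : 0 < al -> 0 < sig ->
  [/\ 0 <= (sig / al) ^ 2, 0 < / al & 0 < / sig * Rpower (sig / al) (eta - 1)].
Proof.
move=> al0 sig0; split; first exact: pow2_ge_0.
  exact: Rinv_0_lt_compat.
by apply: Rmult_lt_0_compat; [exact: Rinv_0_lt_compat | exact: Rpower_gt0].
Qed.

(** The main term plus the perturbation. Small and large exponents are treated
by different bounds; the one for large exponents needs [M - mu] to be of order
[alpha], and when it is not, [M] is so far from the centre [mu + xi alpha]
that the last term of the right-hand side is of order 1. *)
Theorem uniform_local_limit (B c K : R) : 1 <= B -> 0 < c -> 0 <= K ->
  exists C, 0 < C /\
  forall rho eta xi sig s y Psi mu v M, 0 < rho < 1 -> 1 <= alpha rho ->
  1 <= eta <= B + 1 -> 1 <= xi <= B -> 0 < sig <= alpha rho ->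
  law_with_moments y mu v -> v <= sig ^ 2 ->
  perturbed_nb c K rho eta sig s y Psi mu ->
  Rabs (alpha rho * s M - gamma_density eta xi) <=
    C * (error_rate (alpha rho) sig eta
         + Rabs (INR M - mu - xi * alpha rho) / alpha rho).
Proof.
move=> B1 c0 K0; have [C1 [C10 main]] := main_term B1.
have cV := Rinv_0_lt_compat _ c0.
set C2 := 25 * K * exp (2 + / c); set C3 := 50 * K * (5 * (B + 1) + 1 + / c).
have C20 : 0 <= C2 by apply: Rmult_le_pos; [lra | apply: Rlt_le; exact: exp_pos].
have C30 : 0 <= C3 by apply: Rmult_le_pos; lra.
exists (C1 + C2 + C3 + 10 * K); split; first lra.
move=> rho eta xi sig s y Psi mu v M hrho al1 heta hxi hsig ly le_v pnb.
have hM := main rho eta xi sig y mu v M hrho al1 heta hxi ly le_v.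
set al := alpha rho in al1 hsig hM *; set D := Rabs (_ - xi * al) in hM *.
have al0 : 0 < al by lra.
have [r1 r2 r3] := rate_terms eta al0 (proj1 hsig).
have D0 : 0 <= D / al by apply: Rmult_le_pos; [exact: Rabs_pos | lra].
set a := s M + (-1) * conv y (nb rho eta) M.
have err : al * Rabs a <= C2 * (/ sig * Rpower (sig / al) (eta - 1)) + C3 * / al
    + 10 * K * (D / al).
  have e2 : 0 <= C2 * (/ sig * Rpower (sig / al) (eta - 1)) by apply: Rmult_le_pos; lra.
  have e3 : 0 <= C3 * / al by apply: Rmult_le_pos; lra.
  have e4 : 0 <= 10 * K * (D / al) by apply: Rmult_le_pos; lra.
  case: (Rle_lt_dec eta (3 / 2)) => eta2.
    have := perturbation_small_exponent c0 K0 hrho heta hsig ly pnb M eta2.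
    rewrite -/al -/a -/C2; lra.
  case: (Rle_lt_dec D (al / 2)) => hD.
    have farM : alpha rho / 2 <= INR M - mu.
      move: hD; rewrite /D => /Rabs_le_between hD; rewrite -/al.
      have : 1 * al <= xi * al by apply: Rmult_le_compat_r; lra.
      lra.
    have := perturbation_large_exponent c0 K0 hrho heta hsig ly pnb (Rlt_le _ _ eta2) farM.
    rewrite -/al -/a -/C3 /Rdiv; lra.
  have := perturbation_trivial c0 K0 hrho heta hsig ly pnb M; rewrite -/al -/a.
  have D2 : 1 <= 2 * (D / al).
    have -> : 2 * (D / al) = D / (al / 2) by field; lra.
    by apply: (proj1 (Rle_div_r _ _ _ _)); lra.
  have : 5 * K * 1 <= 5 * K * (2 * (D / al)) by apply: Rmult_le_compat_l; lra.
  lra.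
have -> : al * s M - gamma_density eta xi =
  (al * conv y (nb rho eta) M - gamma_density eta xi) + al * a by rewrite /a; ring.
apply: Rle_trans (Rabs_triang _ _) _; rewrite (Rabs_mult al) (Rabs_pos_eq al); last lra.
rewrite /error_rate; set t1 := (sig / al) ^ 2 in r1 hM *.
set t3 := / sig * _ in r3 err *; set t2 := / al in r2 hM err *; set t4 := D / al in D0 hM err *.
have : 0 <= C1 * t3 by apply: Rmult_le_pos; lra.
have : 0 <= C2 * (t1 + t2 + t4) by apply: Rmult_le_pos; lra.
have : 0 <= C3 * (t1 + t3 + t4) by apply: Rmult_le_pos; lra.
have : 0 <= 10 * K * (t1 + t2 + t3) by apply: Rmult_le_pos; lra.
lra.
Qed.

(** The counterpart for signed sequences, which have no main term; again the
bound used depends on whether the exponent exceeds 3/2. *)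
Lemma coef_le_rate (c : R) : 0 < c -> exists C, 0 < C /\
  forall K rho sig eta a M, 0 <= K -> 0 < rho < 1 -> 0 < sig <= alpha rho ->
  1 <= eta -> summable a ->
  (forall t, 0 < t < PI -> Cmod (FT a t) <=
     K * (Rpower (Cmod (omega rho t)) eta * exp (- (c * (sig * t) ^ 2)))) ->
  Rabs (a M) <= C * K * error_rate (alpha rho) sig eta.
Proof.
move=> c0; have e0 := exp_pos (2 + / c).
exists (25 * exp (2 + / c) + 25); split; first lra.
move=> K rho sig eta a M K0 hrho hsig eta1 sa bnd.
have al0 : 0 < alpha rho by lra.
have [r1 r2 r3] := rate_terms eta al0 (proj1 hsig).
rewrite /error_rate; set t1 := (sig / _) ^ 2 in r1 *; set t2 := / alpha rho in r2 *.
set t3 := / sig * _ in r3 *.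
have k1 : 0 <= K * exp (2 + / c) by apply: Rmult_le_pos; lra.
have : 0 <= (25 * (K * exp (2 + / c)) + 25 * K) * t1 by apply: Rmult_le_pos; lra.
have : 0 <= 25 * (K * exp (2 + / c)) * t2 by apply: Rmult_le_pos; lra.
have : 0 <= 25 * K * t2 by apply: Rmult_le_pos; lra.
have : 0 <= 25 * (K * exp (2 + / c)) * t3 by apply: Rmult_le_pos; lra.
have : 0 <= 25 * K * t3 by apply: Rmult_le_pos; lra.
case: (Rle_lt_dec eta (3 / 2)) => eta2.
  have bnd' t : 0 < t < PI -> Cmod (FT a t) <= 25 * K *
      (Rpower (1 + alpha rho * t) (1 - eta) * exp (- (c * (sig * t) ^ 2))).
    move=> ht; apply: Rle_trans (bnd t ht) _.
    have -> : 25 * K * (Rpower (1 + alpha rho * t) (1 - eta) * exp (- (c * (sig * t) ^ 2))) =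
      K * (25 * Rpower (1 + alpha rho * t) (1 - eta) * exp (- (c * (sig * t) ^ 2))) by ring.
    apply: Rmult_le_compat_l => //; apply: Rmult_le_compat_r; first by apply: Rlt_le; exact: exp_pos.
    apply: Rle_trans (@omega_power_le rho t eta hrho ltac:(lra) ltac:(lra)) _.
    by apply: Rmult_le_compat_l; [lra | apply: Rle_Rpower; nra].
  have := @coef_le_damped a M c (25 * K) rho sig eta c0 ltac:(lra) hrho hsig ltac:(lra) sa bnd'.
  rewrite -/t3; lra.
have bnd' t : 0 < t < PI -> Cmod (FT a t) <= K * Rpower (Cmod (omega rho t)) (3 / 2).
  move=> ht; apply: Rle_trans (bnd t ht) _; apply: Rmult_le_compat_l => //.
  have w0 := Cmod_omega_gt0 hrho t; have w1 := Cmod_omega_le1 hrho t.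
  have p0 := Rpower_gt0 (Cmod (omega rho t)) eta.
  have : Rpower (Cmod (omega rho t)) eta <= Rpower (Cmod (omega rho t)) (3 / 2).
    by apply: Rpower_antitone; lra.
  have : exp (- (c * (sig * t) ^ 2)) <= 1.
    rewrite -[X in _ <= X]exp_0; apply: exp_monotone.
    have := Rmult_le_pos _ _ (Rlt_le _ _ c0) (pow2_ge_0 (sig * t)); lra.
  have := exp_pos (- (c * (sig * t) ^ 2)); nra.
have := @coef_le_three_halves a M K rho K0 hrho sa bnd'.
rewrite /Rdiv -/t2; lra.
Qed.

(** * Characteristic functions of laws on the integers *)

Definition pair_weight (p : nat -> R) (i : nat) : R :=
  p (2 * i)%N * p (2 * i).+1 / (p (2 * i)%N + p (2 * i).+1).

Lemma is_series_pairs (a : nat -> R) (l : R) : is_series a l ->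
  is_series (fun i => a (2 * i)%N + a (2 * i).+1) l.
Proof.
move=> sa.
have sub : is_lim_seq (fun n => sum_n a (2 * n).+1) l.
  apply: (is_lim_seq_subseq (sum_n a) l (fun n => (2 * n).+1)) => //.
  by apply: eventually_subseq => n; apply/ltP; rewrite mulnS.
apply: is_lim_seq_ext sub => n; rewrite !sum_n_Reals.
elim: n => [|n IH]; first by [].
rewrite [RHS]/= -IH; have -> : (2 * n.+1)%N = (2 * n).+2 by rewrite mulnS.
by rewrite /=; ring.
Qed.

Section PositiveLaw.

Variable p : nat -> R.
Hypothesis p_gt0 : forall x, 0 < p x.
Hypothesis p_sum : is_series p 1.

Let p_summable : summable p.
Proof.
by apply: ex_series_nonneg_summable => [x|]; [apply: Rlt_le | exists 1].
Qed.

Let pairs_sum : is_series (fun i => p (2 * i)%N + p (2 * i).+1) 1.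
Proof. exact: is_series_pairs. Qed.

Let pair_range i : 0 <= pair_weight p i <= p (2 * i)%N + p (2 * i).+1.
Proof.
have h0 := p_gt0 (2 * i)%N; have h1 := p_gt0 (2 * i).+1.
split; first by apply: Rlt_le; apply: Rdiv_lt_0_compat; nra.
by apply: (proj2 (Rle_div_l _ _ _ _)); nra.
Qed.

Lemma ex_series_pair_weight : ex_series (pair_weight p).
Proof.
apply: (@ex_series_bounded _ (fun i => p (2 * i)%N + p (2 * i).+1)); last by exists 1.
by move=> i; have := pair_range i => ?; rewrite Rabs_pos_eq; lra.
Qed.

Lemma pair_weight_sum_ge0 : 0 <= Series (pair_weight p).
Proof. by apply: Series_ge0 => [|i]; [exact: ex_series_pair_weight | case: (pair_range i)]. Qed.

(** Two neighbouring atoms [p] and [q] contribute a chord of length at most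
[p + q - (1 - cos t) p q / (p + q)]. *)
Lemma Cmod_two_atoms (x : nat) (u v t : R) : 0 < u -> 0 < v ->
  Cmod (RtoC u * cis (INR x * t) + RtoC v * cis (INR x.+1 * t)) <=
    u + v - (1 - cos t) * (u * v / (u + v)).
Proof.
move=> u0 v0; rewrite S_INR Rmult_plus_distr_r Rmult_1_l cis_add.
have -> : (RtoC u * cis (INR x * t) + RtoC v * (cis (INR x * t) * cis t) =
  cis (INR x * t) * (RtoC u + RtoC v * cis t))%C by ring.
rewrite Cmod_mult Cmod_cis Rmult_1_l.
have ct := COS_bound t; set h := u * v / (u + v).
have h0 : 0 < h by apply: Rdiv_lt_0_compat; nra.
have hl : 4 * h <= u + v.
  have : u + v - 4 * h = (u - v) ^ 2 / (u + v) by rewrite /h; field; lra.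
  have : 0 <= (u - v) ^ 2 / (u + v) by apply: Rmult_le_pos; [exact: pow2_ge_0 | apply: Rlt_le; apply: Rinv_0_lt_compat; lra].
  lra.
have rhs0 : 0 <= u + v - (1 - cos t) * h by nra.
apply: Rsqr_incr_0_var => //; rewrite !Rsqr_pow2 Cmod2_alt /Re /Im /=.
have sc := sin2_cos2 t; rewrite /Rsqr in sc.
have -> : (u + (v * cos t - 0 * sin t)) * ((u + (v * cos t - 0 * sin t)) * 1) +
  (0 + (v * sin t + 0 * cos t)) * ((0 + (v * sin t + 0 * cos t)) * 1) =
  u * u + 2 * u * v * cos t + v * v * (sin t * sin t + cos t * cos t) by ring.
rewrite sc.
have huv : h * (u + v) = u * v by rewrite /h; field; lra.
have : 0 <= ((1 - cos t) * h) ^ 2 by exact: pow2_ge_0.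
nra.
Qed.

(** Grouping the positions two by two, the loss of modulus in each pair is at
least its [pair_weight] times [1 - cos t]. *)
Lemma FT_decay t : 0 <= t <= PI ->
  Cmod (FT p t) <= exp (- (Series (pair_weight p) * t ^ 2 / 18)).
Proof.
move=> ht; pose z i := (RtoC (p (2 * i)%N) * cis (INR (2 * i) * t)
   + RtoC (p (2 * i).+1) * cis (INR (2 * i).+1 * t))%C.
have -> : FT p t = (Series (fun i => fst (z i)), Series (fun i => snd (z i))).
  rewrite /FT; congr pair; symmetry.
    have sc := is_series_pairs (Series_correct _ (summable_ex (summable_cos t p_summable))).
    by rewrite -(is_series_unique _ _ sc); apply: Series_ext => i; rewrite /z /=; ring.
  have ss := is_series_pairs (Series_correct _ (summable_ex (summable_sin t p_summable))).
  by rewrite -(is_series_unique _ _ ss); apply: Series_ext => i; rewrite /z /=; ring.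
have exw := ex_series_pair_weight.
have exs : ex_series (fun i => (1 - cos t) * pair_weight p i) by exact: ex_series_scal_l.
have exp_ : ex_series (fun i => p (2 * i)%N + p (2 * i).+1) by exists 1.
apply: Rle_trans (_ : _ <= Series (fun i => (p (2 * i)%N + p (2 * i).+1)
   - (1 - cos t) * pair_weight p i)) _.
  apply: Cmod_Series_le; last exact: ex_series_minus.
  by move=> i; apply: Cmod_two_atoms.
rewrite Series_minus // (is_series_unique _ _ pairs_sum) Series_scal_l.
apply: Rle_trans (exp_ineq1_le _).
have := Rmult_le_compat_r _ _ _ pair_weight_sum_ge0 (one_minus_cos_ge ht).
lra.
Qed.

Lemma Rabs_sin_le (u : R) : Rabs (sin u) <= Rabs u.
Proof.
wlog u0 : u / 0 <= u => [main|].
  case: (Rle_lt_dec 0 u) => hu; first exact: main.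
  by rewrite -Rabs_Ropp -sin_neg -(Rabs_Ropp u); apply: main; lra.
case: u0 => [u0|<-]; last by rewrite sin_0; apply: Rle_refl.
rewrite (Rabs_pos_eq u); last lra.
have s1 := sin_lt_x _ u0.
case: (Rle_lt_dec u PI) => hu.
  by rewrite Rabs_pos_eq; [lra | apply: sin_ge_0; lra].
by have := Rabs_sin_le1 u; have := PI2_1; lra.
Qed.

Lemma Cmod_cis_minus_1 (u : R) : Cmod (cis u - RtoC 1) <= Rabs u.
Proof.
apply: Rsqr_incr_0_var; last exact: Rabs_pos.
rewrite !Rsqr_pow2 Cmod2_alt pow2_abs /Re /Im.
rewrite [fst _]/= [snd _]/=.
have -> : cos u = 1 - 2 * sin (u / 2) * sin (u / 2).
  by rewrite -cos_2a_sin; congr cos; field.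
have -> : sin u = 2 * sin (u / 2) * cos (u / 2).
  by rewrite -sin_2a; congr sin; field.
have sc := sin2_cos2 (u / 2); rewrite /Rsqr in sc.
have hs := Rabs_sin_le (u / 2).
have : sin (u / 2) * sin (u / 2) <= (u / 2) * (u / 2).
  have := Rsqr_le_abs_1 _ _ hs; by rewrite /Rsqr.
set S := sin (u / 2) in sc *; set C' := cos (u / 2) in sc *.
have -> : (1 - 2 * S * S + - (1)) ^ 2 + (2 * S * C' + - 0) ^ 2 =
  4 * (S * S) * (S * S + C' * C') by ring.
rewrite sc; nra.
Qed.

Variables (m v : R).
Hypothesis p_law : law_with_moments p m v.

(** The centred weights sum to zero, so the character may be replaced by its
increment from the mean, which is at most [|x - m| t]. *)
Lemma FT_centered_bound t : 0 <= t ->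
  Cmod (FT (centered p m) t) <= v * t.
Proof.
move=> t0; case: p_law => _ _ pm pm1 pv.
have sc := summable_shifted_moment m p_summable pm1.
pose z x := (RtoC (centered p m x) * cis (m * t) * (cis ((INR x - m) * t) - RtoC 1))%C.
have bnd : Cmod (Series (fun x => fst (z x)), Series (fun x => snd (z x))) <=
    Series (fun x => t * (p x * (INR x - m) ^ 2)).
  apply: Cmod_Series_le => [x|]; last by apply: ex_series_scal_l; exists v.
  rewrite /z !Cmod_mult Cmod_R Cmod_cis Rmult_1_r /centered Rabs_mult.
  rewrite (Rabs_pos_eq (p x)); last by apply: Rlt_le.
  have h := Cmod_cis_minus_1 ((INR x - m) * t).
  rewrite Rabs_mult (Rabs_pos_eq t) // in h.
  have -> : t * (p x * (INR x - m) ^ 2) = p x * Rabs (INR x - m) * (Rabs (INR x - m) * t).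
    by rewrite -pow2_abs; ring.
  apply: Rmult_le_compat_l => //; apply: Rmult_le_pos; [by apply: Rlt_le | exact: Rabs_pos].
rewrite Series_scal_l (is_series_unique _ _ pv) Rmult_comm in bnd.
suff -> : FT (centered p m) t =
    (Series (fun x => fst (z x)), Series (fun x => snd (z x))) by [].
have zeq x : z x = (RtoC (centered p m x) * cis (INR x * t)
    - RtoC (centered p m x) * cis (m * t))%C.
  rewrite /z (_ : INR x * t = m * t + (INR x - m) * t); last ring.
  by rewrite cis_add; ring.
have S0 := is_series_unique _ _ pm.
have exc := summable_ex sc.
rewrite /FT; congr pair; symmetry.
  rewrite (Series_ext _ (fun x => centered p m x * cos (INR x * t)
    - cos (m * t) * centered p m x)); last by move=> x; rewrite zeq /=; ring.
  rewrite Series_minus ?Series_scal_l ?S0; [ring | | exact: ex_series_scal_l].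
  by apply: summable_ex; apply: summable_cos.
rewrite (Series_ext _ (fun x => centered p m x * sin (INR x * t)
  - sin (m * t) * centered p m x)); last by move=> x; rewrite zeq /=; ring.
rewrite Series_minus ?Series_scal_l ?S0; [ring | | exact: ex_series_scal_l].
by apply: summable_ex; apply: summable_sin.
Qed.

End PositiveLaw.

(** * Moments *)

Lemma power0_0 (s : R) : power0 0 s = 0.
Proof. by rewrite /power0; case: (Req_EM_T 0 0) => h. Qed.

Lemma power0_neq0 (u s : R) : u <> 0 -> power0 u s = Rpower u s.
Proof. by rewrite /power0; case: (Req_EM_T u 0) => h. Qed.

Lemma power0_ge0 (u s : R) : 0 <= power0 u s.
Proof.
case: (Req_dec u 0) => [->|/power0_neq0 ->]; first by rewrite power0_0; exact: Rle_refl.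
by apply: Rlt_le; exact: exp_pos.
Qed.

Lemma power0_2 (u : R) : power0 (Rabs u) 2 = u ^ 2.
Proof.
case: (Req_dec u 0) => [->|u0]; first by rewrite Rabs_R0 power0_0 /=; ring.
have a0 := Rabs_pos_lt _ u0.
rewrite power0_neq0; last lra.
by rewrite -pow2_abs (_ : 2 = INR 2) ?Rpower_pow.
Qed.

Lemma power0_half_le (u s : R) : / 2 <= u -> 0 <= s <= 3 -> / 8 <= power0 u s.
Proof.
move=> u2 hs; rewrite power0_neq0; last lra.
apply: Rle_trans (_ : _ <= Rpower (/ 2) s) _; last by apply: Rle_Rpower_l; lra.
apply: Rle_trans (_ : _ <= Rpower (/ 2) 3) _; last by apply: Rpower_antitone; lra.
have -> : Rpower (/ 2) 3 = (/ 2) ^ 3.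
  by rewrite -Rpower_pow; [congr Rpower; rewrite /=; ring | lra].
by rewrite /=; lra.
Qed.

(** Of two neighbouring integers one is at distance at least 1/2 from the
mean. *)
Lemma pair_weight_le_moment (p : nat -> R) (m s : R) :
  (forall x, 0 < p x) -> is_series p 1 -> 2 <= s <= 3 ->
  ex_series (fun x => p x * power0 (Rabs (INR x - m)) s) ->
  Series (pair_weight p) <= 8 * Series (fun x => p x * power0 (Rabs (INR x - m)) s).
Proof.
move=> p0 ps hs exm; rewrite -Series_scal_l.
have sm := is_series_pairs (Series_correct _ (ex_series_scal_l 8 _ exm)).
rewrite -(is_series_unique _ _ sm).
apply: Series_monotone; [exact: ex_series_pair_weight | by eexists; exact: sm | move=> i].
have h0 := p0 (2 * i)%N; have h1 := p0 (2 * i).+1.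
set u := p _ in h0 *; set w := p _ in h1 *.
have le_min : u * w / (u + w) <= u /\ u * w / (u + w) <= w.
  by split; apply: (proj2 (Rle_div_l _ _ _ _)); nra.
rewrite /pair_weight -/u -/w.
have q0 := power0_ge0 (Rabs (INR (2 * i) - m)) s.
have q1 := power0_ge0 (Rabs (INR (2 * i).+1 - m)) s.
have m0 : 0 <= u * power0 (Rabs (INR (2 * i) - m)) s by apply: Rmult_le_pos; lra.
have m1 : 0 <= w * power0 (Rabs (INR (2 * i).+1 - m)) s by apply: Rmult_le_pos; lra.
rewrite -[X in _ <= X]/(8 * (u * power0 (Rabs (INR (2 * i) - m)) s)
  + 8 * (w * power0 (Rabs (INR (2 * i).+1 - m)) s)).
case: (Rle_lt_dec (INR (2 * i) - m) (- / 2)) => side.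
  have far : / 2 <= Rabs (INR (2 * i) - m) by rewrite Rabs_left1; lra.
  have := Rmult_le_compat_l _ _ _ (Rlt_le _ _ h0) (@power0_half_le _ s far ltac:(lra)).
  lra.
have far : / 2 <= Rabs (INR (2 * i).+1 - m) by rewrite S_INR Rabs_pos_eq; lra.
have := Rmult_le_compat_l _ _ _ (Rlt_le _ _ h1) (@power0_half_le _ s far ltac:(lra)).
lra.
Qed.

(** Below the truncation level [t] the square is at most [t^2]; above it the
higher power dominates. *)
Lemma square_le_moment (u t r : R) : 0 < t -> 0 < r ->
  u ^ 2 <= t ^ 2 + power0 (Rabs u) (2 + r) / Rpower t r.
Proof.
move=> t0 r0; have tr := Rpower_gt0 t r.
have q : 0 <= power0 (Rabs u) (2 + r) / Rpower t r.
  by apply: Rmult_le_pos; [exact: power0_ge0 | apply: Rlt_le; exact: Rinv_0_lt_compat].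
rewrite -pow2_abs; have ua := Rabs_pos u.
case: (Rle_lt_dec (Rabs u) t) => hu; first by nra.
have : Rabs u ^ 2 <= power0 (Rabs u) (2 + r) / Rpower t r.
  rewrite power0_neq0; last lra.
  rewrite Rpower_plus (_ : Rpower (Rabs u) 2 = Rabs u ^ 2); last first.
    by rewrite (_ : 2 = INR 2) ?Rpower_pow //; lra.
  apply: (proj1 (Rle_div_r _ _ _ tr)); apply: Rmult_le_compat_l; first exact: pow2_ge_0.
  by apply: Rle_Rpower_l; lra.
have := pow2_ge_0 t; lra.
Qed.

Lemma moment2_le (p : nat -> R) (m t r : R) : (forall x, 0 <= p x) -> is_series p 1 ->
  0 < t -> 0 < r ->
  ex_series (fun x => p x * power0 (Rabs (INR x - m)) 2) ->
  ex_series (fun x => p x * power0 (Rabs (INR x - m)) (2 + r)) ->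
  Series (fun x => p x * power0 (Rabs (INR x - m)) 2) <=
  t ^ 2 + Series (fun x => p x * power0 (Rabs (INR x - m)) (2 + r)) / Rpower t r.
Proof.
move=> p0 ps t0 r0 ex2 exr.
have ep : ex_series (fun x => p x * 1).
  by exists 1; apply: is_series_ext ps => x; rewrite Rmult_1_r.
have [eS SS] := @Series_lin3 p (fun=> 1) (fun x => power0 (Rabs (INR x - m)) (2 + r))
  (fun=> 1) (t ^ 2) (/ Rpower t r) 0 ep exr ep.
have p1 : Series (fun x => p x * 1) = 1.
  by rewrite -[RHS](is_series_unique _ _ ps); apply: Series_ext => x; rewrite Rmult_1_r.
rewrite p1 in SS.
apply: Rle_trans (_ : _ <= Series (fun x => p x * (t ^ 2 * 1 + / Rpower t r *
    power0 (Rabs (INR x - m)) (2 + r) + 0 * 1))) _; last first.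
  rewrite SS /Rdiv; lra.
apply: Series_monotone => // x; apply: Rmult_le_compat_l => //.
rewrite power0_2; have := square_le_moment (INR x - m) t0 r0; rewrite /Rdiv; lra.
Qed.

(** * Sums of independent variables *)

HB.instance Definition _ := Monoid.isComLaw.Build R 0 Rplus
  (fun x y z => esym (Rplus_assoc x y z)) Rplus_comm Rplus_0_l.
HB.instance Definition _ := Monoid.isComLaw.Build R 1 Rmult
  (fun x y z => esym (Rmult_assoc x y z)) Rmult_comm Rmult_1_l.
HB.instance Definition _ := Monoid.isMulLaw.Build R 0 Rmult Rmult_0_l Rmult_0_r.
HB.instance Definition _ := Monoid.isAddLaw.Build R Rmult Rplus
  Rmult_plus_distr_r Rmult_plus_distr_l.
HB.instance Definition _ := Monoid.isComLaw.Build C (RtoC 0) Cplus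
  Cplus_assoc Cplus_comm Cplus_0_l.
HB.instance Definition _ := Monoid.isComLaw.Build C (RtoC 1) Cmult
  Cmult_assoc Cmult_comm Cmult_1_l.
HB.instance Definition _ := Monoid.isMulLaw.Build C (RtoC 0) Cmult Cmult_0_l Cmult_0_r.
HB.instance Definition _ := Monoid.isAddLaw.Build C Cmult Cplus
  Cmult_plus_distr_r Cmult_plus_distr_l.

Definition point_mass (k x : nat) : R := if x == k then 1 else 0.

Lemma is_series_point_mass (k : nat) (f : nat -> R) :
  is_series (fun x => point_mass k x * f x) (f k).
Proof.
have := @is_series_finite (fun x => point_mass k x * f x) k.
have -> : sum_f_R0 (fun x => point_mass k x * f x) k = f k.
  rewrite (PartSum.sum_eq _ (fun x => f x * (if x == k then 1 else 0))) => [|i _].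
    by rewrite sum_f_R0_delta leqnn Rmult_1_r.
  exact: Rmult_comm.
apply=> x lt_kx; rewrite /point_mass; case: eqP => [eq_xk|_]; last exact: Rmult_0_l.
by rewrite eq_xk ltnn in lt_kx.
Qed.

Lemma point_mass_ge0 k x : 0 <= point_mass k x.
Proof. by rewrite /point_mass; case: eqP => _; lra. Qed.

Lemma point_mass_summable k : summable (point_mass k).
Proof.
apply: ex_series_nonneg_summable; first exact: point_mass_ge0.
exists 1; have := @is_series_point_mass k (fun=> 1).
by apply: is_series_ext => x; exact: Rmult_1_r.
Qed.

Lemma FT_point_mass k t : FT (point_mass k) t = cis (INR k * t).
Proof.
rewrite /FT /cis; congr pair; apply: is_series_unique.
  exact: (@is_series_point_mass k (fun x => cos (INR x * t))).
exact: (@is_series_point_mass k (fun x => sin (INR x * t))).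
Qed.

Lemma law_point_mass_0 : law_with_moments (point_mass 0) 0 0.
Proof.
have s1 (f : nat -> R) (l : R) : f 0%N = l -> is_series (fun x => point_mass 0 x * f x) l.
  by move=> <-; exact: (@is_series_point_mass 0 f).
split.
- exact: point_mass_ge0.
- by have := s1 (fun=> 1) 1 erefl; apply: is_series_ext => x; exact: Rmult_1_r.
- by apply: s1; rewrite /=; ring.
- apply: ex_series_nonneg_summable => [x|].
    by apply: Rmult_le_pos; [exact: point_mass_ge0 | exact: pos_INR].
  by exists 0; exact: s1.
- by apply: s1; rewrite /=; ring.
Qed.

(** The variance of the sum is expanded with [conv_weight_add] applied twice; the
cross term is a convolution of two centred sequences and sums to zero. *)
Lemma law_conv (a b : nat -> R) (ma mb va vb : R) :
  law_with_moments a ma va -> law_with_moments b mb vb ->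
  law_with_moments (conv a b) (ma + mb) (va + vb).
Proof.
move=> la lb; have sa := law_summable la; have sb := law_summable lb.
case: la => a0 as_ am am1 av; case: lb => b0 bs bm bm1 bv.
have sca := summable_shifted_moment ma sa am1.
have scb := summable_shifted_moment mb sb bm1.
have sq (p : nat -> R) m v : (forall x, 0 <= p x) ->
    is_series (fun x => p x * (INR x - m) ^ 2) v ->
    summable (centered (centered p m) m) /\ Series (centered (centered p m) m) = v.
  move=> p0 pv.
  have e x : p x * (INR x - m) ^ 2 = centered (centered p m) m x.
    by rewrite /centered; ring.
  have pv' := is_series_ext _ _ _ e pv.
  split; last exact: is_series_unique.
  apply: ex_series_nonneg_summable; last by exists v.
  by move=> x; rewrite -e; apply: Rmult_le_pos => //; exact: pow2_ge_0.
have [s2a S2a] := sq a ma va a0 av; have [s2b S2b] := sq b mb vb b0 bv.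
have Sa := is_series_unique _ _ as_; have Sb := is_series_unique _ _ bs.
have Sca := is_series_unique _ _ am; have Scb := is_series_unique _ _ bm.
split.
- exact: conv_ge0.
- by have := is_series_conv sa sb; rewrite Sa Sb Rmult_1_l.
- apply: (is_series_ext (fun x => conv (centered a ma) b x + conv a (centered b mb) x)).
    by move=> x; rewrite /centered conv_weight_add.
  have -> : 0 = Series (centered a ma) * Series b + Series a * Series (centered b mb).
    by rewrite Sca Scb; ring.
  by apply: is_series_plus; apply: is_series_conv.
- exact: moment1_conv.
have e x : conv a b x * (INR x - (ma + mb)) ^ 2 =
    conv (centered (centered a ma) ma) b x + 2 * conv (centered a ma) (centered b mb) x
    + conv a (centered (centered b mb) mb) x.
  rewrite /= Rmult_1_r -Rmult_assoc conv_weight_add Rmult_plus_distr_r !conv_weight_add.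
  by rewrite /centered; ring.
apply: (is_series_ext _ _ _ (fun x => esym (e x))).
have -> : va + vb = Series (centered (centered a ma) ma) * Series b
   + 2 * (Series (centered a ma) * Series (centered b mb))
   + Series a * Series (centered (centered b mb) mb).
  by rewrite S2a S2b Sca Sa Sb; ring.
apply: is_series_plus; [apply: is_series_plus|]; try exact: is_series_conv.
by apply: is_series_scal_l; exact: is_series_conv.
Qed.

Definition sum_law (T : Type) (a : T -> nat -> R) (s : seq T) : nat -> R :=
  foldr (fun k b => conv (a k) b) (point_mass 0) s.

Section SumLaw.

Variables (T : eqType) (a : T -> nat -> R).

Lemma sum_law_summable s : (forall k, summable (a k)) -> summable (sum_law a s).
Proof.
move=> sa; elim: s => [|k s IH] /=; first exact: point_mass_summable.
exact: summable_conv.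
Qed.

Lemma sum_law_ge0 s x : (forall k x, 0 <= a k x) -> 0 <= sum_law a s x.
Proof.
move=> a0; elim: s x => [|k s IH] x /=; first exact: point_mass_ge0.
exact: conv_ge0.
Qed.

Lemma sum_law_moment1 s : (forall k, summable (a k)) -> (forall k, moment1 (a k)) ->
  moment1 (sum_law a s).
Proof.
move=> sa ma; elim: s => [|k s IH] /=; first exact: (law_moment1 law_point_mass_0).
by apply: moment1_conv => //; exact: sum_law_summable.
Qed.

Lemma FT_sum_law s t : (forall k, summable (a k)) ->
  FT (sum_law a s) t = \big[Cmult/RtoC 1]_(k <- s) FT (a k) t.
Proof.
move=> sa; elim: s => [|k s IH] /=.
  by rewrite big_nil FT_point_mass Rmult_0_l cis_0.
by rewrite big_cons FT_conv ?IH //; exact: sum_law_summable.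
Qed.

Lemma law_sum_law (m v : T -> R) s :
  (forall k, k \in s -> law_with_moments (a k) (m k) (v k)) ->
  law_with_moments (sum_law a s) (\big[Rplus/0]_(k <- s) m k) (\big[Rplus/0]_(k <- s) v k).
Proof.
elim: s => [|k s IH] la /=; first by rewrite !big_nil; exact: law_point_mass_0.
rewrite !big_cons; apply: law_conv; first by apply: la; rewrite mem_head.
by apply: IH => j js; apply: la; rewrite inE js orbT.
Qed.

Variables (m v g : T -> R) (t G : R).

Lemma FT_sum_law_decay s : (forall k, summable (a k)) ->
  (forall k, k \in s -> Cmod (FT (a k) t) <= exp (- (g k * t ^ 2 / 18))) ->
  Cmod (FT (sum_law a s) t) <= exp (- ((\big[Rplus/0]_(k <- s) g k) * t ^ 2 / 18)).
Proof.
move=> sa; elim: s => [|k s IH] dec /=.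
  rewrite FT_point_mass Cmod_cis big_nil.
  by rewrite (_ : - _ = 0) ?exp_0; [exact: Rle_refl | field].
rewrite FT_conv //; last exact: sum_law_summable.
rewrite Cmod_mult big_cons (_ : - _ = - (g k * t ^ 2 / 18)
  + - ((\big[Rplus/0]_(j <- s) g j) * t ^ 2 / 18)); last by field.
rewrite exp_plus; apply: Rmult_le_compat; try exact: Cmod_ge_0.
  by apply: dec; rewrite mem_head.
by apply: IH => j js; apply: dec; rewrite inE js orbT.
Qed.

(** Centring distributes over the factors one at a time, so all but one
factor keep their decay; the missing one is absorbed in [G]. *)
Lemma FT_centered_sum_law_decay s : (forall k, summable (a k)) ->
  (forall k, moment1 (a k)) -> (forall k, k \in s -> g k <= G) -> 0 <= G ->
  (forall k, k \in s -> 0 <= v k) ->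
  (forall k, k \in s -> Cmod (FT (a k) t) <= exp (- (g k * t ^ 2 / 18))) ->
  (forall k, k \in s -> Cmod (FT (centered (a k) (m k)) t) <= v k * t) ->
  Cmod (FT (centered (sum_law a s) (\big[Rplus/0]_(k <- s) m k)) t) <=
   (\big[Rplus/0]_(k <- s) v k) * t
   * exp (- (((\big[Rplus/0]_(k <- s) g k) - G) * t ^ 2 / 18)).
Proof.
move=> sa ma + G0; elim: s => [|k s IH] gG v0 dec cen.
  rewrite !big_nil /= !Rmult_0_l.
  have -> : FT (centered (point_mass 0) 0) t = RtoC 0.
    have e x : centered (point_mass 0) 0 x = 0 * 0.
      rewrite /centered /point_mass; case: eqP => [->|_]; rewrite /=; ring.
    rewrite (FT_ext t e) FT_scal; ring.
  by rewrite Cmod_0; exact: Rle_refl.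
have sub j : j \in s -> j \in k :: s by rewrite inE => ->; rewrite orbT.
have {}IH := IH (fun j js => gG j (sub j js)) (fun j js => v0 j (sub j js))
  (fun j js => dec j (sub j js)) (fun j js => cen j (sub j js)).
have decs := FT_sum_law_decay sa (fun j js => dec j (sub j js)).
have ks : k \in k :: s by rewrite mem_head.
have ss := sum_law_summable s sa; have ms := sum_law_moment1 s sa ma.
rewrite !big_cons /=.
set mu := \big[Rplus/0]_(j <- s) m j in IH *.
set vs := \big[Rplus/0]_(j <- s) v j in IH *.
set gs := \big[Rplus/0]_(j <- s) g j in IH decs *.
have vs0 : 0 <= vs.
  rewrite /vs big_seq; apply: (big_ind (fun x => 0 <= x)) => [||j js].
  - exact: Rle_refl.
  - by move=> x y; lra.
  by apply: v0; exact: sub.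
have -> : FT (centered (conv (a k) (sum_law a s)) (m k + mu)) t =
   (FT (centered (a k) (m k)) t * FT (sum_law a s) t
   + FT (a k) t * FT (centered (sum_law a s) mu) t)%C.
  have sc := summable_shifted_moment (m k) (sa k) (ma k).
  have scs := summable_shifted_moment mu ss ms.
  rewrite -!FT_conv // -[X in (_ + X)%C]Cmult_1_l -FT_lin; try exact: summable_conv.
  by apply: FT_ext => x; rewrite /centered conv_weight_add Rmult_1_l.
apply: Rle_trans (Cmod_triangle _ _) _; rewrite !Cmod_mult.
set E := exp (- ((g k + gs - G) * t ^ 2 / 18)).
have t2 := pow2_ge_0 t.
have gk := gG k ks.
have h1 : Cmod (FT (centered (a k) (m k)) t) * Cmod (FT (sum_law a s) t) <= v k * t * E.
  apply: Rmult_le_compat; try exact: Cmod_ge_0; first exact: cen.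
  apply: Rle_trans decs _; apply: exp_monotone.
  have : (g k - G) * t ^ 2 <= 0 * t ^ 2 by apply: Rmult_le_compat_r; lra.
  lra.
have h2 : Cmod (FT (a k) t) * Cmod (FT (centered (sum_law a s) mu) t) <= vs * t * E.
  have -> : vs * t * E = exp (- (g k * t ^ 2 / 18)) *
      (vs * t * exp (- ((gs - G) * t ^ 2 / 18))).
    have -> : E = exp (- (g k * t ^ 2 / 18)) * exp (- ((gs - G) * t ^ 2 / 18)).
      by rewrite /E -exp_plus; congr exp; field.
    ring.
  by apply: Rmult_le_compat; try exact: Cmod_ge_0; first exact: dec.
lra.
Qed.

End SumLaw.

(** * Sums over configurations *)

Lemma FT_finite_combination (J : Type) (s : seq J) (w : J -> R) (k : J -> nat) t :
  summable (fun x => \big[Rplus/0]_(j <- s) (w j * point_mass (k j) x)) /\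
  FT (fun x => \big[Rplus/0]_(j <- s) (w j * point_mass (k j) x)) t =
  \big[Cplus/RtoC 0]_(j <- s) (RtoC (w j) * cis (INR (k j) * t))%C.
Proof.
elim: s => [|j s [IH1 IH2]].
  rewrite big_nil; split.
    apply: (@summable_le _ (fun x => 0 * point_mass 0 x)) => [x|].
      by rewrite big_nil Rabs_R0 Rmult_0_l; exact: Rle_refl.
    by apply: ex_series_scal_l; apply: summable_ex; exact: point_mass_summable.
  rewrite (@FT_ext _ (fun x => 0 * 0)); last by move=> x; rewrite big_nil; ring.
  rewrite FT_scal; ring.
have e x : \big[Rplus/0]_(i <- (j :: s)) (w i * point_mass (k i) x) =
    \big[Rplus/0]_(i <- s) (w i * point_mass (k i) x) + w j * point_mass (k j) x.
  by rewrite big_cons Rplus_comm.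
have sp := point_mass_summable (k j).
split.
  apply: (@summable_le _ (fun x => Rabs (\big[Rplus/0]_(i <- s) (w i * point_mass (k i) x))
     + Rabs (w j) * Rabs (point_mass (k j) x))) => [x|].
    by rewrite e -Rabs_mult; exact: Rabs_triang.
  by apply: ex_series_plus => //; exact: ex_series_scal_l.
by rewrite (FT_ext t e) FT_lin // IH2 FT_point_mass big_cons Cplus_comm.
Qed.

Lemma RtoC_big (J : Type) (s : seq J) (w : J -> R) :
  RtoC (\big[Rmult/1]_(j <- s) w j) = \big[Cmult/RtoC 1]_(j <- s) RtoC (w j).
Proof.
by elim: s => [|j s IH]; rewrite ?big_nil // !big_cons RtoC_mult IH.
Qed.

Lemma cis_big (J : Type) (s : seq J) (c : J -> nat) t :
  cis (INR (\sum_(j <- s) c j)%N * t) = \big[Cmult/RtoC 1]_(j <- s) cis (INR (c j) * t).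
Proof.
elim: s => [|j s IH]; first by rewrite !big_nil Rmult_0_l cis_0.
by rewrite !big_cons plus_INR Rmult_plus_distr_r cis_add IH.
Qed.

Lemma sum_law_local (T : Type) (a b : T -> nat -> R) (s : seq T) (M x : nat) :
  (forall k y, (y <= M)%N -> a k y = b k y) -> (x <= M)%N ->
  sum_law a s x = sum_law b s x.
Proof.
move=> eq_ab; elim: s x => [|k s IH] x le_xM //=.
by apply: conv_local => y le_yx; [apply: eq_ab | apply: IH]; apply: leq_trans le_yx le_xM.
Qed.

(** Both sides are the coefficient of the same trigonometric polynomial,
expanded by distributivity on the left. *)
Lemma config_sum (n M : nat) (a : 'I_n -> nat -> R) :
  \big[Rplus/0]_(c : {ffun 'I_n -> 'I_M.+1} | (\sum_(k < n) c k)%N == M)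
     \big[Rmult/1]_(k < n) a k (c k) =
  sum_law a (index_enum 'I_n) M.
Proof.
pose b k x := \big[Rplus/0]_(i < M.+1) (a k i * point_mass i x).
have b_eq k x : (x <= M)%N -> a k x = b k x.
  move=> le_xM; rewrite /b (bigD1 (Ordinal (n := M.+1) le_xM)) //= big1 => [|i neq_i].
    by rewrite /point_mass eqxx Rmult_1_r Rplus_0_r.
  rewrite /point_mass; case: eqP => [eq_i|_]; last exact: Rmult_0_r.
  by case/eqP: neq_i; apply: val_inj.
have sb k : summable (b k).
  exact: (proj1 (FT_finite_combination (index_enum 'I_M.+1)
    (fun i : 'I_M.+1 => a k i) (@nat_of_ord M.+1) 0)).
pose A x := \big[Rplus/0]_(c : {ffun 'I_n -> 'I_M.+1})
  (\big[Rmult/1]_(k < n) a k (c k) * point_mass (\sum_(k < n) c k)%N x).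
have [sA _] := FT_finite_combination (index_enum {ffun 'I_n -> 'I_M.+1})
  (fun c => \big[Rmult/1]_(k < n) a k (c k)) (fun c => (\sum_(k < n) c k)%N) 0.
have A_eq : A M = sum_law b (index_enum 'I_n) M.
  apply: FT_inj => // [|t]; first exact: sum_law_summable.
  rewrite (proj2 (FT_finite_combination _ _ _ t)) FT_sum_law //.
  rewrite (eq_bigr (fun k => \big[Cplus/RtoC 0]_(i < M.+1)
     (RtoC (a k i) * cis (INR i * t))%C)); last first.
    by move=> k _; rewrite (proj2 (FT_finite_combination _ (fun i : 'I_M.+1 => a k i)
      (@nat_of_ord M.+1) t)).
  rewrite bigA_distr_bigA; apply: eq_bigr => c _.
  by rewrite RtoC_big cis_big -big_split.
rewrite (@sum_law_local _ a b _ M M) // -A_eq /A big_mkcond; apply: eq_bigr => c _.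
by rewrite /point_mass eq_sym; case: eqP => _; ring.
Qed.

(** * The network and its associated independent variables *)

Lemma conv_point_mass (k M : nat) (b : nat -> R) :
  conv (point_mass k) b M = if (k <= M)%N then b (M - k)%N else 0.
Proof.
rewrite /conv (PartSum.sum_eq _ (fun x => b (M - x)%N * (if x == k then 1 else 0))).
  by rewrite sum_f_R0_delta; case: ifP => _; rewrite ?Rmult_1_r.
by move=> i _; exact: Rmult_comm.
Qed.

Section Network.

Variables (n : nat) (N : network n) (lam : R).
Hypothesis N_closed : closed_network N.
Hypothesis N_mean : mean_parameter N lam.

Let p := X_pmf N lam.
Let m := X_mean N lam.
Let M := customers N.

(** Some queue has positive mass, and positivity propagates along the transitions
of an irreducible routing. *)
Lemma inv_law_gt0 k : 0 < inv_law N k.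
Proof.
have [_ [[[P0 _] irr] [[pi0 [pi1 piP]] _]]] := N_closed.
have [i pi_i] : exists i, 0 < inv_law N i.
  apply: Classical_Prop.NNPP => none; move: pi1.
  rewrite big1 => [?|i _]; first lra.
  by apply: Rle_antisym (pi0 i); apply: Rnot_lt_le => lt; apply: none; exists i.
elim: (irr i k) pi_i => // [a b Pab pi_a|a b c _ IHab _ IHbc pi_a]; last first.
  by apply: IHbc; exact: IHab.
rewrite -piP (bigD1 a) //.
have : 0 <= \big[Rplus/0]_(j < n | j != a) (inv_law N j * routing N j b).
  apply: (big_ind (fun x => 0 <= x)) => [|x y|j _]; [exact: Rle_refl | lra |].
  exact: Rmult_le_pos.
have pos := Rmult_lt_0_compat _ _ pi_a Pab.
by move=> ?; apply: Rplus_lt_le_0_compat.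
Qed.

Lemma coef_gt0 k q : 0 < coef N k q.
Proof.
apply: Rinv_0_lt_compat; rewrite big_nat.
apply: (big_ind (fun x => 0 < x)) => [|x y|i /andP[i1 _]].
- exact: Rlt_0_1.
- exact: Rmult_lt_0_compat.
by case: N_closed => rate0 _; exact: rate0.
Qed.

Let lam_gt0 : 0 < lam.
Proof. by case: N_mean => -[]. Qed.

Let z_gt0 k : 0 < lam * inv_law N k.
Proof. by apply: Rmult_lt_0_compat => //; exact: inv_law_gt0. Qed.

Let term_gt0 k x : 0 < (lam * inv_law N k) ^ x * coef N k x.
Proof. by apply: Rmult_lt_0_compat (coef_gt0 k x); exact: pow_lt. Qed.

Let gen_fun_sum k :
  is_series (fun x => (lam * inv_law N k) ^ x * coef N k x) (gen_fun N k (lam * inv_law N k)).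
Proof.
have := (proj2 (proj1 N_mean)) k => /PSeries_correct h.
by apply: is_series_ext h => x; rewrite pow_n_pow.
Qed.

Let gen_fun_gt0 k : 0 < gen_fun N k (lam * inv_law N k).
Proof.
rewrite -(is_series_unique _ _ (@gen_fun_sum k)).
apply: Rlt_le_trans (term_gt0 k 0) _.
apply: Series_ge_term; first by eexists; exact: (@gen_fun_sum k).
by move=> x; apply: Rlt_le.
Qed.

Lemma X_pmf_gt0 k x : 0 < p k x.
Proof. by apply: Rmult_lt_0_compat => //; apply: Rinv_0_lt_compat. Qed.

Lemma X_pmf_sum k : is_series (p k) 1.
Proof.
have <- : / gen_fun N k (lam * inv_law N k) * gen_fun N k (lam * inv_law N k) = 1.
  by rewrite Rinv_l //; have := gen_fun_gt0 k; lra.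
exact: (is_series_scal_l (/ gen_fun N k (lam * inv_law N k)) _ _ (@gen_fun_sum k)).
Qed.

Lemma X_pmf_summable k : summable (p k).
Proof.
apply: ex_series_nonneg_summable => [x|]; first by apply: Rlt_le; exact: X_pmf_gt0.
by exists 1; exact: (@X_pmf_sum k).
Qed.

Lemma X_pmf_moment1 k : moment1 (p k).
Proof.
apply: ex_series_nonneg_summable => [x|]; last exact: (proj1 (proj2 N_mean)).
by apply: Rmult_le_pos; [apply: Rlt_le; exact: X_pmf_gt0 | exact: pos_INR].
Qed.

Lemma X_mean_sum k : is_series (weighted (p k)) (m k).
Proof. by apply: Series_correct; exact: (proj1 (proj2 N_mean)). Qed.

Lemma X_mean_gt0 k : 0 < m k.
Proof.
rewrite -(is_series_unique _ _ (@X_mean_sum k)).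
apply: Rlt_le_trans (_ : 0 < weighted (p k) 1) _.
  by rewrite /weighted Rmult_1_r; exact: X_pmf_gt0.
apply: Series_ge_term; first by eexists; exact: (@X_mean_sum k).
by move=> x; apply: Rmult_le_pos; [apply: Rlt_le; exact: X_pmf_gt0 | exact: pos_INR].
Qed.

Lemma X_mean_total : \big[Rplus/0]_(k < n) m k = INR M.
Proof. exact: (proj2 (proj2 N_mean)). Qed.

Lemma X_centered_sum k : is_series (centered (p k) (m k)) 0.
Proof.
have -> : 0 = m k - m k * 1 by ring.
apply: (is_series_ext (fun x => weighted (p k) x - m k * p k x)).
  by move=> x; rewrite -[_ = _]/(@eq R _ _) /centered /weighted; ring.
by apply: is_series_minus (@X_mean_sum k) _; apply: is_series_scal_l; exact: (@X_pmf_sum k).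
Qed.

Lemma X_law k : abs_moment_finite N lam 2 k ->
  law_with_moments (p k) (m k) (variance N lam k).
Proof.
move=> fin2; split.
- by move=> x; apply: Rlt_le; exact: X_pmf_gt0.
- exact: (@X_pmf_sum k).
- exact: (@X_centered_sum k).
- exact: X_pmf_moment1.
have := Series_correct _ fin2; apply: is_series_ext => x.
by rewrite power0_2.
Qed.

Lemma FT_char_fun k t : FT (p k) t = (cis (m k * t) * char_fun N lam k t)%C.
Proof.
have sp := X_pmf_summable k.
have trig (f : R -> R) : (forall u, Rabs (f u) <= 1) ->
    ex_series (fun x => p k x * f ((INR x - m k) * t)).
  by move=> f1; apply: summable_ex; apply: summable_mul_le1 => // x.
have ec := trig cos Rabs_cos_le1; have es := trig sin Rabs_sin_le1.
rewrite /FT /char_fun /X_E /cis /Cmult /=; congr pair.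
  rewrite -!Series_scal_l -Series_minus; [|exact: ex_series_scal_l..].
  apply: Series_ext => x; rewrite (_ : INR x * t = m k * t + (INR x - m k) * t); last ring.
  rewrite cos_plus /m /p; ring.
rewrite -!Series_scal_l -Series_plus; [|exact: ex_series_scal_l..].
apply: Series_ext => x; rewrite (_ : INR x * t = m k * t + (INR x - m k) * t); last ring.
rewrite sin_plus /m /p; ring.
Qed.

(** * Queue lengths in terms of the independent variables *)

Definition total_prob : R := sum_law p (index_enum 'I_n) M.

Let scale := \big[Rmult/1]_(k < n) / gen_fun N k (lam * inv_law N k).

Let scale_gt0 : 0 < scale.
Proof.
apply: (big_ind (fun x => 0 < x)) => [|x y|k _]; first exact: Rlt_0_1.
  exact: Rmult_lt_0_compat.
exact: Rinv_0_lt_compat.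
Qed.

(** The parameter [lam] enters only through the total number of customers: this
is why conditioning the independent variables on their sum gives the
stationary law, whatever [lam]. *)
Lemma prod_X_pmf (q : 'I_n -> nat) :
  \big[Rmult/1]_(k < n) p k (q k) = scale * lam ^ (\sum_(k < n) q k)%N * weight N q.
Proof.
have -> : lam ^ (\sum_(k < n) q k)%N = \big[Rmult/1]_(k < n) lam ^ (q k).
  by apply: (big_morph (fun j => lam ^ j) (fun a b => pow_add lam a b)).
rewrite /scale /weight -!big_split; apply: eq_bigr => k _.
by rewrite /p /X_pmf /= Rpow_mult_distr; ring.
Qed.

Let weight_gt0 q : 0 < weight N q.
Proof.
apply: (big_ind (fun x => 0 < x)) => [|x y|k _]; first exact: Rlt_0_1.
  exact: Rmult_lt_0_compat.
by apply: Rmult_lt_0_compat (coef_gt0 k (q k)); apply: pow_lt; exact: inv_law_gt0.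
Qed.

Lemma total_prob_Zpart : total_prob = scale * lam ^ M * Zpart N.
Proof.
rewrite /total_prob -config_sum /Zpart big_distrr /=; apply: eq_bigr => c /eqP sum_c.
by rewrite prod_X_pmf sum_c.
Qed.

Lemma total_prob_gt0 : 0 < total_prob.
Proof.
rewrite total_prob_Zpart; apply: Rmult_lt_0_compat.
  by apply: Rmult_lt_0_compat => //; exact: pow_lt.
have [k0 _] : exists k : 'I_n, True.
  by have [_ [_ [_ [k _]]]] := N_closed; exists k.
pose c0 : config N := [ffun k => if k == k0 then ord_max else ord0].
have sum_c0 : (\sum_(k < n) c0 k)%N == customers N.
  rewrite (bigD1 k0) //= ffunE eqxx big1 ?addn0 // => k neq_k.
  by rewrite ffunE (negbTE neq_k).
rewrite /Zpart (bigD1 c0) //.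
have : 0 <= \big[Rplus/0]_(c : config N | ((\sum_(k < n) c k)%N == customers N) && (c != c0))
    weight N (fun k => c k).
  apply: (big_ind (fun x => 0 <= x)) => [|x y|c _]; [exact: Rle_refl | lra |].
  by apply: Rlt_le.
by apply: Rplus_lt_le_0_compat.
Qed.

Lemma Q_law_eq (q : 'I_n -> nat) : (\sum_(k < n) q k)%N = M ->
  Q_law N q = \big[Rmult/1]_(k < n) p k (q k) / total_prob.
Proof.
move=> sum_q; rewrite /Q_law sum_q eqxx prod_X_pmf sum_q total_prob_Zpart.
have lamM : 0 < lam ^ M by exact: pow_lt.
have := total_prob_gt0; rewrite total_prob_Zpart => h.
have Z0 : Zpart N <> 0 by move=> Z0; move: h; rewrite Z0 Rmult_0_r; lra.
by field; repeat split => //; lra.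
Qed.

(** Expectations of products under the law of the queue lengths are
coefficients of convolutions. *)
Lemma Q_expectation (h : 'I_n -> nat -> R) :
  \big[Rplus/0]_(c : config N) (\big[Rmult/1]_(k < n) h k (c k) * Q_law N (fun k => c k)) =
  sum_law (fun k x => h k x * p k x) (index_enum 'I_n) M / total_prob.
Proof.
rewrite -config_sum /Rdiv big_distrl /= [RHS]big_mkcond; apply: eq_bigr => c _.
case: eqP => [sum_c|neq]; last by rewrite /Q_law; case: eqP => // _; rewrite Rmult_0_r.
by rewrite (Q_law_eq sum_c) [X in _ = X * _]big_split /Rdiv -Rmult_assoc.
Qed.

Definition rest_law (A : {set 'I_n}) : nat -> R :=
  sum_law p [seq k <- index_enum 'I_n | k \notin A].

Lemma sum_law_summable_p s : summable (sum_law p s).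
Proof. by apply: sum_law_summable => k; exact: X_pmf_summable. Qed.

(** Fixing the lengths on [A] replaces the laws of these queues by multiples of
point masses, which shift the position in the law of the others. *)
Lemma Q_marginal_eq (A : {set 'I_n}) (q : 'I_n -> nat) :
  \big[Rplus/0]_(c : config N | [forall k : 'I_n, (k \in A) ==> (c k == q k :> nat)])
     Q_law N (fun k => c k) =
  \big[Rmult/1]_(k in A) p k (q k) *
  (if (\sum_(k in A) q k <= M)%N then rest_law A (M - \sum_(k in A) q k)%N else 0)
  / total_prob.
Proof.
pose h k x := if k \in A then point_mass (q k) x else 1.
have -> : \big[Rplus/0]_(c : config N | [forall k : 'I_n, (k \in A) ==> (c k == q k :> nat)])
     Q_law N (fun k => c k) =
  \big[Rplus/0]_(c : config N) (\big[Rmult/1]_(k < n) h k (c k) * Q_law N (fun k => c k)).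
  rewrite big_mkcond; apply: eq_bigr => c _.
  case: ifP => [/forallP eqc|/negbT].
    rewrite big1 ?Rmult_1_l // => k _; rewrite /h; have := eqc k.
    by case: (k \in A) => //= /eqP ck; rewrite /point_mass ck eqxx.
  rewrite negb_forall => /existsP[k]; rewrite negb_imply => /andP[kA /negbTE neq].
  by rewrite (bigD1 k) //= {1}/h kA /point_mass neq !Rmult_0_l.
rewrite Q_expectation; congr (_ / _).
have sh k : summable (fun x => h k x * p k x).
  have sp := X_pmf_summable k; rewrite /h; case: (k \in A).
    apply: (@summable_le _ (fun x => Rabs (p k x))) => // x.
    rewrite Rabs_mult /point_mass; have := Rabs_pos (p k x).
    by case: eqP => _; rewrite ?Rabs_R1 ?Rabs_R0; lra.
  by apply: (@summable_le _ (fun x => Rabs (p k x))) => // x; rewrite Rmult_1_l; exact: Rle_refl.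
rewrite -conv_point_mass.
set Pi := \big[Rmult/1]_(k in A) p k (q k).
have sr := sum_law_summable_p [seq k <- index_enum 'I_n | k \notin A].
have sc := summable_conv (point_mass_summable (\sum_(k in A) q k)%N) sr.
apply: (FT_inj (b := fun x => Pi * conv (point_mass (\sum_(k in A) q k)%N) (rest_law A) x)).
- exact: sum_law_summable.
- apply: (@summable_le _ (fun x => Rabs Pi * Rabs (conv (point_mass (\sum_(k in A) q k)%N)
    (rest_law A) x))) => [x|]; last exact: ex_series_scal_l.
  by rewrite Rabs_mult; exact: Rle_refl.
move=> t; rewrite FT_scal FT_conv //; last exact: point_mass_summable.
rewrite FT_point_mass !FT_sum_law //; last by move=> k; exact: X_pmf_summable.
rewrite big_filter (bigID (mem A)) /= Cmult_assoc; congr Cmult.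
  have -> : RtoC Pi = \big[Cmult/RtoC 1]_(k in A) RtoC (p k (q k)).
    by rewrite /Pi -[in LHS]big_filter RtoC_big big_filter.
  have -> : cis (INR (\sum_(k in A) q k)%N * t) =
      \big[Cmult/RtoC 1]_(k in A) cis (INR (q k) * t).
    by rewrite -[in LHS]big_filter cis_big big_filter.
  rewrite -big_split /=.
  apply: eq_bigr => k kA; rewrite -FT_point_mass -FT_scal; apply: FT_ext => x.
  rewrite /h kA /point_mass; case: eqP => [->|_]; ring.
apply: eq_bigr => k /negbTE kA; apply: FT_ext => x; rewrite /h kA; ring.
Qed.

(** Queue [j] enters with its weighted law, the others with their own. *)
Lemma Q_mean_eq (j : 'I_n) :
  Q_mean N j = conv (weighted (p j)) (rest_law [set j]) M / total_prob.
Proof.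
pose h k x := if k == j then INR x else 1.
have -> : Q_mean N j =
  \big[Rplus/0]_(c : config N) (\big[Rmult/1]_(k < n) h k (c k) * Q_law N (fun k => c k)).
  apply: eq_bigr => c _; rewrite (bigD1 j) //= {1}/h eqxx big1 ?Rmult_1_r // => k.
  by rewrite /h => /negbTE ->.
rewrite Q_expectation; congr (_ / _).
have sw : summable (weighted (p j)) by exact: X_pmf_moment1.
have sh k : summable (fun x => h k x * p k x).
  rewrite /h; case: eqP => [->|_].
    by apply: (@summable_le _ (fun x => Rabs (weighted (p j) x))) => // x;
       rewrite Rmult_comm; exact: Rle_refl.
  apply: (@summable_le _ (fun x => Rabs (p k x))) => [x|]; last exact: X_pmf_summable.
  by rewrite Rmult_1_l; exact: Rle_refl.
have sr := sum_law_summable_p [seq k <- index_enum 'I_n | k \notin [set j]].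
apply: FT_inj => [||t]; [exact: sum_law_summable | exact: summable_conv |].
rewrite FT_conv // !FT_sum_law //; last by move=> k; exact: X_pmf_summable.
rewrite big_filter (bigD1 j) //=; congr Cmult.
  by apply: FT_ext => x; rewrite /h eqxx /weighted; ring.
apply: eq_big => k; first by rewrite inE.
by move=> /negbTE kj; apply: FT_ext => x; rewrite /h kj; ring.
Qed.

End Network.

(** * Estimates for one network *)

Lemma derC_prod_bound (T : eqType) (f : T -> R -> C) (K Q : R) (s : seq T) (t : R) :
  0 <= K -> 1 <= Q -> (forall k, k \in s -> Cmod (f k t) <= Q) ->
  (forall k, k \in s -> exists d, derC (f k) t d /\ Cmod d <= K) ->
  Cmod (\big[Cmult/RtoC 1]_(k <- s) f k t) <= Q ^ size s /\
  exists d, derC (fun u => \big[Cmult/RtoC 1]_(k <- s) f k u) t d /\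
            Cmod d <= INR (size s) * K * Q ^ size s.
Proof.
move=> K0 Q1; elim: s => [|k s IH] fQ df.
  rewrite big_nil Cmod_1; split; first by rewrite /=; lra.
  exists (RtoC 0); split; last by rewrite Cmod_0 /=; lra.
  by apply: derC_ext (derC_const (RtoC 1) t) => u; rewrite big_nil.
have sub j : j \in s -> j \in k :: s by rewrite inE => ->; rewrite orbT.
have [b1 [d2 [D2 b2]]] := IH (fun j js => fQ j (sub j js)) (fun j js => df j (sub j js)).
have ks : k \in k :: s by rewrite mem_head.
have [d1 [D1 c1]] := df k ks; have q1 := fQ k ks.
have Qs : 0 < Q ^ size s by apply: pow_lt; lra.
rewrite big_cons Cmod_mult; split.
  by apply: Rmult_le_compat => //; exact: Cmod_ge_0.
exists (d1 * \big[Cmult/RtoC 1]_(j <- s) f j t + f k t * d2)%C; split.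
  by apply: derC_ext (derC_mult D1 D2) => u; rewrite big_cons.
apply: Rle_trans (Cmod_triangle _ _) _; rewrite !Cmod_mult.
have h1 : Cmod d1 * Cmod (\big[Cmult/RtoC 1]_(j <- s) f j t) <= K * Q ^ size s.
  by apply: Rmult_le_compat => //; exact: Cmod_ge_0.
have h2 : Cmod (f k t) * Cmod d2 <= Q * (INR (size s) * K * Q ^ size s).
  by apply: Rmult_le_compat => //; exact: Cmod_ge_0.
have h3 : K * Q ^ size s * 1 <= K * Q ^ size s * Q.
  by apply: Rmult_le_compat_l; [apply: Rmult_le_pos; lra | lra].
rewrite [size _]/= S_INR [_ ^ _.+1]/=; lra.
Qed.

(** The hypotheses on one network; the parameters [B], [K], [Kg] are the constants
that have to be uniform over a sequence of networks. *)
Record regular_network (B K Kg r : R) (n : nat) (N : network n) (lam rho : R)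
    (F : {set 'I_n}) (xi : 'I_n -> R) (psi : 'I_n -> R -> C) : Prop := RegularNetwork {
  reg_closed : closed_network N;
  reg_mean : mean_parameter N lam;
  reg_rho : 0 < rho < 1;
  reg_F : F != set0;
  reg_char : forall k t, k \in F -> char_fun N lam k t =
    (cis (- (X_mean N lam k * t)) * Cpower (omega rho t) (xi k) * psi k t)%C;
  reg_psi : forall k t, k \in F -> exists d, derC (psi k) t d /\ Cmod d <= K;
  reg_xi : forall k, k \in F -> 1 <= xi k;
  reg_xi_sum : xi_sum F xi <= B;
  reg_moments : forall k, k \notin F ->
    abs_moment_finite N lam 2 k /\ abs_moment_finite N lam (2 + r) k;
  reg_sigma : 0 < sigma_hat N lam F;
  reg_gamma : sigma_hat N lam F <= Kg * gamma_hat N lam F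
}.

Definition free_queues (n : nat) (F A : {set 'I_n}) : seq 'I_n :=
  [seq k <- index_enum 'I_n | (k \notin A) && (k \notin F)].

Section OneNetwork.

Variables (B K Kg r : R) (n : nat) (N : network n) (lam rho : R).
Variables (F : {set 'I_n}) (xi : 'I_n -> R) (psi : 'I_n -> R -> C).
Hypotheses (K_ge0 : 0 <= K) (Kg_gt0 : 0 < Kg) (r_range : 0 < r <= 1).
Hypothesis reg : regular_network B K Kg r N lam rho F xi psi.

Let al := alpha rho.
Let p := X_pmf N lam.
Let m := X_mean N lam.
Let M := customers N.
Let sig := sigma_hat N lam F.
Let x := xi_sum F xi.
Let L := lyapunov N lam F r.
Let gam k := Series (pair_weight (p k)).
Let v := variance N lam.

Let rho_range := reg_rho reg.
Let sig_gt0 : 0 < sig := reg_sigma reg.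
Let p_gt0 k i : 0 < p k i := X_pmf_gt0 (reg_closed reg) (reg_mean reg) k i.
Let p_summable k : summable (p k) := X_pmf_summable (reg_closed reg) (reg_mean reg) k.
Let p_moment1 k : moment1 (p k) := X_pmf_moment1 (reg_closed reg) (reg_mean reg) k.
Let p_sum k : is_series (p k) 1 := @X_pmf_sum n N lam (reg_closed reg) (reg_mean reg) k.
Let p_law k : k \notin F -> law_with_moments (p k) (m k) (v k).
Proof.
by move=> kF; apply: (X_law (reg_closed reg) (reg_mean reg)); case: (reg_moments reg kF).
Qed.

Let al_gt0 : 0 < al.
Proof. by apply: Rdiv_lt_0_compat; lra. Qed.

Let v_ge0 k : k \notin F -> 0 <= v k.
Proof.
move=> kF; have [f2 _] := reg_moments reg kF; apply: Series_ge0 => // i.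
by apply: Rmult_le_pos; [apply: Rlt_le | exact: power0_ge0].
Qed.

Let gam_ge0 k : 0 <= gam k.
Proof. exact: pair_weight_sum_ge0. Qed.

Let sum_ge0 (P : pred 'I_n) (f : 'I_n -> R) : (forall k, P k -> 0 <= f k) ->
  0 <= \big[Rplus/0]_(k < n | P k) f k.
Proof.
by move=> f0; apply: (big_ind (fun y => 0 <= y)) => [|y z|//]; [exact: Rle_refl | lra].
Qed.

Let sum_le (P : pred 'I_n) (f h : 'I_n -> R) : (forall k, P k -> f k <= h k) ->
  \big[Rplus/0]_(k < n | P k) f k <= \big[Rplus/0]_(k < n | P k) h k.
Proof.
by move=> le_fh; apply: (big_ind2 (fun y z => y <= z)) => [|y z y' z'|//];
  [exact: Rle_refl | lra].
Qed.

Let sig_sqr : sig ^ 2 = \big[Rplus/0]_(k < n | k \notin F) v k.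
Proof. by rewrite /sig /sigma_hat pow2_sqrt //; apply: sum_ge0; exact: v_ge0. Qed.

Let gam_sum : sig ^ 2 <= Kg ^ 2 * \big[Rplus/0]_(k < n | k \notin F) gam k.
Proof.
have g0 : 0 <= \big[Rplus/0]_(k < n | k \notin F) gam k by apply: sum_ge0.
have h := reg_gamma reg; rewrite -/sig in h.
have -> : Kg ^ 2 * \big[Rplus/0]_(k < n | k \notin F) gam k = (Kg * gamma_hat N lam F) ^ 2.
  by rewrite Rpow_mult_distr /gamma_hat pow2_sqrt.
by apply: pow_incr; lra.
Qed.

Let gam_moment k s : 2 <= s <= 3 -> abs_moment_finite N lam s k ->
  gam k <= 8 * abs_moment N lam s k.
Proof. by move=> hs fin; apply: pair_weight_le_moment. Qed.

Let gam_beta : \big[Rplus/0]_(k < n | k \notin F) gam k <= 8 * beta_hat N lam F (2 + r).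
Proof.
rewrite /beta_hat big_distrr /=; apply: sum_le => k kF.
by apply: gam_moment; [lra | case: (reg_moments reg kF)].
Qed.

Let L_eq : beta_hat N lam F (2 + r) = L * (sig ^ 2 * Rpower sig r).
Proof.
have -> : sig ^ 2 * Rpower sig r = Rpower sig (2 + r).
  rewrite Rpower_plus; congr Rmult; rewrite (_ : 2 = INR 2) ?Rpower_pow //.
by rewrite /L /lyapunov -/sig; field; have := Rpower_gt0 sig (2 + r); lra.
Qed.

Let Kg8 : 0 < 8 * Kg ^ 2.
Proof. by have := pow_lt Kg 2 Kg_gt0; lra. Qed.

Let L_lower : / Rpower sig r <= 8 * Kg ^ 2 * L.
Proof.
have sr := Rpower_gt0 sig r; have s2 := pow_lt _ 2 sig_gt0.
have h : sig ^ 2 <= Kg ^ 2 * (8 * (L * (sig ^ 2 * Rpower sig r))).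
  apply: Rle_trans gam_sum _; apply: Rmult_le_compat_l; first exact: pow2_ge_0.
  by rewrite -L_eq; exact: gam_beta.
apply: (Rmult_le_reg_r (sig ^ 2 * Rpower sig r)); first exact: Rmult_lt_0_compat.
rewrite (_ : / _ * (_ * _) = sig ^ 2); last by field; lra.
lra.
Qed.

Lemma lyapunov_gt0 : 0 < L.
Proof.
have h := Rlt_le_trans _ _ _ (Rinv_0_lt_compat _ (Rpower_gt0 sig r)) L_lower.
by apply: (Rmult_lt_reg_l (8 * Kg ^ 2)) => //; rewrite Rmult_0_r.
Qed.

Lemma sigma_hat_ge1 : 8 * Kg ^ 2 * L < 1 -> 1 <= sig.
Proof.
move=> smallL; apply: Rnot_lt_le => sig1.
have := Rpower_le_1 (conj sig_gt0 (Rlt_le _ _ sig1)) (Rlt_le _ _ (proj1 r_range)) => h.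
have := Rinv_le_contravar _ _ (Rpower_gt0 sig r) h; rewrite Rinv_1; have := L_lower; lra.
Qed.

(** Integer-valued summands cannot be too concentrated: [gamma^2] is at most 8
times any moment of order between 2 and 3. Hence [sig^2] is at most a multiple
of the moment of order [2 + r], and [1 / sig], which the local limit produces
as an error, is absorbed by the Lyapunov ratio. *)
Lemma inv_sigma_le : 1 <= sig -> / sig <= 8 * Kg ^ 2 * L.
Proof.
move=> sig1; apply: Rle_trans L_lower; apply: Rinv_le_contravar; first exact: Rpower_gt0.
rewrite -[X in _ <= X](Rpower_1 sig) //; apply: Rle_Rpower; lra.
Qed.

(** One queue carries a negligible part of the variance: truncate at level
[d * sig] and bound the rest by the higher moment. *)
Let gam_small d k : 0 < d -> k \notin F ->
  gam k <= 8 * (sig ^ 2 * (d ^ 2 + L / Rpower d r)).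
Proof.
move=> d0 kF; have [f2 fr] := reg_moments reg kF.
apply: Rle_trans (gam_moment (s := 2) _ f2) _; first lra.
apply: Rmult_le_compat_l; first lra.
have ds : 0 < d * sig by apply: Rmult_lt_0_compat.
apply: Rle_trans (moment2_le (fun y => Rlt_le _ _ (p_gt0 k y)) (@p_sum k) ds
   (proj1 r_range) f2 fr) _.
have bk : abs_moment N lam (2 + r) k <= beta_hat N lam F (2 + r).
  rewrite /beta_hat (bigD1 k) //=.
  have : 0 <= \big[Rplus/0]_(i < n | (i \notin F) && (i != k)) abs_moment N lam (2 + r) i.
    apply: sum_ge0 => i /andP[iF _]; have [_ fri] := reg_moments reg iF.
    apply: Series_ge0 => // y; apply: Rmult_le_pos; [by apply: Rlt_le | exact: power0_ge0].
  by move=> nn; rewrite -[X in X <= _]Rplus_0_r; apply: Rplus_le_compat_l.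
have dr := Rpower_gt0 d r; have sr := Rpower_gt0 sig r.
rewrite -Rpower_mult_distr // -[Series _]/(abs_moment N lam (2 + r) k).
have -> : sig ^ 2 * (d ^ 2 + L / Rpower d r) =
    (d * sig) ^ 2 + beta_hat N lam F (2 + r) / (Rpower d r * Rpower sig r).
  by rewrite L_eq; field; lra.
apply: Rplus_le_compat_l; apply: Rmult_le_compat_r => //.
by apply: Rlt_le; apply: Rinv_0_lt_compat; exact: Rmult_lt_0_compat.
Qed.

(** * The saturable queues *)

Let seqF := [seq k <- index_enum 'I_n | k \in F].

Let mem_seqF k : (k \in seqF) = (k \in F).
Proof. by rewrite mem_filter mem_index_enum andbT. Qed.

Let size_sum (s : seq 'I_n) : INR (size s) = \big[Rplus/0]_(k <- s) 1.
Proof.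
elim: s => [|k s IH]; first by rewrite big_nil.
by rewrite big_cons -IH [size _]/= S_INR Rplus_comm.
Qed.

Lemma size_saturable_le : INR (size seqF) <= x.
Proof. by rewrite size_sum big_filter; apply: sum_le => k kF; exact: (reg_xi reg). Qed.

Lemma xi_le_sum j : j \in F -> xi j <= x.
Proof.
move=> jF; rewrite /x /xi_sum (bigD1 j) //= -[X in X <= _]Rplus_0_r.
apply: Rplus_le_compat_l; apply: sum_ge0 => k /andP[kF _].
by have := reg_xi reg kF; lra.
Qed.

Lemma xi_sum_ge1 : 1 <= x.
Proof.
have /set0Pn[j jF] := reg_F reg.
exact: Rle_trans (reg_xi reg jF) (xi_le_sum jF).
Qed.

Let x_le : x <= B := reg_xi_sum reg.

Let FT_saturable k t : k \in F -> FT (p k) t = (W rho (xi k) t * psi k t)%C.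
Proof.
move=> kF; rewrite (FT_char_fun (reg_closed reg) (reg_mean reg)) (reg_char reg) //.
rewrite Cpower_omega.
have -> : (cis (X_mean N lam k * t) * (cis (- (X_mean N lam k * t)) * W rho (xi k) t * psi k t)
  = (cis (- (X_mean N lam k * t)) * cis (X_mean N lam k * t)) * (W rho (xi k) t * psi k t))%C.
  by ring.
by rewrite cis_opp_mul Cmult_1_l.
Qed.

Let psi_0 k : k \in F -> psi k 0 = RtoC 1.
Proof.
move=> kF; have := FT_saturable 0 kF.
by rewrite FT_0 (is_series_unique _ _ (@p_sum k)) W_at_0 // Cmult_1_l => <-.
Qed.

(** The mean of a saturable queue, read off the derivative of its transform
at the origin. *)
Lemma saturable_mean k : k \in F -> Rabs (m k - xi k * al) <= K.
Proof.
move=> kF; have [d [D le_d]] := reg_psi reg 0 kF.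
have D1 := FT_derive 0 (p_summable k) (p_moment1 k).
have D2 := derC_mult (W_derive rho_range (xi k) 0) D.
have {}D2 := derC_ext (fun u => esym (FT_saturable u kF)) D2.
have := derC_unique D1 D2.
rewrite omega_increment // -W_one // !W_at_0 // psi_0 // FT_0 cis_0 -/al.
have -> : Series (weighted (p k)) = m k by [].
move=> eq_d; apply: Rle_trans le_d.
have -> : d = (Ci * RtoC (m k - xi k * al))%C.
  have -> : d = (Ci * RtoC (xi k) * (RtoC al * RtoC 1 * RtoC 1) * RtoC 1 * RtoC 1 + RtoC 1 * d
     - Ci * RtoC (xi k) * RtoC al)%C by ring.
  by rewrite -eq_d RtoC_minus RtoC_mult; ring.
by rewrite Cmod_mult Cmod_Ci Cmod_R Rmult_1_l; exact: Rle_refl.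
Qed.

Lemma saturable_means :
  Rabs (\big[Rplus/0]_(k in F) m k - x * al) <= B * K.
Proof.
apply: Rle_trans (_ : _ <= INR (size seqF) * K) _; last first.
  by apply: Rmult_le_compat_r => //; exact: Rle_trans size_saturable_le x_le.
rewrite /x /xi_sum -2!(big_filter _ (fun k => k \in F)) -/seqF.
have : forall k, k \in seqF -> k \in F by move=> k; rewrite mem_seqF.
elim: seqF => [|k s IH] sub.
  by rewrite !big_nil /= !Rmult_0_l Rminus_0_r Rabs_R0; exact: Rle_refl.
rewrite !big_cons [size _]/= S_INR.
have h := IH (fun j js => sub j ltac:(by rewrite inE js orbT)).
have h1 := saturable_mean (sub k ltac:(by rewrite mem_head)).
set U := \big[Rplus/0]_(j <- s) m j in h *; set V := \big[Rplus/0]_(j <- s) xi j in h *.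
rewrite (_ : _ - _ = (m k - xi k * al) + (U - V * al)); last by ring.
apply: Rle_trans (Rabs_triang _ _) _.
by rewrite Rmult_plus_distr_r Rmult_1_l Rplus_comm; apply: Rplus_le_compat.
Qed.

Let Q := 1 + K * PI.

Let Q_ge1 : 1 <= Q.
Proof.
have pi0 := PI_RGT_0; have := Rmult_le_pos _ _ K_ge0 (Rlt_le _ _ pi0).
by rewrite /Q; lra.
Qed.

Let psi_le k t : k \in F -> 0 <= t <= PI -> Cmod (psi k t) <= Q.
Proof.
move=> kF ht.
have h := derC_mean_value (proj1 ht) (fun u _ => reg_psi reg u kF).
have -> : psi k t = (psi k t - psi k 0 + RtoC 1)%C by rewrite psi_0 //; ring.
apply: Rle_trans (Cmod_triangle _ _) _; rewrite Cmod_1 /Q.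
have : K * t <= K * PI by apply: Rmult_le_compat_l; lra.
lra.
Qed.

Let QB := Rpower Q B.

Let pow_le_QB (s : seq 'I_n) : INR (size s) <= x -> Q ^ size s <= QB.
Proof.
move=> hs; rewrite -Rpower_pow; last lra.
by apply: Rle_Rpower; lra.
Qed.

Let Psi t := \big[Cmult/RtoC 1]_(k <- seqF) psi k t.
Let KPsi := B * K * QB.

Let QB_gt0 : 0 < QB := Rpower_gt0 Q B.

Let B_ge1 : 1 <= B.
Proof. exact: Rle_trans xi_sum_ge1 x_le. Qed.

Let KPsi_ge0 : 0 <= KPsi.
Proof. by apply: Rmult_le_pos; [apply: Rmult_le_pos; lra | apply: Rlt_le]. Qed.

Let Psi_derive t : 0 <= t <= PI -> exists d, derC Psi t d /\ Cmod d <= KPsi.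
Proof.
move=> ht.
have [_ [d [D le_d]]] := @derC_prod_bound _ psi K Q seqF t K_ge0 Q_ge1
  (fun k ks => psi_le (etrans (esym (mem_seqF k)) ks) ht)
  (fun k ks => reg_psi reg t (etrans (esym (mem_seqF k)) ks)).
exists d; split=> //; apply: Rle_trans le_d _.
have h := size_saturable_le; have h2 := pow_le_QB h.
apply: Rmult_le_compat => //.
- by apply: Rmult_le_pos => //; exact: pos_INR.
- by apply: pow_le; lra.
by apply: Rmult_le_compat_r => //; exact: Rle_trans h x_le.
Qed.

Let Psi_0 : Psi 0 = RtoC 1.
Proof.
rewrite /Psi big_seq big1 // => k; rewrite mem_seqF; exact: psi_0.
Qed.

Let Psi_near t : 0 <= t <= PI -> Cmod (Psi t - RtoC 1) <= KPsi * t.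
Proof.
move=> ht; rewrite -Psi_0; apply: derC_mean_value; first lra.
by move=> u hu; apply: Psi_derive; lra.
Qed.

Let FT_prod_saturable t :
  \big[Cmult/RtoC 1]_(k in F) FT (p k) t = (W rho x t * Psi t)%C.
Proof.
rewrite (eq_bigr (fun k => (W rho (xi k) t * psi k t)%C)); last first.
  by move=> k; exact: FT_saturable.
rewrite big_split /= /Psi big_filter; congr Cmult.
rewrite /x /xi_sum; symmetry.
by apply: (big_morph (fun s => W rho s t)); [move=> s u; exact: W_add | exact: W_zero].
Qed.

(** * The remaining queues *)

Variables (l : nat) (d : R).
Hypothesis d_gt0 : 0 < d.
Hypothesis small : INR l.+1 * (8 * (d ^ 2 + L / Rpower d r)) <= / (2 * Kg ^ 2).

Let G := 8 * (sig ^ 2 * (d ^ 2 + L / Rpower d r)).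
Let c := / (36 * Kg ^ 2).

Let Kg2 : 0 < Kg ^ 2.
Proof. exact: pow_lt. Qed.

Let c_gt0 : 0 < c.
Proof. by apply: Rinv_0_lt_compat; lra. Qed.

Let G_ge0 : 0 <= G.
Proof.
apply: Rmult_le_pos; first lra; apply: Rmult_le_pos; first exact: pow2_ge_0.
have := pow2_ge_0 d; have : 0 <= L / Rpower d r.
  by apply: Rmult_le_pos; apply: Rlt_le; [exact: lyapunov_gt0 | apply: Rinv_0_lt_compat; exact: Rpower_gt0].
lra.
Qed.

Let free := free_queues F.

Let mem_free A k : (k \in free A) = (k \notin A) && (k \notin F).
Proof. by rewrite mem_filter mem_index_enum andbT. Qed.

Section Removed.

Variable A : {set 'I_n}.
Hypothesis A_F : forall k, k \in A -> k \notin F.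
Hypothesis card_A : (#|A| <= l)%N.

Let gam_free : sig ^ 2 * / (2 * Kg ^ 2) <= \big[Rplus/0]_(k <- free A) gam k - G.
Proof.
have s2 := pow_lt _ 2 sig_gt0.
have h1 : sig ^ 2 * / Kg ^ 2 <= \big[Rplus/0]_(k < n | k \notin F) gam k.
  apply: (Rmult_le_reg_l (Kg ^ 2)) => //.
  rewrite (_ : Kg ^ 2 * (sig ^ 2 * / Kg ^ 2) = sig ^ 2); last by field; lra.
  exact: gam_sum.
have h2 : \big[Rplus/0]_(k < n | (k \notin F) && (k \in A)) gam k <= INR l * G.
  apply: Rle_trans (_ : _ <= \big[Rplus/0]_(k < n | (k \notin F) && (k \in A)) G) _.
    by apply: sum_le => k /andP[kF _]; exact: gam_small.
  rewrite big_const.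
  have -> : forall N0 : nat, iter N0 (Rplus G) 0 = INR N0 * G.
    elim=> [|N0 IH]; first by rewrite /= Rmult_0_l.
    by rewrite iterS IH S_INR; ring.
  apply: Rmult_le_compat_r => //; apply: le_INR; apply/leP.
  apply: leq_trans card_A; apply: subset_leq_card; apply/subsetP => k.
  by rewrite unfold_in => /andP[].
have h3 : \big[Rplus/0]_(k < n | k \notin F) gam k =
   \big[Rplus/0]_(k < n | (k \notin F) && (k \in A)) gam k
   + \big[Rplus/0]_(k <- free A) gam k.
  by rewrite big_filter (bigID (mem A)) /=; congr Rplus; apply: eq_bigl => k; rewrite andbC.
have h4 : INR l.+1 * G <= sig ^ 2 * / (2 * Kg ^ 2).
  have -> : INR l.+1 * G = sig ^ 2 * (INR l.+1 * (8 * (d ^ 2 + L / Rpower d r))).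
    by rewrite /G; ring.
  by apply: Rmult_le_compat_l; lra.
rewrite S_INR in h4.
have h5 : sig ^ 2 * / Kg ^ 2 = sig ^ 2 * / (2 * Kg ^ 2) + sig ^ 2 * / (2 * Kg ^ 2).
  by field; lra.
lra.
Qed.

Let y := sum_law p (free A).
Let mu := \big[Rplus/0]_(k <- free A) m k.

Lemma free_law :
  law_with_moments y mu (\big[Rplus/0]_(k <- free A) v k).
Proof. by apply: law_sum_law => k; rewrite mem_free => /andP[_]; exact: p_law. Qed.

Lemma free_variance : \big[Rplus/0]_(k <- free A) v k <= sig ^ 2.
Proof.
rewrite sig_sqr big_filter [X in _ <= X](bigID (mem A)) /=.
have : 0 <= \big[Rplus/0]_(k < n | (k \notin F) && (k \in A)) v k.
  by apply: sum_ge0 => k /andP[kF _]; exact: v_ge0.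
have -> : \big[Rplus/0]_(k < n | (k \notin A) && (k \notin F)) v k =
    \big[Rplus/0]_(k < n | (k \notin F) && (k \notin A)) v k.
  by apply: eq_bigl => k; rewrite andbC.
move=> nn; rewrite -[X in X <= _]Rplus_0_l; exact: Rplus_le_compat_r.
Qed.

Let decay_exponent (S t : R) : sig ^ 2 * / (2 * Kg ^ 2) <= S ->
  exp (- (S * t ^ 2 / 18)) <= exp (- (c * (sig * t) ^ 2)).
Proof.
move=> hS; apply: exp_monotone.
have := Rmult_le_compat_r _ _ _ (pow2_ge_0 t) hS.
rewrite (_ : c * (sig * t) ^ 2 = sig ^ 2 * / (2 * Kg ^ 2) * t ^ 2 / 18); first lra.
by rewrite /c; field; lra.
Qed.

Lemma free_decay t : 0 <= t <= PI -> Cmod (FT y t) <= exp (- (c * (sig * t) ^ 2)).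
Proof.
move=> ht.
apply: Rle_trans (FT_sum_law_decay (g := gam) p_summable _) _.
  by move=> k _; exact: FT_decay.
apply: decay_exponent; apply: Rle_trans gam_free _.
rewrite -[X in _ <= X]Rminus_0_r; apply: Rplus_le_compat_l.
by apply: Ropp_le_contravar; exact: G_ge0.
Qed.

Lemma free_centered_decay t : 0 <= t <= PI ->
  Cmod (FT (centered y mu) t) <= sig ^ 2 * t * exp (- (c * (sig * t) ^ 2)).
Proof.
move=> ht; rewrite /mu /y.

apply: Rle_trans (@FT_centered_sum_law_decay _ p m v gam t G (free A)
  p_summable p_moment1 _ G_ge0 _ _ _) _.
- by move=> k; rewrite mem_free => /andP[_ kF]; exact: gam_small.
- by move=> k; rewrite mem_free => /andP[_ kF]; exact: v_ge0.
- by move=> k _; exact: FT_decay.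
- by move=> k; rewrite mem_free => /andP[_ kF]; apply: FT_centered_bound => //; [exact: p_law | lra].
have vs0 : 0 <= \big[Rplus/0]_(k <- free A) v k.
  by rewrite big_filter; apply: sum_ge0 => k /andP[_]; exact: v_ge0.
apply: Rmult_le_compat.
- by apply: Rmult_le_pos => //; lra.
- by apply: Rlt_le; exact: exp_pos.
- by apply: Rmult_le_compat_r; [lra | exact: free_variance].
exact: decay_exponent gam_free.
Qed.

Let FT_rest t : FT (rest_law N lam A) t = (W rho x t * Psi t * FT y t)%C.
Proof.
rewrite !FT_sum_law // big_filter (bigID (mem F)) /= -FT_prod_saturable big_filter.
congr Cmult; apply: eq_bigl => k.
by case kF: (k \in F); rewrite ?andbF // andbT; apply/negP => /A_F; rewrite kF.
Qed.

Let rest_summable : summable (rest_law N lam A).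
Proof. exact: sum_law_summable. Qed.

Let rest_moment1 : moment1 (rest_law N lam A).
Proof. exact: sum_law_moment1. Qed.

(** The saturable queues contribute [W] to the power of their total exponent,
times the product of their Lipschitz factors. The other queues outside [A] keep
at least half of the decay: by [small], [l + 1] queues carry at most half of
[gamma^2], where [l] may be removed with [A] and one more is lost when the sum
is centred. *)
Lemma rest_perturbed : perturbed_nb c KPsi rho x sig (rest_law N lam A) y Psi mu.
Proof.
split=> //.
- exact: free_decay.
- exact: free_centered_decay.
Qed.

(** One more geometric factor raises the exponent by one: this law appears in the
mean of a saturable queue. *)
Lemma rest_perturbed_shifted :
  perturbed_nb c KPsi rho (x + 1) sig (conv (nb rho 1) (rest_law N lam A)) y Psi mu.
Proof.
have s1 := nb_summable rho_range Rlt_0_1.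
split=> //.
- exact: summable_conv.
- by apply: moment1_conv => //; exact: nb_moment1 rho_range Rlt_0_1.
- move=> t; rewrite FT_conv // FT_nb ?FT_rest ?W_add //; [ring | exact: Rlt_0_1].
- exact: free_decay.
- exact: free_centered_decay.
Qed.

End Removed.

(** * The mean of a saturable queue *)

Section SaturableQueue.

Variable j : 'I_n.
Hypothesis j_F : j \in F.

Let all_law := rest_law N lam set0.
Let other_law := rest_law N lam [set j].
Let y := sum_law p (free set0).

Let card_set0 : (#|@set0 'I_n| <= l)%N.
Proof. by rewrite cards0. Qed.

(** If [psi j] were 1, the law of queue [j] would be negative binomial of exponent
[xi j] and satisfy [i nb_xi(i) = xi ((1 + al) nb_{xi + 1}(i) - nb_xi(i))], with
[nb_{xi + 1}] the convolution of [nb_1] and [nb_xi]. This is the defect in that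
identity after convolution with the other queues. *)
Definition size_bias_remainder (i : nat) : R :=
  conv (weighted (p j)) other_law i
  + 1 * (xi j * all_law i + (- (xi j * (1 + al))) * conv (nb rho 1) all_law i).

Let s_other : summable other_law.
Proof. exact: sum_law_summable. Qed.

Let s_all : summable all_law.
Proof. exact: sum_law_summable. Qed.

Let s_shifted : summable (conv (nb rho 1) all_law).
Proof. by apply: summable_conv => //; exact: nb_summable rho_range Rlt_0_1. Qed.

Let s_scaled u w (f h : nat -> R) : summable f -> summable h ->
  summable (fun i => u * f i + w * h i).
Proof.
move=> sf sh; apply: (@summable_le _ (fun i => Rabs u * Rabs (f i) + Rabs w * Rabs (h i))).
  by move=> i; rewrite -!Rabs_mult; exact: Rabs_triang.
by apply: ex_series_plus; exact: ex_series_scal_l.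
Qed.

Lemma size_bias_remainder_summable : summable size_bias_remainder.
Proof.
have s1 := summable_conv (p_moment1 j : summable (weighted (p j))) s_other.
have s2 := s_scaled (xi j) (- (xi j * (1 + al))) s_all s_shifted.
have := s_scaled 1 1 s1 s2; apply: ex_series_ext => i.
by rewrite /size_bias_remainder Rmult_1_l.
Qed.

Let seqFj := [seq k <- seqF | k != j].

Let FT_all t : FT all_law t = (FT (p j) t * FT other_law t)%C.
Proof.
rewrite !FT_sum_law // !big_filter (bigD1 j) ?inE //=; congr Cmult.
by apply: eq_bigl => k; rewrite !inE.
Qed.

Let FT_other t : (W rho (xi j) t * FT other_law t =
  W rho x t * \big[Cmult/RtoC 1]_(k <- seqFj) psi k t * FT y t)%C.
Proof.
rewrite !FT_sum_law // !big_filter (bigID (mem F)) /= Cmult_assoc; congr Cmult; last first.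
  apply: eq_bigl => k; rewrite !inE; case kF: (k \in F); rewrite ?andbF // !andbT.
  by apply/eqP => kj; move: kF; rewrite kj j_F.
have -> : W rho x t = (W rho (xi j) t * \big[Cmult/RtoC 1]_(k in F | k != j) W rho (xi k) t)%C.
  have -> : W rho x t = \big[Cmult/RtoC 1]_(k in F) W rho (xi k) t.
    by rewrite /x /xi_sum; apply: (big_morph (fun s => W rho s t));
      [move=> s u; exact: W_add | exact: W_zero].
  by rewrite (bigD1 j).
rewrite -Cmult_assoc; congr Cmult; rewrite big_filter_cond -big_split /=.
apply: eq_big => [k|k /andP[_ kF]]; first by rewrite !inE andbC.
exact: FT_saturable.
Qed.

(** Differentiating [W psi_j] in the transform of the weighted law, the derivative
of [W] cancels against the other two terms and [W psi_j'] is left, which has the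
full exponent [x] when multiplied by the other saturable factors. *)
Lemma size_bias_remainder_decay t : 0 < t < PI ->
  Cmod (FT size_bias_remainder t) <=
    K * QB * (Rpower (Cmod (omega rho t)) x * exp (- (c * (sig * t) ^ 2))).
Proof.
move=> ht.
have ht' : 0 <= t <= PI by lra.
have [dpsi [D le_d]] := reg_psi reg t j_F.
have D1 := FT_derive t (p_summable j) (p_moment1 j).
have D2 := derC_mult (W_derive rho_range (xi j) t) D.
have {}D2 := derC_ext (fun u => esym (FT_saturable u j_F)) D2.
have eqd := derC_unique D1 D2.
have FTw : FT (weighted (p j)) t =
   (RtoC (xi j) * (RtoC (1 + al) * omega rho t - RtoC 1) * FT (p j) t - Ci * W rho (xi j) t * dpsi)%C.
  have i2 : (Ci * Ci = - RtoC 1)%C by rewrite /Ci /Cmult /Copp /RtoC /=; congr pair; ring.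
  have -> : FT (weighted (p j)) t = (- (Ci * Ci) * FT (weighted (p j)) t)%C by rewrite i2; ring.
  have -> : (- (Ci * Ci) * FT (weighted (p j)) t = - Ci * (Ci * FT (weighted (p j)) t))%C by ring.
  rewrite eqd FT_saturable //.
  have -> : (RtoC (xi j) * (RtoC (1 + al) * omega rho t - RtoC 1) * (W rho (xi j) t * psi j t) =
    - (Ci * Ci) * RtoC (xi j) * (RtoC (1 + al) * omega rho t - RtoC 1) * (W rho (xi j) t * psi j t))%C.
    by rewrite i2; ring.
  by rewrite -/al; ring.
have -> : FT size_bias_remainder t =
    (- Ci * dpsi * (W rho (xi j) t * FT other_law t))%C.
  have s1 := summable_conv (p_moment1 j : summable (weighted (p j))) s_other.
  have s2 := s_scaled (xi j) (- (xi j * (1 + al))) s_all s_shifted.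
  have s3 : summable (fun i => xi j * all_law i).
    by apply: (@summable_le _ (fun i => Rabs (xi j) * Rabs (all_law i))) => [i|];
      [rewrite Rabs_mult; exact: Rle_refl | exact: ex_series_scal_l].
  rewrite FT_lin // FT_lin // FT_scal !FT_conv //; [|exact: nb_summable rho_range Rlt_0_1|exact: p_moment1].
  rewrite FT_nb // ?W_one //; last exact: Rlt_0_1.
  by rewrite FT_all FTw RtoC_opp RtoC_mult; ring.
have [le_prod _] := @derC_prod_bound _ psi K Q seqFj t K_ge0 Q_ge1
  (fun k ks => psi_le (etrans (esym (mem_seqF k)) (mem_subseq (filter_subseq _ _) ks)) ht')
  (fun k ks => reg_psi reg t (etrans (esym (mem_seqF k)) (mem_subseq (filter_subseq _ _) ks))).
have le_QB : Q ^ size seqFj <= QB.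
  apply: pow_le_QB; apply: Rle_trans size_saturable_le; apply: le_INR; apply/leP.
  by rewrite size_filter; exact: count_size.
have dec := free_decay card_set0 ht'.
have modulus (a b e f : C) : Cmod (- Ci * a * (b * e * f)) = Cmod a * Cmod b * (Cmod e * Cmod f).
  by rewrite !Cmod_mult Cmod_opp Cmod_Ci; ring.
rewrite FT_other modulus Cmod_W //.
have wp := Rpower_gt0 (Cmod (omega rho t)) x.
have h1 : Cmod dpsi * Rpower (Cmod (omega rho t)) x <= K * Rpower (Cmod (omega rho t)) x.
  by apply: Rmult_le_compat_r; [lra | exact: le_d].
have h2 : Cmod (\big[Cmult/RtoC 1]_(k <- seqFj) psi k t) * Cmod (FT y t) <=
    QB * exp (- (c * (sig * t) ^ 2)).
  apply: Rmult_le_compat; try exact: Cmod_ge_0; last exact: dec.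
  exact: Rle_trans le_prod le_QB.
have -> : K * QB * (Rpower (Cmod (omega rho t)) x * exp (- (c * (sig * t) ^ 2))) =
  K * Rpower (Cmod (omega rho t)) x * (QB * exp (- (c * (sig * t) ^ 2))) by ring.
apply: Rmult_le_compat => //; apply: Rmult_le_pos; try exact: Cmod_ge_0.
by apply: Rlt_le.
Qed.

End SaturableQueue.

End OneNetwork.

(** * Estimates uniform over the networks *)

Definition rest_prob (n : nat) (N : network n) (lam : R) (A : {set 'I_n})
    (q : 'I_n -> nat) : R :=
  if (\sum_(k in A) q k <= customers N)%N
  then rest_law N lam A (customers N - \sum_(k in A) q k)%N else 0.

Lemma rest_law_set0 (n : nat) (N : network n) (lam : R) i :
  rest_law N lam set0 i = sum_law (X_pmf N lam) (index_enum 'I_n) i.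
Proof.
by rewrite /rest_law (eq_filter (a2 := predT)) ?filter_predT // => k; rewrite inE.
Qed.

Lemma rest_prob_set0 (n : nat) (N : network n) (lam : R) q :
  rest_prob N lam set0 q = total_prob N lam.
Proof. by rewrite /rest_prob big_set0 /= subn0 rest_law_set0. Qed.

Lemma big_opp (I : finType) (P : pred I) (f : I -> R) :
  - (\big[Rplus/0]_(k | P k) f k) = \big[Rplus/0]_(k | P k) - f k.
Proof.
by apply: (big_morph Ropp); [move=> a b; ring | exact: Ropp_0].
Qed.

Lemma INR_sum (I : finType) (P : pred I) (q : I -> nat) :
  INR (\sum_(k | P k) q k)%N = \big[Rplus/0]_(k | P k) INR (q k).
Proof. by apply: (big_morph INR); [exact: plus_INR | by []]. Qed.

(** Raising the exponent by one leaves the limit density at [x] unchanged: hence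
the shifted law in the mean of a saturable queue has the same main term. *)
Lemma gamma_density_shift (x : R) : 1 <= x ->
  gamma_density (x + 1) x = gamma_density x x.
Proof.
move=> x1; have G0 := Gamma_gt0 x1; rewrite /gamma_density Gamma_S //.
rewrite (_ : x + 1 - 1 = (x - 1) + 1); last ring.
by rewrite Rpower_plus Rpower_1; [field; lra | lra].
Qed.

Lemma eps_ge_inv_alpha (B K Kg r : R) (n : nat) (N : network n) lam rho F xi psi :
  0 < Kg -> 0 < r <= 1 -> regular_network B K Kg r N lam rho F xi psi ->
  0 < / alpha rho <= eps N lam rho F xi r.
Proof.
move=> Kg0 hr reg; have L0 := lyapunov_gt0 Kg0 hr reg.
have rho_range := reg_rho reg.
have al0 : 0 < alpha rho by apply: Rdiv_lt_0_compat; lra.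
have aV := Rinv_0_lt_compat _ al0; split=> //.
rewrite /eps; set t := sigma_hat N lam F / _.
have t2 := pow2_ge_0 t.
have h1 := Rmult_lt_0_compat _ _ L0 (Rpower_gt0 t (2 + r)).
have h2 := Rmult_lt_0_compat _ _ L0 (Rpower_gt0 t (xi_sum F xi - 1)).
rewrite /Rdiv Rmult_1_l; lra.
Qed.

(** Outside [A] the centre of the local limit is [mu + x alpha], which differs from
[M - sum_A q] by the deviation of the means of the saturable queues from
[x alpha], bounded by [B K], and by [sum_A (m - q)]. For a saturable queue the
size-biased law is expanded with [size_bias_remainder], and the main terms of
the two laws in it combine to [g xi_j alpha], which is [g m_j] up to a bounded
error. *)
Theorem network_estimates (B K Kg r : R) (l : nat) :
  1 <= B -> 0 <= K -> 0 < Kg -> 0 < r <= 1 ->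
  exists tau C, 0 < tau /\ 0 < C /\
  forall n (N : network n) lam rho F xi psi,
  regular_network B K Kg r N lam rho F xi psi ->
  sigma_hat N lam F / alpha rho <= tau -> lyapunov N lam F r <= tau ->
  let g := gamma_density (xi_sum F xi) (xi_sum F xi) in
  let e := eps N lam rho F xi r in
  [/\ 0 < g, g / 2 <= alpha rho * total_prob N lam /\ / C <= g,
      forall (A : {set 'I_n}) q, (forall k, k \in A -> k \notin F) -> (#|A| <= l)%N ->
        Rabs (alpha rho * rest_prob N lam A q - g) <=
        C * (e + Rabs (\big[Rplus/0]_(k in A) (X_mean N lam k - INR (q k))) / alpha rho) &
      forall j, j \in F ->
        alpha rho / 2 <= X_mean N lam j /\
        Rabs (alpha rho * conv (weighted (X_pmf N lam j)) (rest_law N lam [set j]) (customers N)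
              - g * X_mean N lam j) <= C * e * X_mean N lam j].
Proof.
move=> B1 K0 Kg0 hr.
have Kg2 : 0 < Kg ^ 2 by apply: pow_lt.
pose c := / (36 * Kg ^ 2); have c0 : 0 < c by apply: Rinv_0_lt_compat; lra.
pose QB := Rpower (1 + K * PI) B; pose KPsi := B * K * QB.
have QB0 : 0 < QB := Rpower_gt0 _ _.
have BK0 : 0 <= B * K by apply: Rmult_le_pos; lra.
have KPsi0 : 0 <= KPsi by apply: Rmult_le_pos; lra.
have [C0 [C00 lim]] := negative_binomial_limit B1.
have [C1 [C10 local]] := uniform_local_limit B1 c0 KPsi0.
have [C2 [C20 rem]] := coef_le_rate c0.
(* truncation level for which, with [t1] below, [l + 1] queues carry at most half
   of [gamma^2] *)
pose d := / (8 * Kg * INR l.+1).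
have l0 := INR_S_gt0 l.
have l1 : 1 <= INR l.+1 by rewrite S_INR; have := pos_INR l; lra.
have d0 : 0 < d by apply: Rinv_0_lt_compat; apply: Rmult_lt_0_compat; lra.
have dr := Rpower_gt0 d r.
pose C3 := C1 * (1 + 8 * Kg ^ 2 + B * K).
have C30 : 0 < C3 by apply: Rmult_lt_0_compat; lra.
pose D := C1 * (2 + 8 * Kg ^ 2 + B * K).
have D0 : 0 < D by apply: Rmult_lt_0_compat; lra.
(* thresholds: [t1] for the negligibility of [l + 1] queues, [t2] for [sig >= 1],
   [t3] for [alpha] to exceed twice the deviations of the saturable means, [t4]
   for the total probability to keep half of its main term *)
pose t1 := Rpower d r / (32 * INR l.+1 * Kg ^ 2).
have t10 : 0 < t1.
  by apply: Rdiv_lt_0_compat => //; apply: Rmult_lt_0_compat => //; lra.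
pose t2 := / (16 * Kg ^ 2); have t20 : 0 < t2 by apply: Rinv_0_lt_compat; lra.
pose t3 := / (2 * (B * K) + 2 * K + 1); have t30 : 0 < t3 by apply: Rinv_0_lt_compat; lra.
pose t4 := / (2 * C0 * D).
have t40 : 0 < t4 by apply: Rinv_0_lt_compat; apply: Rmult_lt_0_compat; lra.
pose tau := Rmin (Rmin t1 t2) (Rmin t3 t4).
have tau0 : 0 < tau by do 2![apply: Rmin_pos] => //; apply: Rmin_pos.
have tau1 : tau <= t1 by apply: Rle_trans (Rmin_l _ _) (Rmin_l _ _).
have tau2 : tau <= t2 by apply: Rle_trans (Rmin_l _ _) (Rmin_r _ _).
have tau3 : tau <= t3 by apply: Rle_trans (Rmin_r _ _) (Rmin_l _ _).
have tau4 : tau <= t4 by apply: Rle_trans (Rmin_r _ _) (Rmin_r _ _).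
clearbody tau.
have tau_le1 : tau <= 1.
  apply: Rle_trans tau3 _; rewrite -[X in _ <= X]Rinv_1.
  by apply: Rinv_le_contravar; lra.
pose Cj := 2 * (C2 * (K * QB) * (1 + 8 * Kg ^ 2) + 3 * B * C3 + C0 * K).
have KQ0 : 0 <= C2 * (K * QB).
  by apply: Rmult_le_pos; [lra | apply: Rmult_le_pos; lra].
have Cj0 : 0 <= Cj.
  have := Rmult_le_pos _ _ KQ0 (ltac:(lra) : 0 <= 1 + 8 * Kg ^ 2).
  have := Rmult_le_pos _ _ (ltac:(lra) : 0 <= 3 * B) (Rlt_le _ _ C30).
  have := Rmult_le_pos _ _ (Rlt_le _ _ C00) K0.
  by rewrite /Cj; lra.
exists tau, (C0 + 2 * C0 + C3 + Cj); split=> //; split; first lra.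
move=> n N lam rho F xi psi reg ht hL g e.
set al := alpha rho in ht *; set sig := sigma_hat N lam F in ht.
set L := lyapunov N lam F r in hL; set x := xi_sum F xi in g *.
have rho_range := reg_rho reg.
have al0 : 0 < al by apply: Rdiv_lt_0_compat; lra.
have sig0 : 0 < sig := reg_sigma reg.
have x1 : 1 <= x := xi_sum_ge1 reg.
have xB : x <= B := reg_xi_sum reg.
have small : INR l.+1 * (8 * (d ^ 2 + L / Rpower d r)) <= / (2 * Kg ^ 2).
  have e1 : INR l.+1 * (8 * d ^ 2) = / (8 * Kg ^ 2) * / INR l.+1 by rewrite /d; field; lra.
  have i1 : / INR l.+1 <= 1 by rewrite -[X in _ <= X]Rinv_1; apply: Rinv_le_contravar; lra.
  have p8 : 0 < / (8 * Kg ^ 2) by apply: Rinv_0_lt_compat; lra.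
  have e2 : INR l.+1 * (8 * (L / Rpower d r)) <= INR l.+1 * (8 * (t1 / Rpower d r)).
    apply: Rmult_le_compat_l; first lra; apply: Rmult_le_compat_l; first lra.
    by apply: Rmult_le_compat_r; [apply: Rlt_le; exact: Rinv_0_lt_compat | lra].
  have e3 : INR l.+1 * (8 * (t1 / Rpower d r)) = 2 * / (8 * Kg ^ 2) by rewrite /t1; field; lra.
  have e4 : / (2 * Kg ^ 2) = 4 * / (8 * Kg ^ 2) by field; lra.
  have e5 : / (8 * Kg ^ 2) * / INR l.+1 <= / (8 * Kg ^ 2) * 1 by apply: Rmult_le_compat_l; lra.
  lra.
have L8 : 8 * Kg ^ 2 * L < 1.
  have h : 8 * Kg ^ 2 * L <= 8 * Kg ^ 2 * t2 by apply: Rmult_le_compat_l; lra.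
  have : 8 * Kg ^ 2 * t2 = / 2 by rewrite /t2; field; lra.
  lra.
have sig1 : 1 <= sig := sigma_hat_ge1 hr reg L8.
have sigV : / sig <= 8 * Kg ^ 2 * L := inv_sigma_le hr reg sig1.
set t := sig / al in ht.
have t0 : 0 < t by apply: Rdiv_lt_0_compat.
have al_eq : / al = t * / sig by rewrite /t; field; lra.
have sigV1 : 0 < / sig <= 1.
  split; first exact: Rinv_0_lt_compat.
  by rewrite -[X in _ <= X]Rinv_1; apply: Rinv_le_contravar; lra.
have alV : 0 < / al <= tau.
  by split; [exact: Rinv_0_lt_compat | rewrite al_eq; nra].
have al_big : 2 * (B * K) + 2 * K + 1 <= al.
  rewrite -(Rinv_inv al) -(Rinv_inv (2 * (B * K) + 2 * K + 1)).
  by apply: Rinv_le_contravar; [lra | rewrite -/t3; lra].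
have sig_al : sig <= al.
  have -> : sig = t * al by rewrite /t; field; lra.
  have : t * al <= 1 * al by apply: Rmult_le_compat_r; lra.
  lra.
have L0 : 0 < L.
  apply: (Rmult_lt_reg_l (8 * Kg ^ 2)); first lra.
  by rewrite Rmult_0_r; lra.
have tx : 0 < Rpower t (x - 1) <= 1.
  by split; [exact: Rpower_gt0 | apply: Rpower_le_1; lra].
have t2r := Rpower_gt0 t (2 + r); have tt := pow2_ge_0 t.
have e_eq : e = t ^ 2 + / al + L * Rpower t (2 + r) + L * Rpower t (x - 1).
  by rewrite /e /eps -/al -/sig -/t -/L -/x; field; lra.
have Lt0 : 0 < L * Rpower t (2 + r) by apply: Rmult_lt_0_compat.
have Ltx : 0 < L * Rpower t (x - 1) by apply: Rmult_lt_0_compat; lra.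
have e_al : / al <= e by lra.
have e0 : 0 < e by lra.
have rate_e : error_rate al sig x <= (1 + 8 * Kg ^ 2) * e.
  rewrite /error_rate -/t.
  have h : / sig * Rpower t (x - 1) <= 8 * Kg ^ 2 * L * Rpower t (x - 1).
    by apply: Rmult_le_compat_r; lra.
  have : 0 <= 8 * Kg ^ 2 * (t ^ 2 + / al + L * Rpower t (2 + r)) by apply: Rmult_le_pos; lra.
  rewrite e_eq; lra.
have rate_shift : error_rate al sig (x + 1) <= error_rate al sig x.
  rewrite /error_rate -/t; apply: Rplus_le_compat_l; apply: Rmult_le_compat_l; first lra.
  by apply: Rpower_antitone; lra.
have rate_tau : error_rate al sig x <= (2 + 8 * Kg ^ 2) * tau.
  rewrite /error_rate -/t.
  have h1 : t ^ 2 <= tau.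
    rewrite /= Rmult_1_r -[X in _ <= X]Rmult_1_r; apply: Rmult_le_compat; lra.
  have h2 : / sig * Rpower t (x - 1) <= 8 * Kg ^ 2 * L * 1 by apply: Rmult_le_compat; lra.
  have h3 : 8 * Kg ^ 2 * L <= 8 * Kg ^ 2 * tau by apply: Rmult_le_compat_l; lra.
  lra.
have al1 : 1 <= alpha rho by rewrite -/al; lra.
have [[gC0 gC0'] _ _ _] := lim rho x x rho_range al1 ltac:(lra) ltac:(lra).
rewrite -/g in gC0 gC0'.
have g0 : 0 < g by apply: Rlt_le_trans gC0; exact: Rinv_0_lt_compat.
have means := saturable_means K0 reg; rewrite -/al -/x in means.
set mF := \big[Rplus/0]_(k in F) _ in means.
have mF_big : al / 2 <= mF.
  move/Rabs_le_between: means; have : 1 * al <= x * al by apply: Rmult_le_compat_r; lra.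
  lra.
pose mu A := \big[Rplus/0]_(k <- free_queues F A) X_mean N lam k.
have mu_ge0 A : 0 <= mu A.
  apply: (big_ind (fun y => 0 <= y)) => [|y z|k _]; [exact: Rle_refl | lra |].
  by apply: Rlt_le; exact: X_mean_gt0 (reg_closed reg) (reg_mean reg) k.
have total (A : {set 'I_n}) : (forall k, k \in A -> k \notin F) ->
    INR (customers N) = \big[Rplus/0]_(k in A) X_mean N lam k + mF + mu A.
  move=> AF; rewrite -(X_mean_total (reg_mean reg)) (bigID (mem A)) /= Rplus_assoc.
  congr Rplus; rewrite (bigID (mem F)) /= /mu big_filter; congr Rplus.
  apply: eq_bigl => k; case kF: (k \in F); rewrite ?andbF // andbT.
  by apply/negP => /AF; rewrite kF.
have rest_est (A : {set 'I_n}) q : (forall k, k \in A -> k \notin F) -> (#|A| <= l)%N ->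
  Rabs (al * rest_prob N lam A q - g) <= C1 * (error_rate al sig x + B * K * / al
    + Rabs (\big[Rplus/0]_(k in A) (X_mean N lam k - INR (q k))) / al)
    + 2 * C0 * (Rabs (\big[Rplus/0]_(k in A) (X_mean N lam k - INR (q k))) / al).
  move=> AF cardA; set S := \big[Rplus/0]_(k in A) _.
  have S_eq : S = \big[Rplus/0]_(k in A) X_mean N lam k - INR (\sum_(k in A) q k)%N.
    by rewrite INR_sum /Rminus big_opp -big_split.
  have S0 : 0 <= Rabs S / al by apply: Rmult_le_pos; [exact: Rabs_pos | lra].
  have r0 : 0 <= error_rate al sig x.
    by have [? ? ?] := rate_terms x al0 sig0; rewrite /error_rate; lra.
  have BKa : 0 <= B * K * / al by apply: Rmult_le_pos; lra.
  have tot := total A AF; rewrite /rest_prob; case: leqP => hq.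
    set M' := (customers N - _)%N.
    have M'_eq : INR M' = INR (customers N) - INR (\sum_(k in A) q k)%N.
      by rewrite /M' -minusE minus_INR //; apply/leP.
    have := local rho x x sig (rest_law N lam A) _ _ _ _ M' rho_range al1
      ltac:(lra) ltac:(lra) (conj sig0 sig_al) (free_law reg A) (free_variance reg A)
      (rest_perturbed K0 Kg0 hr reg d0 small AF cardA).
    rewrite -/al -/g -[\big[_/_]_(k <- _) _]/(mu A) => h; apply: Rle_trans h _.
    have -> : INR M' - mu A - x * al = (mF - x * al) + S by rewrite M'_eq S_eq tot; ring.
    have h1 : Rabs (mF - x * al + S) / al <= B * K * / al + Rabs S / al.
      rewrite -Rmult_plus_distr_r; apply: Rmult_le_compat_r; first lra.
      by apply: Rle_trans (Rabs_triang _ _) _; apply: Rplus_le_compat_r.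
    have h2 : C1 * (error_rate al sig x + Rabs (mF - x * al + S) / al) <=
       C1 * (error_rate al sig x + B * K * / al + Rabs S / al) by apply: Rmult_le_compat_l; lra.
    have : 0 <= 2 * C0 * (Rabs S / al) by apply: Rmult_le_pos; lra.
    lra.
  (* more customers in [A] than in the network: the left-hand side is [g], and
     [sum_A (m - q)] is at least of order [alpha] *)
  rewrite Rmult_0_r Rminus_0_l Rabs_Ropp (Rabs_pos_eq g); last lra.
  have hq' : INR (customers N) < INR (\sum_(k in A) q k)%N by apply: lt_INR; apply/ltP.
  have muA := mu_ge0 A.
  have hS : al / 2 <= Rabs S by rewrite Rabs_left1; lra.
  have hS2 : / 2 <= Rabs S / al.
    by apply: (proj1 (Rle_div_r _ _ _ al0)); lra.
  have : 2 * C0 * / 2 <= 2 * C0 * (Rabs S / al) by apply: Rmult_le_compat_l; lra.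
  have : 0 <= C1 * (error_rate al sig x + B * K * / al + Rabs S / al) by apply: Rmult_le_pos; lra.
  lra.
have set0F (k : 'I_n) : k \in set0 -> k \notin F by rewrite inE.
have card0 : (#|@set0 'I_n| <= l)%N by rewrite cards0.
have rate_C3 (A : {set 'I_n}) : (forall k, k \in A -> k \notin F) -> C1 * (error_rate al sig x + B * K * / al) <= C3 * e.
  move=> _; rewrite /C3 (Rmult_assoc C1); apply: Rmult_le_compat_l; first lra.
  have : B * K * / al <= B * K * e by apply: Rmult_le_compat_l.
  lra.
have total_est : Rabs (al * total_prob N lam - g) <= C1 * (error_rate al sig x + B * K * / al).
  have := rest_est set0 (fun=> 0%N) set0F card0.
  by rewrite rest_prob_set0 big_set0 Rabs_R0 /Rdiv Rmult_0_l Rmult_0_r !Rplus_0_r.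
split=> //.
- split.
    have h1 : C1 * (error_rate al sig x + B * K * / al) <= D * tau.
      rewrite /D (Rmult_assoc C1); apply: Rmult_le_compat_l; first lra.
      have : B * K * / al <= B * K * tau by apply: Rmult_le_compat_l; lra.
      lra.
    have h2 : D * tau <= D * t4 by apply: Rmult_le_compat_l; lra.
    have h3 : D * t4 = / C0 / 2 by rewrite /t4; field; lra.
    move/Rabs_le_between: total_est; lra.
  apply: Rle_trans gC0; apply: Rinv_le_contravar; lra.
- move=> A q AF cardA; apply: Rle_trans (rest_est A q AF cardA) _.
  set S := Rabs _ / al.
  have S0 : 0 <= S by apply: Rmult_le_pos; [exact: Rabs_pos | lra].
  have h1 := rate_C3 A AF.
  have h2 : C1 * S <= C3 * S.
    apply: Rmult_le_compat_r => //; rewrite /C3 -{1}(Rmult_1_r C1).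
    by apply: Rmult_le_compat_l; lra.
  have h3 : 0 <= C0 * S by apply: Rmult_le_pos; lra.
  have h4 : 0 <= (3 * C0 + Cj) * e by apply: Rmult_le_pos; lra.
  have h5 : 0 <= Cj * S by apply: Rmult_le_pos.
  lra.
move=> j jF.
have mj := saturable_mean reg jF; rewrite -/al in mj.
have xi1 := reg_xi reg jF; have xix := xi_le_sum reg jF; rewrite -/x in xix.
set m := X_mean N lam j in mj *.
have m_big : al / 2 <= m.
  move/Rabs_le_between: mj; have : 1 * al <= xi j * al by apply: Rmult_le_compat_r; lra.
  lra.
split=> //.
set all_law := rest_law N lam set0; set M := customers N.
have total_eq : total_prob N lam = all_law M by rewrite /all_law rest_law_set0.
rewrite total_eq in total_est.
have shifted := local rho (x + 1) x sig (conv (nb rho 1) all_law) _ _ _ _ M rho_range al1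
  ltac:(lra) ltac:(lra) (conj sig0 sig_al) (free_law reg set0) (free_variance reg set0)
  (rest_perturbed_shifted K0 Kg0 hr reg d0 small set0F card0).
rewrite -/al gamma_density_shift // -/g -[\big[_/_]_(k <- _) _]/(mu set0) in shifted.
have tot := total set0 set0F; rewrite big_set0 Rplus_0_l -/M in tot.
have {}shifted : Rabs (al * conv (nb rho 1) all_law M - g) <= C3 * e.
  apply: Rle_trans shifted _; apply: Rle_trans (rate_C3 set0 set0F).
  apply: Rmult_le_compat_l; first lra; apply: Rplus_le_compat => //.
  have -> : INR M - mu set0 - x * al = mF - x * al by rewrite tot; ring.
  by apply: Rmult_le_compat_r; lra.
have {}total_est := Rle_trans _ _ _ total_est (rate_C3 set0 set0F).
have remM := rem (K * QB) rho sig x _ M (Rmult_le_pos _ _ K0 (Rlt_le _ _ QB0)) rho_range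
  (conj sig0 sig_al) x1 (size_bias_remainder_summable reg j)
  (fun t ht => size_bias_remainder_decay K0 Kg0 hr reg d0 small jF ht).
rewrite -/al in remM.
set cw := conv _ _ M.
have cw_eq : al * cw - g * m = al * size_bias_remainder N lam rho xi j M
    + - (xi j * (al * all_law M - g))
    + xi j * (1 + al) * (al * conv (nb rho 1) all_law M - g)
    + g * - (m - xi j * al).
  by rewrite /size_bias_remainder -/cw -/all_law -/al; ring.
have ale : 1 <= al * e.
  have := Rmult_le_compat_l _ _ _ (Rlt_le _ _ al0) e_al; rewrite Rinv_r; lra.
have C3e : 0 <= C3 * e by apply: Rmult_le_pos; lra.
have b1 : Rabs (al * size_bias_remainder N lam rho xi j M) <=
    al * e * (C2 * (K * QB) * (1 + 8 * Kg ^ 2)).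
  rewrite Rabs_mult (Rabs_pos_eq al); last lra.
  rewrite Rmult_assoc; apply: Rmult_le_compat_l; first lra.
  apply: Rle_trans remM _.
  have -> : e * (C2 * (K * QB) * (1 + 8 * Kg ^ 2)) =
    C2 * (K * QB) * ((1 + 8 * Kg ^ 2) * e) by ring.
  exact: Rmult_le_compat_l.
have b2 : Rabs (- (xi j * (al * all_law M - g))) <= al * e * (B * C3).
  rewrite Rabs_Ropp Rabs_mult (Rabs_pos_eq (xi j)); last lra.
  apply: Rle_trans (_ : _ <= B * (C3 * e)) _.
    by apply: Rmult_le_compat => //; [lra | exact: Rabs_pos | lra].
  have : B * (C3 * e) * 1 <= B * (C3 * e) * al.
    by apply: Rmult_le_compat_l; [apply: Rmult_le_pos; lra | lra].
  lra.
have b3 : Rabs (xi j * (1 + al) * (al * conv (nb rho 1) all_law M - g)) <=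
    al * e * (2 * (B * C3)).
  have p0 : 0 <= xi j * (1 + al) by apply: Rmult_le_pos; lra.
  rewrite Rabs_mult (Rabs_pos_eq (xi j * _)) //.
  have p1 : xi j * (1 + al) <= B * (2 * al) by apply: Rmult_le_compat; lra.
  apply: Rle_trans (_ : _ <= B * (2 * al) * (C3 * e)) _.
    by apply: Rmult_le_compat => //; exact: Rabs_pos.
  lra.
have b4 : Rabs (g * - (m - xi j * al)) <= al * e * (C0 * K).
  rewrite Rabs_mult Rabs_Ropp (Rabs_pos_eq g); last lra.
  have p0 : 0 <= C0 * K by apply: Rmult_le_pos; lra.
  apply: Rle_trans (_ : _ <= C0 * K) _.
    by apply: Rmult_le_compat => //; [lra | exact: Rabs_pos].
  have : 1 * (C0 * K) <= al * e * (C0 * K) by apply: Rmult_le_compat_r.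
  lra.
have b5 : Rabs (al * cw - g * m) <= al * e * (Cj / 2).
  have triangle4 a1 a2 a3 a4 :
      Rabs (a1 + a2 + a3 + a4) <= Rabs a1 + Rabs a2 + Rabs a3 + Rabs a4.
    have := Rabs_triang (a1 + a2 + a3) a4; have := Rabs_triang (a1 + a2) a3.
    have := Rabs_triang a1 a2; lra.
  rewrite cw_eq; apply: Rle_trans (triangle4 _ _ _ _) _; rewrite /Cj; lra.
apply: Rle_trans b5 _.
have h1 : al * (e * (Cj / 2)) <= 2 * m * (e * (Cj / 2)).
  by apply: Rmult_le_compat_r; [apply: Rmult_le_pos; lra | lra].
have h2 : 0 <= (C0 + 2 * C0 + C3) * (e * m) by apply: Rmult_le_pos; [lra | apply: Rmult_le_pos; lra].
lra.
Qed.

(** * Relative errors *)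

(** [X / P] is estimated through numerator and denominator, both scaled by [al] so
that they have the same main term [g], up to the factor [Y]. *)
Lemma relative_error_le (g al P X Y C D E : R) : 0 < C -> 0 < al -> 0 < P -> 0 < Y ->
  / C <= g -> g / 2 <= al * P -> Rabs (al * P - g) <= D ->
  Rabs (al * X - g * Y) <= E * Y ->
  Rabs (X / P / Y - 1) <= 2 * C * (D + E).
Proof.
move=> C0 al0 P0 Y0 gC gP hD hE.
have CV := Rinv_0_lt_compat _ C0.
have aP : 0 < al * P by apply: Rmult_lt_0_compat.
have D0 : 0 <= D := Rle_trans _ _ _ (Rabs_pos _) hD.
have E0 : 0 <= E.
  apply: (Rmult_le_reg_r Y) => //; rewrite Rmult_0_l.
  exact: Rle_trans (Rabs_pos _) hE.
have -> : X / P / Y - 1 = ((al * X - g * Y) - Y * (al * P - g)) / (Y * (al * P)).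
  by field; lra.
have YaP : 0 < Y * (al * P) by apply: Rmult_lt_0_compat.
rewrite /Rdiv Rabs_mult (Rabs_pos_eq (/ _)); last by apply: Rlt_le; exact: Rinv_0_lt_compat.
apply: (proj2 (Rle_div_l _ _ _ YaP)).
apply: Rle_trans (Rabs_triang _ _) _; rewrite Rabs_Ropp (Rabs_mult Y) (Rabs_pos_eq Y); last lra.
have h1 : Y * Rabs (al * P - g) <= Y * D by apply: Rmult_le_compat_l; lra.
have h2 : 1 <= 2 * C * (al * P).
  have h3 : 2 * C * (/ C / 2) = 1 by field; lra.
  have : 2 * C * (/ C / 2) <= 2 * C * (al * P) by apply: Rmult_le_compat_l; lra.
  lra.
have h4 : (D + E) * Y * 1 <= (D + E) * Y * (2 * C * (al * P)).
  by apply: Rmult_le_compat_l => //; apply: Rmult_le_pos; lra.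
lra.
Qed.

Lemma mean_abs_deviation_le (u m : R) : 0 <= u -> 0 <= m ->
  u * Rabs (u - m) <= 3 / 2 * ((u - m) ^ 2 + m ^ 2).
Proof.
move=> u0 m0; have h := Rle_abs (u - m); have a0 := Rabs_pos (u - m).
rewrite -pow2_abs; set a := Rabs _ in h a0 *.
have : u * a <= (m + a) * a by apply: Rmult_le_compat_r; lra.
have := pow2_ge_0 (a - m); have := pow2_ge_0 m; lra.
Qed.

(** The stationary quantities are quotients by the total probability. The mean of
a queue outside [F] is obtained by averaging the estimate for its removal over
its length [i], weighted by [i]: the error [i |i - m|] has mean at most a
multiple of the variance plus [m^2]. *)
Theorem network_relative_errors (B K Kg r : R) (l : nat) :
  1 <= B -> 0 <= K -> 0 < Kg -> 0 < r <= 1 ->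
  exists tau C, 0 < tau /\ 0 < C /\
  forall n (N : network n) lam rho F xi psi,
  regular_network B K Kg r N lam rho F xi psi ->
  sigma_hat N lam F / alpha rho <= tau -> lyapunov N lam F r <= tau ->
  let e := eps N lam rho F xi r in
  let m := X_mean N lam in
  [/\ Rabs (gamma_density (xi_sum F xi) (xi_sum F xi) / (alpha rho * total_prob N lam) - 1)
        <= C * e,
      forall (A : {set 'I_n}) q, (forall k, k \in A -> k \notin F) -> (#|A| <= l)%N ->
        Rabs (rest_prob N lam A q / total_prob N lam - 1) <=
        C * (e + Rabs (\big[Rplus/0]_(k in A) (m k - INR (q k))) / alpha rho),
      forall j, j \notin F -> Rabs (Q_mean N j / m j - 1) <=
        C * (e + (variance N lam j + m j ^ 2) / (m j * alpha rho)) &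
      forall j, j \in F -> Rabs (Q_mean N j / m j - 1) <= C * e].
Proof.
move=> B1 K0 Kg0 hr.
have [tau [C [tau0 [C0 est]]]] := network_estimates l.+1 B1 K0 Kg0 hr.
exists tau, (2 * C * (4 * C)); split=> //; split; first by apply: Rmult_lt_0_compat; lra.
move=> n N lam rho F xi psi reg ht hL e m.
have [g0 [gP gC] restE satE] := est n N lam rho F xi psi reg ht hL.
set g := gamma_density _ _ in g0 gP gC restE satE *; rewrite -/e in restE satE.
set al := alpha rho in gP restE satE *; set P := total_prob N lam in gP *.
have clo := reg_closed reg; have mea := reg_mean reg; have rho_range := reg_rho reg.
have al0 : 0 < al by apply: Rdiv_lt_0_compat; lra.
have P0 : 0 < P := total_prob_gt0 clo mea.
have e0 : 0 < e by have := eps_ge_inv_alpha Kg0 hr reg; rewrite -/e; lra.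
have m0 j : 0 < m j := X_mean_gt0 clo mea j.
have totE : Rabs (al * P - g) <= C * e.
  have := restE set0 (fun=> 0%N) _ _; rewrite rest_prob_set0 big_set0 Rabs_R0 -/P.
  rewrite /Rdiv Rmult_0_l Rplus_0_r; apply; last by rewrite cards0.
  by move=> k; rewrite inE.
have Ce0 : 0 < C * e by apply: Rmult_lt_0_compat.
have scale_le u : 0 <= u -> 2 * C * (C * e + C * (e + u)) <= 2 * C * (4 * C) * (e + u).
  move=> u0; have : 0 <= 2 * C * C * (2 * e + 3 * u).
    by apply: Rmult_le_pos; [apply: Rmult_le_pos; lra | lra].
  lra.
split.
- have aP : 0 < al * P by apply: Rmult_lt_0_compat.
  have -> : g / (al * P) - 1 = (- (al * P - g)) / (al * P) by field; lra.
  rewrite /Rdiv Rabs_mult Rabs_Ropp (Rabs_pos_eq (/ _)); last by apply: Rlt_le; exact: Rinv_0_lt_compat.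
  apply: (proj2 (Rle_div_l _ _ _ aP)); apply: Rle_trans totE _.
  have h1 : / C / 2 <= al * P by lra.
  have h2 : 2 * C * (4 * C) * e * (/ C / 2) = 4 * (C * e) by field; lra.
  have : 2 * C * (4 * C) * e * (/ C / 2) <= 2 * C * (4 * C) * e * (al * P).
    by apply: Rmult_le_compat_l => //; do 2![apply: Rmult_le_pos; try lra].
  lra.
- move=> A q AF cardA.
  have h := restE A q AF (leqW cardA).
  set u := Rabs _ / al in h *.
  have u0 : 0 <= u.
    by apply: Rmult_le_pos; [exact: Rabs_pos | apply: Rlt_le; exact: Rinv_0_lt_compat].
  have -> : rest_prob N lam A q / P - 1 = rest_prob N lam A q / P / 1 - 1 by field; lra.
  apply: Rle_trans (scale_le u u0).
  by apply: relative_error_le gC gP totE _ => //; [lra | rewrite !Rmult_1_r].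
- move=> j jF; rewrite (Q_mean_eq clo mea) -/P.
  have [f2 _] := reg_moments reg jF.
  have jl := X_law clo mea f2.
  set v := variance N lam j in jl *.
  set p := X_pmf N lam j in jl *.
  have p0 i : 0 < p i := X_pmf_gt0 clo mea j i.
  have m0j := m0 j.
  pose R_ i := al * rest_prob N lam [set j] (fun=> i).
  have R_est i : Rabs (R_ i - g) <= C * (e + Rabs (INR i - m j) / al).
    have := restE [set j] (fun=> i) _ _; rewrite big_set1 (Rabs_minus_sym _ (INR i)); apply.
      by move=> k; rewrite inE => /eqP ->.
    by rewrite cards1.
  have cw_eq : al * conv (weighted p) (rest_law N lam [set j]) (customers N) =
      Series (fun i => weighted p i * R_ i).
    rewrite conv_Series -Series_scal_l; apply: Series_ext => i.
    by rewrite /R_ /rest_prob big_set1; ring.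
  have e1 : ex_series (fun i => p i * 1).
    by exists 1; apply: is_series_ext (law_sum jl) => i; rewrite Rmult_1_r.
  have S1 : Series (fun i => p i * 1) = 1.
    by rewrite -[RHS](is_series_unique _ _ (law_sum jl)); apply: Series_ext => i; rewrite Rmult_1_r.
  have em : ex_series (fun i => p i * INR i) by exact: (proj1 (proj2 mea)).
  have ev : ex_series (fun i => p i * (INR i - m j) ^ 2) by exists v; exact: law_variance jl.
  have Sv : Series (fun i => p i * (INR i - m j) ^ 2) = v.
    exact: is_series_unique _ _ (law_variance jl).
  have [eS SS] := Series_lin3 (C * e) (3 / 2 * C / al) (3 / 2 * C / al * m j ^ 2) em ev e1.
  rewrite S1 Sv -[Series (fun i => p i * INR i)]/(m j) in SS.
  have bnd i : Rabs (weighted p i * (R_ i - g)) <= p i * (C * e * INR i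
      + 3 / 2 * C / al * (INR i - m j) ^ 2 + 3 / 2 * C / al * m j ^ 2 * 1).
    have i0 := pos_INR i; have pi0 := p0 i.
    rewrite /weighted Rmult_assoc Rabs_mult (Rabs_pos_eq (p i)); last lra.
    apply: Rmult_le_compat_l; first lra; rewrite Rabs_mult (Rabs_pos_eq (INR i)) //.
    apply: Rle_trans (Rmult_le_compat_l _ _ _ i0 (R_est i)) _.
    have h := mean_abs_deviation_le i0 (Rlt_le _ _ m0j).
    have Ca : 0 <= C * / al by apply: Rlt_le; apply: Rmult_lt_0_compat => //; exact: Rinv_0_lt_compat.
    have := Rmult_le_compat_l _ _ _ Ca h; rewrite /Rdiv; lra.
  have ew : ex_series (fun i => g * weighted p i) by exact: ex_series_scal_l.
  have ed := summable_ex (summable_le bnd eS).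
  have ex_R : ex_series (fun i => weighted p i * R_ i).
    apply: ex_series_ext (ex_series_plus _ _ ed ew) => i.
    by rewrite /plus /=; ring.
  have dev : Rabs (al * conv (weighted p) (rest_law N lam [set j]) (customers N) - g * m j) <=
     C * (e + 3 / 2 * ((v + m j ^ 2) / (m j * al))) * m j.
    have -> : C * (e + 3 / 2 * ((v + m j ^ 2) / (m j * al))) * m j =
      C * e * m j + 3 / 2 * C / al * v + 3 / 2 * C / al * m j ^ 2 * 1 by field; lra.
    rewrite -SS cw_eq.
    have -> : Series (fun i => weighted p i * R_ i) - g * m j =
        Series (fun i => weighted p i * (R_ i - g)).
      have -> : g * m j = Series (fun i => g * weighted p i) by rewrite Series_scal_l.
      by rewrite -Series_minus //; apply: Series_ext => i; ring.
    exact: Series_abs_le.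
  set u := (v + m j ^ 2) / (m j * al) in dev *.
  have u0 : 0 <= u.
    apply: Rmult_le_pos; last by apply: Rlt_le; apply: Rinv_0_lt_compat; exact: Rmult_lt_0_compat.
    have := pow2_ge_0 (m j); suff : 0 <= v by lra.
    rewrite -Sv; apply: Series_ge0 => // i.
    by apply: Rmult_le_pos; [apply: Rlt_le | exact: pow2_ge_0].
  apply: Rle_trans (relative_error_le C0 al0 P0 m0j gC gP totE dev) _.
  have : 0 <= 2 * C * C * (2 * e + 5 / 2 * u).
    by apply: Rmult_le_pos; [apply: Rmult_le_pos; lra | lra].
  lra.
move=> j jF; rewrite (Q_mean_eq clo mea) -/P.
have [_ dev] := satE j jF.
apply: Rle_trans (relative_error_le C0 al0 P0 (m0 j) gC gP totE dev) _.
have : 0 <= 2 * C * C * (2 * e) by apply: Rmult_le_pos; [apply: Rmult_le_pos; lra | lra].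
lra.
Qed.

(** * Uniformity over the sequence of networks *)

(** An estimate valid for large indices becomes uniform by taking the maximum
with the constants of the finitely many others. *)
Lemma uniform_constant (P : nat -> R -> Prop) :
  (forall n k k', k <= k' -> P n k -> P n k') ->
  (exists k, eventually (fun n => P n k)) -> (forall n, exists k, P n k) ->
  exists k, 0 < k /\ forall n, P n k.
Proof.
move=> incr [k [n0 large]] each.
have [k' small] : exists k', forall n, (n < n0)%N -> P n k'.
  elim: (n0) => [|j [k' IH]]; first by exists 0.
  have [k2 hk2] := each j; exists (Rmax k' k2) => n.
  rewrite ltnS leq_eqVlt => /predU1P[->|lt_nj].
    exact: (incr _ _ _ (Rmax_r _ _) hk2).
  by apply: (incr _ _ _ (Rmax_l _ _)); exact: IH.
exists (Rmax 1 (Rmax k k')); split; first by apply: Rlt_le_trans (Rmax_l _ _); lra.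
move=> n; apply: (incr _ _ _ (Rmax_r _ _)); case: (ltnP n n0) => hn.
  by apply: (incr _ _ _ (Rmax_r _ _)); exact: small.
by apply: (incr _ _ _ (Rmax_l _ _)); apply: large; apply/leP.
Qed.

Lemma split_error (x a b : R) : 0 <= a -> 0 <= b -> Rabs x <= a + b ->
  exists e1 e2, Rabs e1 <= a /\ Rabs e2 <= b /\ x = e1 + e2.
Proof.
move=> a0 b0 hx; case: (Rle_lt_dec (Rabs x) a) => h.
  by exists x, 0; rewrite Rabs_R0; repeat split=> //; lra.
case: (Rle_lt_dec 0 x) => x0.
  rewrite (Rabs_pos_eq x x0) in hx h.
  exists a, (x - a); rewrite (Rabs_pos_eq a) // (Rabs_pos_eq (x - a)); last lra.
  by split; [lra | split; lra].
rewrite (Rabs_left x x0) in hx h.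
exists (- a), (x + a); rewrite Rabs_Ropp (Rabs_pos_eq a) // (Rabs_left1 (x + a)); last lra.
by split; [lra | split; lra].
Qed.

Lemma term_le_big (I : finType) (f : I -> R) (i : I) : (forall j, 0 <= f j) ->
  f i <= \big[Rplus/0]_j f j.
Proof.
move=> f0; rewrite (bigD1 i) //= -[X in X <= _]Rplus_0_r; apply: Rplus_le_compat_l.
by apply: (big_ind (fun y => 0 <= y)) => [|y z|//]; [exact: Rle_refl | lra].
Qed.

Lemma bound_by_multiple (d u : R) : 0 < u -> exists k, 0 <= k /\ d <= k * u.
Proof.
move=> u0; exists (Rabs d / u); split.
  by apply: Rmult_le_pos; [exact: Rabs_pos | apply: Rlt_le; exact: Rinv_0_lt_compat].
rewrite (_ : Rabs d / u * u = Rabs d); [exact: Rle_abs | by field; lra].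
Qed.

Lemma rest_prob_bounded (n : nat) (N : network n) (lam : R) :
  closed_network N -> mean_parameter N lam -> forall A : {set 'I_n},
  exists D, forall q, 0 <= rest_prob N lam A q <= D.
Proof.
move=> clo mea A.
have r0 i : 0 <= rest_law N lam A i.
  by apply: sum_law_ge0 => k x; apply: Rlt_le; exact: X_pmf_gt0.
have rs : ex_series (rest_law N lam A).
  by apply: summable_ex; apply: sum_law_summable => k; exact: X_pmf_summable.
exists (Series (rest_law N lam A)) => q; rewrite /rest_prob; case: ifP => _.
  by split=> //; exact: Series_ge_term.
by split; [exact: Rle_refl | exact: Series_ge0].
Qed.

Theorem theorem3p4
  (N : forall n, network n) (lam rho0 : nat -> R)
  (F0 : forall n, {set 'I_n}) (xi : forall n, 'I_n -> R)
  (psi : forall n, 'I_n -> R -> C) (r : R) :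
  (forall n, (1 <= n)%N -> closed_network (N n)) ->
  (forall n, (1 <= n)%N -> mean_parameter (N n) (lam n)) ->
  0 < r <= 1 ->
  assumption_P N lam rho0 F0 xi psi ->
  (forall n (k : 'I_n), k \notin F0 n ->
     abs_moment_finite (N n) (lam n) 2 k /\
     abs_moment_finite (N n) (lam n) (2 + r) k) ->
  eventually (fun n => nondegenerate (N n) (lam n) (rho0 n) (F0 n)) ->
  is_lim_seq (fun n => sigma_hat (N n) (lam n) (F0 n) / alpha (rho0 n)) 0 ->
  is_lim_seq (fun n => lyapunov (N n) (lam n) (F0 n) r) 0 ->
  (exists K, 0 < K /\ forall n, (1 <= n)%N ->
     Rabs (sigma_hat (N n) (lam n) (F0 n))
     <= K * Rabs (gamma_hat (N n) (lam n) (F0 n))) ->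
  (exists B, forall n, (1 <= n)%N -> xi_sum (F0 n) (xi n) <= B) ->
  let eps_ n := eps (N n) (lam n) (rho0 n) (F0 n) (xi n) r in
  let xi_ n := xi_sum (F0 n) (xi n) in
  let p n k := X_pmf (N n) (lam n) k in
  let m n k := X_mean (N n) (lam n) k in
  let ok n := (1 <= n)%N /\ nondegenerate (N n) (lam n) (rho0 n) (F0 n) in
  (* (i) *)
  (exists K, 0 < K /\
     forall n (q : 'I_n -> nat), ok n ->
       (\sum_(k < n) q k)%N = customers (N n) ->
       exists e, Rabs e <= K * Rabs (eps_ n) /\
         Q_law (N n) q =
           alpha (rho0 n) * Gamma (xi_ n)
           / (exp (- xi_ n) * Rpower (xi_ n) (xi_ n - 1))
           * \big[Rmult/1]_(k < n) p n k (q k) * (1 + e)) /\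
  (* (ii) *)
  (forall l : nat, exists K, 0 < K /\
     forall n (q : 'I_n -> nat), ok n -> (l <= n)%N ->
       (forall k : 'I_n, (k < l)%N -> k \notin F0 n) ->
       exists e1 e2, Rabs e1 <= K * Rabs (eps_ n) /\
         Rabs e2 <= K * Rabs (\big[Rplus/0]_(k < n | (k < l)%N)
                                (m n k - INR (q k)) / alpha (rho0 n)) /\
         Q_marginal (N n) l q =
           \big[Rmult/1]_(k < n | (k < l)%N) p n k (q k) * (1 + e1 + e2)) /\
  (* (iii) *)
  (exists K, 0 < K /\
     forall n (j : 'I_n), ok n -> j \notin F0 n ->
       exists e1 e2, Rabs e1 <= K * Rabs (eps_ n) /\
         Rabs e2 <= K * Rabs ((variance (N n) (lam n) j + m n j ^ 2)
                              / (m n j * alpha (rho0 n))) /\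
         Q_mean (N n) j = m n j * (1 + e1 + e2)) /\
  (* (iv) *)
  (exists K, 0 < K /\
     forall n (j : 'I_n), ok n -> j \in F0 n ->
       exists e, Rabs e <= K * Rabs (eps_ n) /\
         Q_mean (N n) j = m n j * (1 + e)).
Proof.
move=> clo mea hr [hrho [hF [hchar [[K [K0 hpsi]] [ximax hxi]]]]] hmom _ hlim hlyap
  [Kg [Kg0 hg]] [B0 hB].
intros eps_ xi_ p m ok.
pose B := Rmax B0 1; have B1 : 1 <= B := Rmax_r _ _.
have reg n : ok n -> regular_network B K Kg r (N n) (lam n) (rho0 n) (F0 n) (xi n) (psi n).
  move=> [n1 [al0 sig0]].
  have rho_range : 0 < rho0 n < 1.
    have [r0 r1] := hrho n n1; split=> //; case: r0 => // r0.
    by move: al0; rewrite /alpha -r0 /Rdiv Rmult_0_l => /Rlt_irrefl.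
  split=> //.
  - exact: clo.
  - exact: mea.
  - exact: hF.
  - by move=> k t; exact: hchar.
  - move=> k t kF; have [dd [Dd le_d]] := hpsi n k t kF.
    by exists dd; split=> //; exact: derC_is_derive.
  - by move=> k kF; case: (hxi n k kF).
  - exact: Rle_trans (hB n n1) (Rmax_l _ _).
  - by move=> k; exact: hmom.
  have := hg n n1; rewrite Rabs_pos_eq; last lra.
  by rewrite Rabs_pos_eq //; exact: sqrt_pos.
have al_gt0 n : ok n -> 0 < alpha (rho0 n) by case=> _ [].
have eps_gt0 n : ok n -> 0 < eps_ n.
  by move=> okn; have := eps_ge_inv_alpha Kg0 hr (reg n okn); rewrite -/(eps_ n); lra.
have P0 n : ok n -> 0 < total_prob (N n) (lam n).
  by move=> [n1 _]; apply: total_prob_gt0; [exact: clo | exact: mea].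
have m0 n j : ok n -> 0 < m n j.
  by move=> [n1 _]; apply: X_mean_gt0; [exact: clo | exact: mea].
have large l : exists C, 0 < C /\ eventually (fun n => ok n ->
  let e := eps_ n in
  [/\ Rabs (gamma_density (xi_ n) (xi_ n) / (alpha (rho0 n) * total_prob (N n) (lam n)) - 1)
        <= C * e,
      forall (A : {set 'I_n}) q, (forall k, k \in A -> k \notin F0 n) -> (#|A| <= l)%N ->
        Rabs (rest_prob (N n) (lam n) A q / total_prob (N n) (lam n) - 1) <=
        C * (e + Rabs (\big[Rplus/0]_(k in A) (m n k - INR (q k))) / alpha (rho0 n)),
      forall j, j \notin F0 n -> Rabs (Q_mean (N n) j / m n j - 1) <=
        C * (e + (variance (N n) (lam n) j + m n j ^ 2) / (m n j * alpha (rho0 n))) &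
      forall j, j \in F0 n -> Rabs (Q_mean (N n) j / m n j - 1) <= C * e]).
  have [tau [C [tau0 [C0 est]]]] := network_relative_errors l B1 (Rlt_le _ _ K0) Kg0 hr.
  exists C; split=> //.
  have /is_lim_seq_spec /(_ (mkposreal tau tau0)) [n1 hn1] := hlim.
  have /is_lim_seq_spec /(_ (mkposreal tau tau0)) [n2 hn2] := hlyap.
  exists (n1 + n2)%N => n /leP le_n okn; apply: est; first exact: reg.
    have := hn1 n (@leP _ _ (leq_trans (leq_addr _ _) le_n)).
    by rewrite /= Rminus_0_r => /Rabs_lt_between; lra.
  have := hn2 n (@leP _ _ (leq_trans (leq_addl _ _) le_n)).
  by rewrite /= Rminus_0_r => /Rabs_lt_between; lra.
(* outside the asymptotic regime there are finitely many networks, and for each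
   of them [eps] is positive, so that any finite error is a multiple of it *)
have single n (D : R) : ok n -> exists k, forall V u, 0 <= V -> u <= D -> u <= k * (eps_ n + V).
  move=> okn; have [k [k0 hk]] := bound_by_multiple D (eps_gt0 n okn); exists k => V u V0 hu.
  have := Rmult_le_pos _ _ k0 V0; lra.
split; [|split; [|split]].
- have [C [C0 hC]] := large 0%N.
  pose P n k := ok n -> Rabs (gamma_density (xi_ n) (xi_ n)
    / (alpha (rho0 n) * total_prob (N n) (lam n)) - 1) <= k * eps_ n.
  have [k [k0 hk]] : exists k, 0 < k /\ forall n, P n k.
    apply: uniform_constant => [n k k' le_k Pk okn||n].
    + by apply: Rle_trans (Pk okn) _; apply: Rmult_le_compat_r le_k; apply: Rlt_le; exact: eps_gt0.
    + by exists C; apply: filter_imp hC => n h okn; case: (h okn).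
    case: (Classical_Prop.classic (ok n)) => [okn|nok]; last by exists 0 => /nok.
    have [k hk] := single n (Rabs (gamma_density (xi_ n) (xi_ n)
      / (alpha (rho0 n) * total_prob (N n) (lam n)) - 1)) okn.
    exists k => _; rewrite -(Rplus_0_r (eps_ n)).
    exact: (hk 0 _ (Rle_refl 0) (Rle_refl _)).
  exists k; split=> // n q okn sum_q.
  set g := gamma_density (xi_ n) (xi_ n) in P hk.
  exists (g / (alpha (rho0 n) * total_prob (N n) (lam n)) - 1); split.
    by rewrite (Rabs_pos_eq (eps_ n)); [exact: hk | apply: Rlt_le; exact: eps_gt0].
  have [n1 _] := okn.
  rewrite (Q_law_eq (clo n n1) (mea n n1) sum_q) /g /gamma_density.
  have x1 : 1 <= xi_ n := xi_sum_ge1 (reg n okn).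
  have G0 := Gamma_gt0 x1; have Pn := P0 n okn; have an := al_gt0 n okn.
  have en := exp_pos (- xi_ n); have rn := Rpower_gt0 (xi_ n) (xi_ n - 1).
  set Pi := \big[Rmult/1]_(i < n) p n i (q i); rewrite -[X in X / _ = _]/Pi.
  by field; repeat split; lra.
- move=> l; have [C [C0 hC]] := large l.
  pose A n := [set k : 'I_n | (k < l)%N].
  pose S n q := Rabs (\big[Rplus/0]_(k in A n) (m n k - INR (q k))) / alpha (rho0 n).
  have S0 n q : ok n -> 0 <= S n q.
    move=> okn; apply: Rmult_le_pos; first exact: Rabs_pos.
    by apply: Rlt_le; apply: Rinv_0_lt_compat; exact: al_gt0.
  pose P n k := ok n -> (l <= n)%N -> (forall k : 'I_n, (k < l)%N -> k \notin F0 n) ->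
    forall q, Rabs (rest_prob (N n) (lam n) (A n) q / total_prob (N n) (lam n) - 1)
      <= k * (eps_ n + S n q).
  have [k [k0 hk]] : exists k, 0 < k /\ forall n, P n k.
    apply: uniform_constant => [n k k' le_k Pk okn ln lF q||n].
    + apply: Rle_trans (Pk okn ln lF q) _; apply: Rmult_le_compat_r le_k.
      by have := eps_gt0 n okn; have := S0 n q okn; lra.
    + exists C; apply: filter_imp hC => n h okn ln lF q; case: (h okn) => _ hA _ _; apply: hA.
        by move=> j; rewrite inE; exact: lF.
      have -> : A n = [set widen_ord ln i | i : 'I_l].
        apply/setP => j; rewrite inE; apply/idP/imsetP => [jl|[i _ ->]]; last exact: (ltn_ord i).
        by exists (Ordinal jl) => //; apply: val_inj.
      by apply: leq_trans (leq_imset_card _ _) _; rewrite card_ord.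
    case: (Classical_Prop.classic (ok n)) => [okn|nok]; last by exists 0 => /nok.
    have [n1 _] := okn.
    have [D hD] := rest_prob_bounded (clo n n1) (mea n n1) (A n).
    have [k hk] := single n (D / total_prob (N n) (lam n) + 1) okn.
    exists k => _ _ _ q; apply: (hk _ _ (S0 n q okn)).
    have Pn := P0 n okn; have PV := Rinv_0_lt_compat _ Pn; have [q0 qD] := hD q.
    apply: Rle_trans (Rabs_triang _ _) _; rewrite Rabs_Ropp Rabs_R1.
    apply: Rplus_le_compat_r; rewrite Rabs_pos_eq; last by apply: Rmult_le_pos; lra.
    by apply: Rmult_le_compat_r; lra.
  exists k; split=> // n q okn ln lF.
  have en := eps_gt0 n okn; have Sn := S0 n q okn; have an := al_gt0 n okn.
  have h := hk n okn ln lF q; rewrite Rmult_plus_distr_l in h.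
  have [e1 [e2 [h1 [h2 h3]]]] := split_error
    (Rmult_le_pos _ _ (Rlt_le _ _ k0) (Rlt_le _ _ en)) (Rmult_le_pos _ _ (Rlt_le _ _ k0) Sn) h.
  exists e1, e2; split; [|split].
  + by rewrite (Rabs_pos_eq (eps_ n)) //; lra.
  + apply: Rle_trans h2 _; apply: Req_le; congr (_ * _).
    rewrite /S /Rdiv Rabs_mult (Rabs_pos_eq (/ _)); last first.
      by apply: Rlt_le; exact: Rinv_0_lt_compat.
    by congr (Rabs _ * _); apply: eq_bigl => i; rewrite inE.
  have [n1 _] := okn.
  have -> : Q_marginal (N n) l q = \big[Rplus/0]_(c : config (N n) |
      [forall i : 'I_n, (i \in A n) ==> (c i == q i :> nat)]) Q_law (N n) (fun i => c i).
    by apply: eq_bigl => c; apply: eq_forallb => i; rewrite inE.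
  rewrite (Q_marginal_eq (clo n n1) (mea n n1)) -/(rest_prob (N n) (lam n) (A n) q).
  have -> : 1 + e1 + e2 = rest_prob (N n) (lam n) (A n) q / total_prob (N n) (lam n) by lra.
  rewrite /Rdiv Rmult_assoc; congr (_ * _).
  by apply: eq_bigl => i; rewrite inE.
- have [C [C0 hC]] := large 0%N.
  pose V n j := (variance (N n) (lam n) j + m n j ^ 2) / (m n j * alpha (rho0 n)).
  have V0 n j : ok n -> j \notin F0 n -> 0 <= V n j.
    move=> okn jF; have [n1 _] := okn.
    apply: Rmult_le_pos; last first.
      apply: Rlt_le; apply: Rinv_0_lt_compat; apply: Rmult_lt_0_compat; [exact: m0 | exact: al_gt0].
    apply: Rplus_le_le_0_compat; last exact: pow2_ge_0.
    apply: Series_ge0 => [|x]; first by case: (hmom n j jF).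
    apply: Rmult_le_pos; [apply: Rlt_le; apply: X_pmf_gt0 | exact: power0_ge0].
      exact: clo.
    exact: mea.
  pose P n k := ok n -> forall j, j \notin F0 n ->
    Rabs (Q_mean (N n) j / m n j - 1) <= k * (eps_ n + V n j).
  have [k [k0 hk]] : exists k, 0 < k /\ forall n, P n k.
    apply: uniform_constant => [n k k' le_k Pk okn j jF||n].
    + apply: Rle_trans (Pk okn j jF) _; apply: Rmult_le_compat_r le_k.
      by have := eps_gt0 n okn; have := V0 n j okn jF; lra.
    + by exists C; apply: filter_imp hC => n h okn; case: (h okn).
    case: (Classical_Prop.classic (ok n)) => [okn|nok]; last by exists 0 => /nok.
    have [k hk] := single n (\big[Rplus/0]_(j < n) Rabs (Q_mean (N n) j / m n j - 1)) okn.
    exists k => _ j jF; apply: (hk _ _ (V0 n j okn jF)).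
    by apply: (term_le_big (f := fun j => Rabs (Q_mean (N n) j / m n j - 1))) => i; exact: Rabs_pos.
  exists k; split=> // n j okn jF.
  have en := eps_gt0 n okn; have Vn := V0 n j okn jF; have mj := m0 n j okn.
  have h := hk n okn j jF; rewrite Rmult_plus_distr_l in h.
  have [e1 [e2 [h1 [h2 h3]]]] := split_error
    (Rmult_le_pos _ _ (Rlt_le _ _ k0) (Rlt_le _ _ en)) (Rmult_le_pos _ _ (Rlt_le _ _ k0) Vn) h.
  exists e1, e2; split; [|split].
  + by rewrite (Rabs_pos_eq (eps_ n)) //; lra.
  + by rewrite -/(V n j) (Rabs_pos_eq (V n j)).
  have -> : 1 + e1 + e2 = Q_mean (N n) j / m n j by lra.
  by field; lra.
have [C [C0 hC]] := large 0%N.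
pose P n k := ok n -> forall j, j \in F0 n ->
  Rabs (Q_mean (N n) j / m n j - 1) <= k * eps_ n.
have [k [k0 hk]] : exists k, 0 < k /\ forall n, P n k.
  apply: uniform_constant => [n k k' le_k Pk okn j jF||n].
  + by apply: Rle_trans (Pk okn j jF) _; apply: Rmult_le_compat_r le_k; apply: Rlt_le; exact: eps_gt0.
  + by exists C; apply: filter_imp hC => n h okn; case: (h okn).
  case: (Classical_Prop.classic (ok n)) => [okn|nok]; last by exists 0 => /nok.
  have [k hk] := single n (\big[Rplus/0]_(j < n) Rabs (Q_mean (N n) j / m n j - 1)) okn.
  exists k => _ j jF; rewrite -(Rplus_0_r (eps_ n)); apply: (hk 0 _ (Rle_refl 0)).
  by apply: (term_le_big (f := fun j => Rabs (Q_mean (N n) j / m n j - 1))) => i; exact: Rabs_pos.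
exists k; split=> // n j okn jF; have mj := m0 n j okn.
exists (Q_mean (N n) j / m n j - 1); split.
  by rewrite (Rabs_pos_eq (eps_ n)); [exact: hk | apply: Rlt_le; exact: eps_gt0].
by field; lra.
Qed.
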